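(* Let $\pi:E\to B$ be a vector bundle with zero section $\iota:B\to E$, and let $\nabla$ be a representation of the Lie algebroid $\pi^*E\to E$ on a vector bundle $F\to E$. For $k\ge0$ let $h_k:\Omega^k(\pi^*E;F)\to\Omega^{k-1}(\pi^*E;F)$ be $$h_k\omega:=\int_0^1\frac1t\,\Psi_t^*(i_{\mathbf{e}}\omega)\,dt .$$ Then the maps $h_k$ give a homotopy between the identity and $\Psi_0^*:=\lim_{t\to0}\Psi_t^*$: $$h_{k+1}\circ\mathrm{d}_\nabla+\mathrm{d}_\nabla\circ h_k=\mathrm{id}-\Psi_0^*.$$ Moreover, for $k>0$ one has $h_{k+1}\circ\mathrm{d}_\nabla+\mathrm{d}_\nabla\circ h_k=\mathrm{id}$, and for $k=0$ one has $h_1\circ\mathrm{d}_\nabla=\mathrm{id}-\mathcal{P}_0\circ\pi^*\circ\iota^*$, i.e. $(h_1\mathrm{d}_\nabla\omega)_v=\omega_v-\mathcal{P}_0(\omega_{0_{\pi(v)}})$ for $\omega\in\Gamma(F)$, $v\in E$.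
   Context: The pullback bundle $\pi^*E\to E$ has fiber $(\pi^*E)_v=E_{\pi(v)}$ at $v\in E$; for $s\in\Gamma(E)$, $\pi^*s(v):=s(\pi(v))$. It is a Lie algebroid over $E$ with anchor the vertical lift $(v_0,v)\mapsto\frac{d}{dt}\big|_{t=0}(v_0+tv)\in T_{v_0}E$ and bracket characterized by $[\pi^*s_1,\pi^*s_2]=0$ for $s_1,s_2\in\Gamma(E)$. The Euler section $\mathbf{e}\in\Gamma(\pi^*E)$ is $\mathbf{e}(v)=v$. A representation $\nabla$ of $\pi^*E$ on $F\to E$ is a flat $\pi^*E$-connection on $F$. Put $\Omega^k(\pi^*E;F)=\Gamma(\wedge^k(\pi^*E)^*\otimes F)$ (zero for $k<0$), with differential $\mathrm{d}_\nabla$ given by the Koszul formula $$\mathrm{d}_\nabla\lambda(\sigma_0,\ldots,\sigma_k)=\sum_i(-1)^i\nabla_{\sigma_i}(\lambda(\ldots,\hat\sigma_i,\ldots))+\sum_{i<j}(-1)^{i+j}\lambda([\sigma_i,\sigma_j],\ldots,\hat\sigma_i,\ldots,\hat\sigma_j,\ldots).$$ $i_{\mathbf{e}}$ is insertion of $\mathbf{e}$ (zero on $\Omega^0$). For $v\in E$ and $t\in[0,1]$, $\mathcal{P}_t:F_{tv}\to F_v$ is $\nabla$-parallel transport along the $\pi^*E$-path $a:[t,1]\to\pi^*E$, $a(s)=v\in E_{\pi(v)}=(\pi^*E)_{sv}$, over the radial curve $\gamma(s)=sv$: $\mathcal{P}_t(\sigma_0)=\sigma(1)$, where $\nabla_a\sigma=0$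 and $\sigma(t)=\sigma_0$. For $t\in(0,1]$, $\omega\in\Omega^k(\pi^*E;F)$ and $u_1,\ldots,u_k\in(\pi^*E)_v$, define $$(\Psi_t^*\omega)_v(u_1,\ldots,u_k):=t^k\,\mathcal{P}_t\big(\omega_{tv}(u_1,\ldots,u_k)\big),$$ using $(\pi^*E)_{tv}=E_{\pi(v)}=(\pi^*E)_v$. The integrand in $h_k$ evaluated at $v$ and $u_1,\dots,u_{k-1}$ equals $t^{k-1}\mathcal{P}_t(\omega_{tv}(v,u_1,\ldots,u_{k-1}))$, so it extends smoothly to $t=0$; $h_0=0$. The limit $\lim_{t\to0}\Psi_t^*$ is taken pointwise. *)

(* Defs.v *)
From HB Require Import structures.
From mathcomp Require Import all_boot all_order all_algebra.
From mathcomp Require Import all_classical all_reals all_analysis.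

Set Implicit Arguments.
Unset Strict Implicit.
Unset Printing Implicit Defensive.

Import Order.TTheory GRing.Theory Num.Theory.
Import numFieldNormedType.Exports.

Local Open Scope classical_set_scope.
Local Open Scope ring_scope.

(* Geometric objects are split into raw data (an atlas, a prebundle) and a
   Prop saying that the data are well behaved (is_manifold, is_vbundle), so
   that total spaces and pullbacks are plain constructions on data.  Likewise
   sections and forms are arbitrary families, and smoothness is a separate
   predicate. *)

(* [Ck k U f] is the usual C^k condition when U is open, its only use. *)
Fixpoint Ck (R : realType) (n k : nat) (U : set 'rV[R]_n)
    (f : 'rV[R]_n -> R) : Prop :=
  (forall x, U x -> {for x, continuous f}) /\
  (if k is k'.+1 then
     forall i : 'I_n,
       (forall x, U x -> derivable f x (delta_mx 0 i)) /\
       Ck k' U (fun x => 'D_(delta_mx 0 i) f x)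
   else True).

Definition smooth_coord (R : realType) (n : nat) (U : set 'rV[R]_n)
    (f : 'rV[R]_n -> R) : Prop :=
  forall k, Ck k U f.

Record atlas (R : realType) := Atlas {
  pt :> Type;
  mdim : nat;
  chart : Type;
  cdom : chart -> set pt;
  crd : chart -> pt -> 'rV[R]_mdim
}.

Section Manifolds.
Context (R : realType) (M : atlas R).

(* The topology induced by the charts. *)
Definition open_in (W : set M) : Prop :=
  forall i : chart M, open (crd i @` (cdom i `&` W)).

(* Smoothness on W, used only for W with [open_in W]. *)
Definition smooth_on (W : set M) (f : M -> R) : Prop :=
  forall i : chart M, exists g : 'rV[R]_(mdim M) -> R,
    smooth_coord (crd i @` (cdom i `&` W)) g /\
    (forall x, cdom i x -> W x -> f x = g (crd i x)).

Record is_manifold : Prop := IsManifold {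
  dom_cover : forall x : M, exists i, cdom i x;
  crd_inj : forall (i : chart M) (x y : M),
    cdom i x -> cdom i y -> crd i x = crd i y -> x = y;
  dom_open : forall j : chart M, open_in (cdom j);
  crd_smooth : forall (j : chart M) (c : 'I_(mdim M)),
    smooth_on (cdom j) (fun x => crd j x 0 c);
  manifold_hausdorff : forall x y : M, x <> y -> exists U V : set M,
    [/\ open_in U, open_in V, U x, V y & U `&` V = set0];
  manifold_second_countable : exists2 D : set (set M), countable D &
    (forall U, D U -> open_in U) /\
    (forall (W : set M) (x : M), open_in W -> W x ->
       exists2 U, D U & U x /\ U `<=` W)
}.

End Manifolds.

Record prebundle (R : realType) (M : atlas R) := Prebundle {
  fib :> M -> vectType R;
  brank : nat;
  tchart : Type;
  tdom : tchart -> set M;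
  triv : tchart -> forall x : M, fib x -> 'rV[R]_brank
}.

Section Bundles.
Context (R : realType) (M : atlas R) (A : prebundle M).

Record is_vbundle : Prop := IsVbundle {
  tdom_cover : forall x : M, exists i : tchart A, tdom i x;
  tdom_open : forall i : tchart A, open_in (tdom i);
  triv_linear : forall (i : tchart A) (x : M), tdom i x ->
    forall (a : R) (e e' : A x),
      triv i (a *: e + e') = a *: triv i e + triv i e';
  triv_bij : forall (i : tchart A) (x : M), tdom i x ->
    bijective (triv i (x := x));
  triv_smooth : forall i j : tchart A, exists T : M -> 'M[R]_(brank A),
    (forall a b, smooth_on (tdom i `&` tdom j) (fun x => T x a b)) /\
    (forall x, tdom i x -> tdom j x ->
       forall e : A x, triv j e = triv i e *m T x)
}.

Definition sect := forall x : M, A x.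

Definition smooth_sect (s : sect) : Prop :=
  forall (i : tchart A) (c : 'I_(brank A)),
    smooth_on (tdom i) (fun x => triv i (s x) 0 c).

(* The c-th vector at x of the local frame given by the trivialization i. *)
Definition frame (i : tchart A) (c : 'I_(brank A)) (x : M) : A x :=
  xget 0 [set e : A x | triv i e = delta_mx 0 c].

Definition total_space : atlas R := {|
  pt := {x : M & A x};
  mdim := mdim M + brank A;
  chart := chart M * tchart A;
  cdom := fun ij => [set p | cdom ij.1 (projT1 p) /\ tdom ij.2 (projT1 p)];
  crd := fun ij p => row_mx (crd ij.1 (projT1 p)) (triv ij.2 (projT2 p))
|}.

Definition tpt (x : M) (e : A x) : total_space :=
  existT (fun x : M => A x : Type) x e.

End Bundles.

Definition pullback (R : realType) (N M : atlas R) (phi : N -> M)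
    (A : prebundle M) : prebundle N := {|
  fib := fun y => A (phi y);
  brank := brank A;
  tchart := tchart A;
  tdom := fun i => phi @^-1` tdom i;
  triv := fun i y => triv i (x := phi y)
|}.

(* A tangent vector at x is seen as a derivation at x, hence an anchor
   A -> TM is given by [rho x a f], the derivative of f along the image of a. *)
Section LieAlgebroids.
Context (R : realType) (M : atlas R) (A : prebundle M).
Context (rho : forall x : M, A x -> (M -> R) -> R).
Context (br : sect A -> sect A -> sect A).

Record is_lie_algebroid : Prop := IsLieAlgebroid {
  br_smooth : forall s t : sect A,
    smooth_sect s -> smooth_sect t -> smooth_sect (br s t);
  br_linear : forall (a : R) (s s' t : sect A),
    smooth_sect s -> smooth_sect s' -> smooth_sect t -> forall x,
    br (fun y => a *: s y + s' y) t x = a *: br s t x + br s' t x;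
  br_antisym : forall s t : sect A,
    smooth_sect s -> smooth_sect t -> forall x, br s t x = - br t s x;
  br_jacobi : forall s t r : sect A,
    smooth_sect s -> smooth_sect t -> smooth_sect r -> forall x,
    br s (br t r) x = br (br s t) r x + br t (br s r) x;
  br_leibniz : forall (s t : sect A) (f : M -> R),
    smooth_sect s -> smooth_sect t -> smooth_on setT f -> forall x,
    br s (fun y => f y *: t y) x = f x *: br s t x + rho (s x) f *: t x
}.

Context (F : prebundle M).

(* [nabla x a s] is the derivative at x of the section s along a in A x. *)
Context (nabla : forall x : M, A x -> sect F -> F x).

Record is_connection : Prop := IsConnection {
  conn_smooth : forall (s : sect A) (r : sect F),
    smooth_sect s -> smooth_sect r -> smooth_sect (fun x => nabla (s x) r);
  conn_linear : forall (x : M) (c : R) (a a' : A x) (r : sect F),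
    smooth_sect r -> nabla (c *: a + a') r = c *: nabla a r + nabla a' r;
  conn_add : forall (x : M) (a : A x) (r r' : sect F),
    smooth_sect r -> smooth_sect r' ->
    nabla a (fun y => r y + r' y) = nabla a r + nabla a r';
  conn_leibniz : forall (x : M) (a : A x) (f : M -> R) (r : sect F),
    smooth_on setT f -> smooth_sect r ->
    nabla a (fun y => f y *: r y) = f x *: nabla a r + rho a f *: r x
}.

Definition is_flat : Prop :=
  forall (s t : sect A) (r : sect F),
    smooth_sect s -> smooth_sect t -> smooth_sect r -> forall x,
    nabla (s x) (fun y => nabla (t y) r)
      - nabla (t x) (fun y => nabla (s y) r) = nabla (br s t x) r.

Definition is_representation : Prop := is_connection /\ is_flat.

(* Values of a k-form on A with values in F; see [is_form]. *)
Definition preform (k : nat) := forall x : M, ('I_k -> A x) -> F x.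

Record is_form (k : nat) (w : preform k) : Prop := IsForm {
  form_multilinear : forall (x : M) (u : 'I_k -> A x) (i : 'I_k) (c : R)
      (e e' : A x),
    w x [eta u with i |-> c *: e + e'] =
    c *: w x [eta u with i |-> e] + w x [eta u with i |-> e'];
  form_alternating : forall (x : M) (u : 'I_k -> A x) (i j : 'I_k),
    i != j -> u i = u j -> w x u = 0;
  form_smooth : forall (i : tchart A) (j : tchart F)
      (b : 'I_k -> 'I_(brank A)) (c : 'I_(brank F)),
    smooth_on (tdom i `&` tdom j)
      (fun x => triv j (w x (fun l => frame i (b l) x)) 0 c)
}.

(* The arguments in the second sum are [s_i, s_j] followed by the s_l,
   l different from i and j, in increasing order of l. *)
Definition koszul (k : nat) (w : preform k) (s : 'I_k.+1 -> sect A) : sect F :=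
  fun x =>
    \sum_(i < k.+1)
       (-1) ^+ i *: nabla (s i x) (fun y => w y (fun l => s (lift i l) y))
    + \sum_(i < k.+1) \sum_(j < k.+1 | (i < j)%N)
       (-1) ^+ (i + j) *: w x (fun l : 'I_k => nth 0
          (br (s i) (s j) x
             :: [seq s m x | m <- enum 'I_k.+1 & (m != i) && (m != j)]) l).

(* The value at u_0, ..., u_k in A x is the common value at x of the Koszul
   formula on all smooth sections s_0, ..., s_k through u_0, ..., u_k. *)
Definition dA (k : nat) (w : preform k) : preform k.+1 :=
  fun x u => xget 0 [set y : F x | forall s : 'I_k.+1 -> sect A,
    (forall i, smooth_sect (s i)) -> (forall i, s i x = u i) ->
    koszul w s x = y].

(* [cov_derivative g a I t s y] says that y is the derivative nabla_a t at the
   time s of I, for t a section of F along g, defined on the interval I.  It is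
   determined by the Leibniz rule when t is written, near s, as a sum of
   terms f(s') e(g(s')) with e a global section of F. *)
Definition cov_derivative (g : R -> M) (a : forall s, A (g s)) (I : set R)
    (t : forall s, F (g s)) (s : R) (y : F (g s)) : Prop :=
  exists (m : nat) (f : 'I_m -> R -> R) (e : 'I_m -> sect F),
    [/\ forall j, smooth_sect (e j),
        forall j, derivable (f j) s 1,
        \forall s' \near s, I s' -> t s' = \sum_j f j s' *: e j (g s')
      & y = \sum_j (derive1 (f j) s *: e j (g s) + f j s *: nabla (a s) (e j))].

Definition parallel (g : R -> M) (a : forall s, A (g s)) (I : set R)
    (t : forall s, F (g s)) : Prop :=
  forall s, I s -> cov_derivative a I t (0 : F (g s)).

Definition section_form (r : sect F) : preform 0 := fun x _ => r x.

End LieAlgebroids.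

(* Limits and integrals in a finite-dimensional space, taken coordinatewise
   in the basis [vbasis fullv] (any basis gives the same result). *)
Section VectorAnalysis.
Context (R : realType) (V : vectType R).

Definition vcoord (i : 'I_(\dim {:V})) (e : V) : R :=
  coord (vbasis {:V}) i e.

Definition is_cvg0 (f : R -> V) : Prop :=
  forall i, cvg (vcoord i (f t) @[t --> 0^'+]).

Definition vlim0 (f : R -> V) : V :=
  \sum_i lim (vcoord i (f t) @[t --> 0^'+]) *: (vbasis {:V})`_i.

Definition vint (f : R -> V) : V :=
  \sum_i (\int[@lebesgue_measure R]_(t in `]0, 1]) vcoord i (f t))
           *: (vbasis {:V})`_i.

End VectorAnalysis.

Section Homotopy.
Context (R : realType) (B : atlas R) (E : prebundle B).

Definition bproj (v : total_space E) : B := projT1 v.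

Definition zero_section (b : B) : total_space E := tpt (0 : E b).

Definition dilate (t : R) (v : total_space E) : total_space E :=
  tpt (t *: projT2 v).

Definition pullE : prebundle (total_space E) := pullback bproj E.

Definition pull_sect (s : sect E) : sect pullE := fun v => s (bproj v).

Definition euler : sect pullE := fun v => projT2 v.

Definition vlift (v : total_space E) (u : pullE v)
    (f : total_space E -> R) : R :=
  derive1 (fun t : R =>
    f (tpt (projT2 v + t *: (u : E (projT1 v))))) 0.

Context (F : prebundle (total_space E)).
Context (br : sect pullE -> sect pullE -> sect pullE).
Context (nabla : forall v : total_space E, pullE v -> sect F -> F v).

(* The map P_t : F_(tv) -> F_v; its argument is a point of the total space of
   F, meant to lie over tv (the value is 0 otherwise). *)
Definition transport (t : R) (v : total_space E) (y : total_space F) : F v :=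
  xget 0 [set z : F v | exists s : forall r : R, F (dilate r v),
    [/\ parallel nabla (fun r : R => projT2 v : pullE (dilate r v)) `[t, 1] s,
        tpt (s t) = y
      & tpt (s 1) = tpt z]].

Definition Psi (t : R) (k : nat) (w : preform pullE F k) : preform pullE F k :=
  fun v u => t ^+ k *: transport t v (tpt (w (dilate t v) u)).

Definition Psi0 (k : nat) (w : preform pullE F k) : preform pullE F k :=
  fun v u => vlim0 (fun t => Psi t w u).

Definition insert_euler (k : nat) (w : preform pullE F k.+1) :
    preform pullE F k :=
  fun v u => w v (fun l => oapp u (euler v) (unlift ord0 l)).

(* [homotopy w] is h_(k+1) w for w of degree k+1. *)
Definition homotopy (k : nat) (w : preform pullE F k.+1) : preform pullE F k :=
  fun v u => vint (fun t => t^-1 *: Psi t (insert_euler w) u).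

(* d h_k, which is zero for k = 0. *)
Definition d_homotopy (k : nat) : preform pullE F k -> preform pullE F k :=
  match k with
  | 0 => fun _ _ _ => 0
  | k'.+1 => fun w => dA br nabla (homotopy w)
  end.

End Homotopy.

(* Main.v *)
(** Along the ray t v, parallel transport solves a linear differential equation
    x' = - x G, and variation of constants gives (h w)_v(u) = x(1), where x(0) = 0
    and x' = - x G + t^k w_(t v)(v, u).  Smooth dependence of linear equations on
    parameters then makes h w smooth, and rescaling the ray gives, for sections
    s_i pulled back from the base and the Euler section e,
      nabla_e ((h w)(s_1, .., s_k)) + k (h w)(s_1, .., s_k) = w(e, s_1, .., s_k).
    Together with [e, s_i] = - s_i and flatness, this shows that the form
    a = h d w + d h w - w satisfies nabla_e (a(s)) + k a(s) = 0, that is,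
    t^k a(s)(t v) is parallel along every ray.  For k > 0 it vanishes at t = 0,
    hence identically; for k = 0, h d w vanishes on the zero section, so that
    w - h d w is the parallel extension of the restriction of w. *)

Require Import Defs.
From HB Require Import structures.
From mathcomp Require Import all_boot all_order all_algebra.
From mathcomp Require Import all_classical all_reals all_analysis.
From mathcomp Require Import ring lra zify.

Set Implicit Arguments.
Unset Strict Implicit.
Unset Printing Implicit Defensive.

Import Order.TTheory GRing.Theory Num.Theory.
Import numFieldNormedType.Exports.

Local Open Scope classical_set_scope.
Local Open Scope ring_scope.

(** * Differential calculus *)

(** The obstacle is that no single trivialization of F need cover a ray. Instead of trivializing F
    along the ray, the proof takes finitely many global sections e_k that span F near it, with
    smooth coefficient functionals c_k ([is_coframe]), obtained from compactness and cutoffs. The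
    e_k may be linearly dependent. Solving x' = - x G for coefficients still produces parallel
    sections, which gives existence; uniqueness is proved for the coordinates c_k of a section,
    which obey an equation with a corrected matrix ([drift]). Transport is defined by choice and h
    by a coordinatewise integral. Once h w is known to be x(1), its linearity, alternation,
    smoothness and behaviour under rescaling are read off the differential equation, and nothing is
    differentiated under an integral sign. Rays are prolonged to time 2, because v sits at time 1
    and h w has to be differentiated there. Forms are tested on sections pulled back from B: these
    commute and span every fibre, so the Koszul formula loses its brackets, except those with the
    Euler section. *)

Section Derivatives.
Context (R : realType) (V : normedModType R).
Implicit Types (f g : V -> R) (x v : V).

Lemma is_derive_add f g x v (df dg : R) : is_derive x v f df ->
  is_derive x v g dg -> is_derive x v (fun y => f y + g y) (df + dg).
Proof. exact: is_deriveD. Qed.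

Lemma is_derive_opp f x v (df : R) : is_derive x v f df ->
  is_derive x v (fun y => - f y) (- df).
Proof. exact: is_deriveN. Qed.

Lemma is_derive_mul f g x v (df dg : R) : is_derive x v f df ->
  is_derive x v g dg ->
  is_derive x v (fun y => f y * g y) (df * g x + f x * dg).
Proof.
move=> hf hg; apply: is_derive_eq (is_deriveM hf hg) _.
by rewrite /GRing.scale/= addrC mulrC.
Qed.

Lemma is_derive_exp f n x v (df : R) : is_derive x v f df ->
  is_derive x v (fun y => f y ^+ n) (n%:R * f x ^+ n.-1 * df).
Proof.
have -> : (fun y => f y ^+ n) = f ^+ n.
  by apply/funext => y; elim: n => [|n IH] //; rewrite !exprS IH.
by move=> hf; exact: is_deriveX.
Qed.

Lemma is_derive_sumr (I : Type) (r : seq I) (P : pred I) (F : I -> V -> R)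
    (dF : I -> R) x v :
  (forall i, P i -> is_derive x v (F i) (dF i)) ->
  is_derive x v (fun y => \sum_(i <- r | P i) F i y) (\sum_(i <- r | P i) dF i).
Proof.
move=> h; elim: r => [|a r IH].
  under eq_fun do rewrite big_nil.
  by rewrite big_nil; exact: is_derive_cst.
under eq_fun do rewrite big_cons.
rewrite big_cons; case: ifP => // Pa.
exact: is_derive_add (h _ Pa) IH.
Qed.

(** Reduces directional derivatives to one variable: the two difference quotients are the same
    function of [h]. *)
Lemma is_derive_lineP f (y e : V) (t d : R) :
  is_derive t 1 (fun s : R => f (y + s *: e)) d <->
  is_derive (y + t *: e) e f d.
Proof.
have E : (fun h : R => h^-1 *: (((fun s : R => f (y + s *: e)) \o shift t)
      (h *: (1 : R)) - f (y + t *: e))) =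
    (fun h : R => h^-1 *: ((f \o shift (y + t *: e)) (h *: e)
      - f (y + t *: e))).
  apply/funext => h /=.
  by rewrite (_ : h *: (1 : R) = h) ?[_ *: _]mulr1 // scalerDl addrCA.
split => -[h1 h2]; split.
- by move: h1; rewrite /derivable E.
- by move: h2; rewrite /derive E.
- by rewrite /derivable E.
- by rewrite /derive E.
Qed.

End Derivatives.

Lemma is_derive_chain (R : realType) (f g : R -> R) (x df dg : R) :
  is_derive x 1 f df -> is_derive (f x) 1 g dg ->
  is_derive x 1 (fun y => g (f y)) (dg * df).
Proof.
move=> [hf ef] [hg eg].
have df1 := (derivable1_diffP _ _).1 hf; have dg1 := (derivable1_diffP _ _).1 hg.
split; first exact/derivable1_diffP/differentiable_comp.
by rewrite -ef -eg -!derive1E; exact: (derive1_comp hf hg).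
Qed.

Lemma is_derive_cont (R : realType) (f : R -> R) (x d : R) :
  is_derive x 1 f d -> {for x, continuous f}.
Proof.
move=> [hf _]; apply: differentiable_continuous.
exact: (derivable1_diffP f x).1 hf.
Qed.

Lemma mean_value (R : realType) (f df : R -> R) (a b : R) : a <= b ->
  (forall x, a <= x <= b -> is_derive x 1 f (df x)) ->
  exists2 c, a <= c <= b & f b - f a = df c * (b - a).
Proof.
move=> ab h; have hd x : x \in `[a, b] -> is_derive x 1 f (df x).
  by rewrite in_itv; exact: h.
have cf : {within `[a, b], continuous f}.
  by apply: derivable_within_continuous => x /hd [].
have ho x : x \in `]a, b[ -> is_derive x 1 f (df x).
  by move=> /subset_itv_oo_cc; exact: hd.
have [c + E] := MVT_segment ab ho cf.
by rewrite in_itv => c1; exists c.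
Qed.

Section RowVectors.
Context (R : realType) (n : nat).
Implicit Types (x w : 'rV[R]_n).

Lemma rV_coord_le x i : `|x 0 i| <= `|x|.
Proof.
rewrite [leRHS]/Num.norm/= mx_normrE.
exact: (le_bigmax _ (fun ij : 'I_1 * 'I_n => `|x ij.1 ij.2|) (0, i)).
Qed.

Lemma rV_norm_le x (e : R) : 0 <= e -> (forall i, `|x 0 i| <= e) -> `|x| <= e.
Proof.
move=> e0 h; rewrite [leLHS]/Num.norm/= mx_normrE.
by apply: bigmax_le => // -[i j] _ /=; rewrite ord1.
Qed.

Lemma rV_norm_lt x (e : R) : 0 < e -> (forall i, `|x 0 i| < e) -> `|x| < e.
Proof.
move=> e0 h; rewrite [ltLHS]/Num.norm/= mx_normrE.
by apply: bigmax_lt => // -[i j] _ /=; rewrite ord1.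
Qed.

Lemma rV_cvg (T : Type) (F : set_system T) (f : T -> 'rV[R]_n) x :
  Filter F -> (forall i, f t 0 i @[t --> F] --> x 0 i) -> f t @[t --> F] --> x.
Proof.
move=> FF h; apply/cvgrPdist_lt => e e0.
suff : \forall t \near F, forall i, `|x 0 i - f t 0 i| < e.
  apply: filterS => t ht; apply: rV_norm_lt => // i.
  by rewrite !mxE; exact: ht.
apply: filter_forall => i.
by have /cvgrPdist_lt := h i; exact.
Qed.

End RowVectors.

Lemma nbhs_dist (R : realType) (V : normedModType R) (x : V) (P : set V) :
  nbhs x P <-> exists2 e : R, 0 < e & forall y, `|x - y| < e -> P y.
Proof.
split=> [h|[e e0 h]].
  have [e /= e0 he] := (nbhs_normP x P).1 h.
  by exists e => // y xy; apply: he.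
by apply/(nbhs_normP x P); exists e.
Qed.

Lemma near_dist (R : realType) (V : normedModType R) (x : V) (P : V -> Prop)
    (e : R) :
  0 < e -> (forall y, `|x - y| < e -> P y) -> \forall y \near x, P y.
Proof. by move=> e0 h; apply: (nbhs_dist x P).2; exists e. Qed.

Lemma cvg_sumr (R : realType) (T I : Type) (F : set_system T) (r : seq I)
    (P : pred I) (f : I -> T -> R) (a : I -> R) : Filter F ->
  (forall i, P i -> f i t @[t --> F] --> a i) ->
  \sum_(i <- r | P i) f i t @[t --> F] --> \sum_(i <- r | P i) a i.
Proof.
move=> FF h; elim: r => [|i r IH].
  under eq_cvg do rewrite big_nil.
  by rewrite big_nil; exact: cvg_cst.
under eq_cvg do rewrite big_cons.
by rewrite big_cons; case: ifP => // Pi; apply: cvgD => //; exact: h.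
Qed.

(** * Continuous partial derivatives and the chain rule along curves *)

Section CurveDerivative.
Context (R : realType) (n : nat).

(** Continuous partial derivatives imply differentiability: go from x to x + w along the coordinate
    directions, one at a time, and apply the mean value theorem on each leg. *)
Lemma partials_estimate (f : 'rV[R]_n -> R) (df : 'I_n -> 'rV[R]_n -> R)
    (x : 'rV[R]_n) (e : R) : 0 < e ->
  (\forall y \near x, forall c : 'I_n, is_derive y (delta_mx 0 c) f (df c y)) ->
  (forall c, {for x, continuous (df c)}) ->
  \forall w \near (0 : 'rV[R]_n),
    `|f (x + w) - f x - \sum_c w 0 c * df c x| <= e * `|w|.
Proof.
(* Each of the n legs costs at most e' times the norm of w; dividing by n + 1 also covers n = 0. *)
move=> e0 hd hc; pose e' := e / n.+1%:R.
have e'0 : 0 < e' by rewrite divr_gt0.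
have hc' : \forall y \near x, forall c : 'I_n, `|df c x - df c y| < e'.
  apply: (@filter_forall _ _ (fun (c : 'I_n) y => `|df c x - df c y| < e') (nbhs x)) => c.
  by have /cvgrPdist_lt := hc c; exact.
have [d d0 hx] := (nbhs_dist x _).1 (filterI hd hc').
apply: (near_dist d0) => w; rewrite sub0r normrN => wd.
(* The broken path from x to x + w has the vertices x + p j. *)
pose p (j : nat) : 'rV[R]_n := \row_c (if (c < j)%N then w 0 c else 0).
have pcE (c : 'I_n) : p c.+1 = p c + w 0 c *: delta_mx 0 c.
  apply/rowP => i; rewrite !mxE eqxx /= ltnS leq_eqVlt.
  have [->|ne] := eqVneq i c; first by rewrite ltnn eqxx mulr1 add0r.
  by rewrite mulr0 addr0 (negbTE (_ : i != c :> nat)).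
have H j : (j <= n)%N ->
    `|f (x + p j) - f x - \sum_(c < n | (c < j)%N) w 0 c * df c x|
      <= j%:R * (e' * `|w|).
  elim: j => [_|j IH jn].
    have -> : p 0%N = 0 by apply/rowP => i; rewrite !mxE.
    by rewrite addr0 subrr big1 // subr0 normr0 mul0r.
  pose c := Ordinal jn.
  have -> : p j.+1 = p j + w 0 c *: delta_mx 0 c by rewrite -(pcE c).
  rewrite (bigD1 c) //=; under eq_bigl => i.
    rewrite (_ : (i < j.+1)%N && (i != c) = (i < j)%N); last first.
      by rewrite -val_eqE /= ltnS ltn_neqAle andbC.
    over.
  pose q (t : R) := x + p j + t *: (w 0 c *: delta_mx 0 c).
  have qd (t : R) : t \in `[0, 1] -> `|x - q t| < d.
    rewrite in_itv /= => /andP[t0 t1]; apply: le_lt_trans wd.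
    apply: rV_norm_le => // i; rewrite !mxE /= opprD opprD !addrA subrr add0r.
    rewrite -opprD normrN; have [->|ne] := eqVneq i c.
      rewrite ltnn add0r mulr1 normrM ger0_norm //.
      by apply: le_trans (rV_coord_le w c); rewrite ler_piMl.
    by rewrite !mulr0 addr0; case: ifP => _; rewrite ?normr0 ?rV_coord_le.
  have qder (t : R) : t \in `[0, 1] ->
      is_derive t 1 (f \o q) (w 0 c * df c (q t)).
    move=> /qd/hx[/(_ c) hdc _].
    have E : (f \o q) = (fun t : R => f (x + p j + (t * w 0 c) *: delta_mx 0 c)).
      by apply/funext => s; rewrite /= /q scalerA.
    rewrite E mulrC.
    apply: (@is_derive_chain _ (fun t : R => t * w 0 c)
      (fun s => f (x + p j + s *: delta_mx 0 c))).
      apply: is_derive_eq (is_derive_mul (is_derive_id _ _)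
        (is_derive_cst _ _ _)) _.
      by rewrite mul1r mulr0 addr0.
    by apply/is_derive_lineP; rewrite -scalerA.
  have qder' (t : R) : 0 <= t <= 1 ->
    is_derive t 1 (f \o q) (w 0 c * df c (q t)).
    by move=> t01; apply: qder; rewrite in_itv.
  have [s s01 E] := mean_value ler01 qder'.
  have [_ /(_ c) hs] : ((fun y0 => forall c : 'I_n,
      is_derive y0 (delta_mx 0 c) f (df c y0)) `&`
      (fun y0 => forall c : 'I_n, `|df c x - df c y0| < e')) (q s).
    by apply: hx; apply: qd; rewrite in_itv.
  move: E; rewrite /= /q scale1r scale0r addr0 subr0 mulr1 -addrA => E.
  rewrite (_ : _ - _ - _ = (f (x + p j) - f x -
      \sum_(c < n | (c < j)%N) w 0 c * df c x)
    + w 0 c * (df c (x + (p j + s *: (w 0 c *: delta_mx 0 c))) - df c x)).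
    rewrite -[in leRHS]addn1 natrD mulrDl mul1r.
    apply: le_trans (ler_normD _ _) (lerD (IH (ltnW jn)) _).
    rewrite normrM mulrC; apply: ler_pM => //; last exact: rV_coord_le.
    by rewrite distrC ltW //; move: hs; rewrite /q -addrA.
  by rewrite [x + (p j + s *: _)]addrA mulrBr -E; ring.
have := H n (leqnn n).
have -> : p n = w by apply/rowP => i; rewrite !mxE ltn_ord.
under eq_bigl do rewrite ltn_ord.
move=> /le_trans; apply; rewrite mulrA ler_wpM2r // /e' mulrCA ler_piMr ?ltW//.
by rewrite ltr_pdivrMr // mul1r ltr_nat.
Qed.

Lemma is_derive_curve (f : 'rV[R]_n -> R) (df : 'I_n -> 'rV[R]_n -> R)
    (g : R -> 'rV[R]_n) (dg : 'I_n -> R) (t : R) :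
  (\forall y \near g t, forall c : 'I_n, is_derive y (delta_mx 0 c) f (df c y)) ->
  (forall c, {for g t, continuous (df c)}) ->
  (forall c, is_derive t 1 (fun s => g s 0 c) (dg c)) ->
  is_derive t 1 (fun s => f (g s)) (\sum_c dg c * df c (g t)).
Proof.
move=> hd hc hg.
have gquo c : h^-1 * (g (h + t) 0 c - g t 0 c) @[h --> 0^'] --> dg c.
  have [h1 h2] := hg c; move: h1 => /cvg_ex[l hl].
  move: h2; rewrite /derive (cvg_lim _ hl) // => <-; move: hl.
  by apply: cvg_trans; apply: near_eq_cvg; near=> h; rewrite /= [h *: 1]mulr1.
have gcont : g (h + t) - g t @[h --> 0^'] --> (0 : 'rV[R]_n).
  apply: rV_cvg => c; rewrite mxE; under eq_cvg do rewrite !mxE.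
  have /is_derive_cont := hg c => /cvgrPdist_lt hct.
  apply/cvgrPdist_lt => e e0; have /nbhs_dist[d d0 hd'] := hct e e0.
  near=> h; rewrite sub0r opprB; apply: hd'.
  rewrite opprD addrCA subrr addr0 normrN.
  by near: h; apply: dnbhs0_lt.
(* Bounds the difference quotients of [g] near 0, each coordinate being within 1 of its limit; the
   last 1 keeps M positive when n = 0. *)
pose M : R := \sum_c (`|dg c| + 1) + 1.
have M0 : 0 < M by rewrite ltr_wpDl // sumr_ge0 // => c _; rewrite addr_ge0.
have gbd : \forall h \near 0^', `|h^-1 *: (g (h + t) - g t)| <= M.
  have : \forall h \near 0^', forall c,
      `|dg c - h^-1 * (g (h + t) 0 c - g t 0 c)| < 1.
    by apply: filter_forall => c; have /cvgrPdist_lt := gquo c; exact.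
  apply: filterS => h hh; apply: rV_norm_le; first exact: ltW.
  move=> c; rewrite !mxE /M (bigD1 c) //= -addrA; apply: ler_wpDr.
    by rewrite addr_ge0 // sumr_ge0 // => i _; rewrite addr_ge0.
  move: (hh c); set u := h^-1 * _ => hc'.
  have := ler_normB (dg c) (dg c - u).
  rewrite opprB addrCA subrr addr0 => /le_trans; apply.
  by rewrite lerD2l ltW.
suff cv : h^-1 *: (f (g (h *: 1 + t)) - f (g t)) @[h --> 0^'] -->
    \sum_c dg c * df c (g t).
  split; first by apply/cvg_ex; eexists; exact: cv.
  exact: cvg_lim cv.
(* The quotient is split into the remainder of [partials_estimate], divided by h, and the linear
   part, whose limit is known coordinatewise. *)
have -> : (fun h : R => h^-1 *: (f (g (h *: (1 : R) + t)) - f (g t))) =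
   (fun h => h^-1 * (f (g (h + t)) - f (g t)
      - \sum_c (g (h + t) - g t) 0 c * df c (g t))
     + \sum_c (h^-1 * (g (h + t) 0 c - g t 0 c)) * df c (g t)).
  apply/funext => h; rewrite [h *: 1]mulr1 [LHS]/GRing.scale/=.
  rewrite (_ : \sum_c (h^-1 * (g (h + t) 0 c - g t 0 c)) * df c (g t) =
     h^-1 * \sum_c ((g (h + t) - g t) 0 c * df c (g t))).
    by rewrite -mulrDr subrK.
  by rewrite mulr_sumr; apply: eq_bigr => c _; rewrite !mxE mulrA.
rewrite -[X in _ --> X]add0r; apply: cvgD; last first.
  by apply: cvg_sumr => c _; apply: cvgMr_tmp; exact: gquo.
apply/cvgrPdist_le => e e0.
have eM : 0 < e / M by rewrite divr_gt0.
have hest : \forall h \near 0^', `|f (g t + (g (h + t) - g t)) - f (g t) -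
    \sum_c (g (h + t) - g t) 0 c * df c (g t)| <= e / M * `|g (h + t) - g t|.
  exact: gcont (partials_estimate eM hd hc).
move: hest gbd; apply: filterS2 => h; rewrite addrCA subrr addr0 => h1 h2.
rewrite sub0r normrN normrM.
apply: le_trans (ler_wpM2l (normr_ge0 _) h1) _.
rewrite mulrCA -normrZ -[leRHS](divfK (lt0r_neq0 M0)).
by rewrite ler_wpM2l // ltW.
Unshelve. all: by end_near. Qed.

End CurveDerivative.

(** * Functions of class C^k *)

Section CkCalculus.
Context (R : realType).

Lemma continuous_near_eq (T S : topologicalType) (f g : T -> S) (x : T) :
  {near x, f =1 g} -> {for x, continuous f} -> {for x, continuous g}.
Proof.
move=> fg cf; rewrite /prop_for /continuous_at -(nbhs_singleton fg).
by apply: cvg_trans cf; apply: near_eq_cvg; exact: fg.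
Qed.

Lemma continuous_sumr (T : topologicalType) (I : Type) (r : seq I) (P : pred I)
    (f : I -> T -> R) (x : T) :
  (forall i, P i -> {for x, continuous (f i)}) ->
  {for x, continuous (fun y => \sum_(i <- r | P i) f i y)}.
Proof. by move=> h; apply: cvg_sumr => i /h. Qed.

Variable n : nat.
Implicit Types (U V : set 'rV[R]_n) (f g : 'rV[R]_n -> R) (k : nat).

Lemma Ck_cont k U f x : Ck k U f -> U x -> {for x, continuous f}.
Proof. by case: k => [|k] [h _]; exact: h. Qed.

Lemma Ck_der k U f (i : 'I_n) x : Ck k.+1 U f -> U x ->
  is_derive x (delta_mx 0 i) f ('D_(delta_mx 0 i) f x).
Proof. by move=> [_ /(_ i)[h _]] Ux; apply: derivableP; exact: h. Qed.

Lemma Ck_partial k U f (i : 'I_n) : Ck k.+1 U f ->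
  Ck k U (fun x => 'D_(delta_mx 0 i) f x).
Proof. by move=> [_ /(_ i)[]]. Qed.

Lemma CkW k U f : Ck k.+1 U f -> Ck k U f.
Proof.
elim: k f => [|k IH] f [h1 h2]; split=> // i.
by have [h3 h4] := h2 i; split=> //; exact: IH.
Qed.

Lemma Ck_sub k U V f : V `<=` U -> Ck k U f -> Ck k V f.
Proof.
move=> VU; elim: k f => [|k IH] f [h1 h2]; (split; [by move=> x /VU /h1|]) => // i.
have [h3 h4] := h2 i; split; first by move=> x /VU /h3.
exact: IH.
Qed.

Lemma Ck_local k U f :
  (forall x, U x -> exists V, [/\ open V, V x & Ck k V f]) -> Ck k U f.
Proof.
elim: k f => [|k IH] f h; (split; [move=> x Ux|]) => //.
- by have [V [_ Vx hV]] := h x Ux; exact: Ck_cont hV Vx.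
- by have [V [_ Vx hV]] := h x Ux; exact: Ck_cont hV Vx.
move=> i; split=> [x Ux|].
  by have [V [_ Vx hV]] := h x Ux; have [] := Ck_der i hV Vx.
apply: IH => x /h[V [oV Vx hV]]; exists V; split => //; exact: Ck_partial.
Qed.

Lemma near_open_eq (T : Type) U (f g : 'rV[R]_n -> T) x : open U -> U x ->
  (forall y, U y -> f y = g y) -> {near x, f =1 g}.
Proof. by move=> oU Ux fg; apply: filterS (open_nbhs_nbhs (conj oU Ux)). Qed.

Lemma Ck_eq k U f g : open U -> (forall x, U x -> f x = g x) ->
  Ck k U f -> Ck k U g.
Proof.
move=> oU; elim: k f g => [|k IH] f g fg [h1 h2]; (split; [move=> x Ux|]) => //.
- exact: continuous_near_eq (near_open_eq oU Ux fg) (h1 x Ux).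
- exact: continuous_near_eq (near_open_eq oU Ux fg) (h1 x Ux).
move=> i; have [h3 h4] := h2 i; split=> [x Ux|].
  exact: near_eq_derivable (near_open_eq oU Ux fg) (h3 x Ux).
apply: IH h4 => x Ux.
exact: near_eq_derive (near_open_eq oU Ux fg).
Qed.

(** Lets the partial derivatives be given by explicit formulas, valid on U only, in place of the
    total operator ['D_]. *)
Lemma Ck_intro k U f (df : 'I_n -> 'rV[R]_n -> R) : open U ->
  (forall x, U x -> {for x, continuous f}) ->
  (forall i x, U x -> is_derive x (delta_mx 0 i) f (df i x)) ->
  (forall i, Ck k U (df i)) -> Ck k.+1 U f.
Proof.
move=> oU h1 h2 h3; split=> // i; split=> [x /(h2 i)[]//|].
by apply: Ck_eq (h3 i) => // x /(h2 i)[].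
Qed.

Lemma Ck_cst k U (c : R) : open U -> Ck k U (fun=> c).
Proof.
move=> oU; elim: k c => [|k IH] c; first by split=> // x _; exact: cst_continuous.
apply: (@Ck_intro k U _ (fun _ _ => 0)) => //.
by move=> x _; exact: cst_continuous.
Qed.

Lemma Ck_add k U f g : open U -> Ck k U f -> Ck k U g ->
  Ck k U (fun x => f x + g x).
Proof.
move=> oU; elim: k f g => [|k IH] f g hf hg.
  by split=> // x Ux; apply: continuousD; [exact: Ck_cont hf Ux|exact: Ck_cont hg Ux].
apply: (Ck_intro oU (df := fun i x => 'D_(delta_mx 0 i) f x + 'D_(delta_mx 0 i) g x)).
- by move=> x Ux; apply: continuousD; [exact: Ck_cont hf Ux|exact: Ck_cont hg Ux].
- by move=> i x Ux; exact: is_derive_add (Ck_der i hf Ux) (Ck_der i hg Ux).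
- by move=> i; apply: IH; exact: Ck_partial.
Qed.

Lemma Ck_mul k U f g : open U -> Ck k U f -> Ck k U g ->
  Ck k U (fun x => f x * g x).
Proof.
move=> oU; elim: k f g => [|k IH] f g hf hg.
  by split=> // x Ux; apply: continuousM; [exact: Ck_cont hf Ux|exact: Ck_cont hg Ux].
apply: (Ck_intro oU (df := fun i x =>
  'D_(delta_mx 0 i) f x * g x + f x * 'D_(delta_mx 0 i) g x)).
- by move=> x Ux; apply: continuousM; [exact: Ck_cont hf Ux|exact: Ck_cont hg Ux].
- by move=> i x Ux; exact: is_derive_mul (Ck_der i hf Ux) (Ck_der i hg Ux).
- move=> i; apply: Ck_add => //; apply: IH; try exact: Ck_partial.
  + exact: CkW.
  + exact: CkW.
Qed.

Lemma Ck_sum k U (I : Type) (r : seq I) (P : pred I) (F : I -> 'rV[R]_n -> R) :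
  open U -> (forall i, P i -> Ck k U (F i)) ->
  Ck k U (fun x => \sum_(i <- r | P i) F i x).
Proof.
move=> oU h; elim: r => [|a r IH].
  by under eq_fun do rewrite big_nil; exact: Ck_cst.
under eq_fun do rewrite big_cons.
by case Pa : (P a) => //; apply: Ck_add => //; exact: h.
Qed.

Lemma Ck_prod k U (I : Type) (r : seq I) (F : I -> 'rV[R]_n -> R) :
  open U -> (forall i, Ck k U (F i)) -> Ck k U (fun x => \prod_(i <- r) F i x).
Proof.
move=> oU h; elim: r => [|a r IH].
  by under eq_fun do rewrite big_nil; exact: Ck_cst.
by under eq_fun do rewrite big_cons; exact: Ck_mul.
Qed.

Lemma is_derive_coord (x v : 'rV[R]_n) c :
  is_derive x v (fun y : 'rV[R]_n => y 0 c) (v 0 c).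
Proof.
have -> : x = (x + 0 *: v) by rewrite scale0r addr0.
apply/is_derive_lineP; under eq_fun do rewrite !mxE.
apply: is_derive_eq (is_derive_add (is_derive_cst _ _ _)
  (is_derive_mul (is_derive_id _ _) (is_derive_cst _ _ _))) _.
by rewrite mul1r mulr0 addr0 add0r.
Qed.

Lemma Ck_coord k U c : open U -> Ck k U (fun x : 'rV[R]_n => x 0 c).
Proof.
move=> oU; case: k => [|k].
  by split=> // x _; exact: coord_continuous.
apply: (Ck_intro oU (df := fun i _ => (delta_mx 0 i : 'rV[R]_n) 0 c)).
- by move=> x _; exact: coord_continuous.
- by move=> i x _; exact: is_derive_coord.
- by move=> i; exact: Ck_cst.
Qed.

Lemma Ck_inv k U f : open U -> (forall x, U x -> f x != 0) -> Ck k U f ->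
  Ck k U (fun x => (f x)^-1).
Proof.
move=> oU f0; elim: k => [|k IH] hf.
  by split=> // x Ux; exact: (cvgV (f0 x Ux) (Ck_cont hf Ux)).
apply: (Ck_intro oU (df := fun i x =>
  (-1) * ((f x)^-1 * (f x)^-1 * 'D_(delta_mx 0 i) f x))).
- by move=> x Ux; exact: (cvgV (f0 x Ux) (Ck_cont hf Ux)).
- move=> i x Ux; have [h1 h2] := Ck_der i hf Ux.
  split; first exact: derivableV (f0 x Ux) h1.
  by rewrite (deriveV (f0 x Ux) h1) mulN1r expr2 invfM /GRing.scale/= mulNr.
- have hi := IH (CkW hf).
  move=> i; apply: Ck_mul => //; first exact: Ck_cst.
  by apply: (Ck_mul oU (Ck_mul oU hi hi)); exact: Ck_partial.
Qed.

Lemma is_derive_C1_curve U f (g : R -> 'rV[R]_n) (dg : 'I_n -> R) (t : R) :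
  open U -> Ck 1 U f -> U (g t) ->
  (forall c, is_derive t 1 (fun s => g s 0 c) (dg c)) ->
  is_derive t 1 (fun s => f (g s)) (\sum_c dg c * 'D_(delta_mx 0 c) f (g t)).
Proof.
move=> oU hf Ugt hg; apply: (@is_derive_curve R n f (fun c x => 'D_(delta_mx 0 c) f x) g dg t _ _ hg).
- apply: filterS (open_nbhs_nbhs (conj oU Ugt)) => y Uy c.
  exact: Ck_der hf Uy.
- move=> c; exact: Ck_cont (Ck_partial c hf) Ugt.
Qed.

End CkCalculus.

(** Induction on k for all f: the partial derivatives of the composite are sums of products of
    partials of g with composites of partials of f. *)
Lemma Ck_comp (R : realType) (n m k : nat) (U : set 'rV[R]_n) (V : set 'rV[R]_m)
    (f : 'rV[R]_m -> R) (g : 'rV[R]_n -> 'rV[R]_m) :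
  open U -> open V -> (forall x, U x -> V (g x)) -> Ck k V f ->
  (forall c, Ck k U (fun x => g x 0 c)) -> Ck k U (fun x => f (g x)).
Proof.
move=> oU oV UV; elim: k f => [|k IH] f hf hg.
  split=> // x Ux; apply: continuous_comp; last exact: Ck_cont hf (UV x Ux).
  by apply: (@rV_cvg _ _ _ (nbhs x)) => c; exact: Ck_cont (hg c) Ux.
apply: (Ck_intro oU (df := fun i x => \sum_c
    'D_(delta_mx 0 i) (fun x => g x 0 c) x * 'D_(delta_mx 0 c) f (g x))).
- move=> x Ux; apply: continuous_comp; last exact: Ck_cont hf (UV x Ux).
  by apply: (@rV_cvg _ _ _ (nbhs x)) => c; exact: Ck_cont (hg c) Ux.
- move=> i x Ux.
  have x0 : x = x + 0 *: delta_mx 0 i by rewrite scale0r addr0.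
  rewrite [X in is_derive X]x0.
  apply/(is_derive_lineP (fun x => f (g x))).
  rewrite [X in \sum_c _ * 'D__ f (g X)]x0.
  apply: (@is_derive_C1_curve _ _ V f (fun s => g (x + s *: delta_mx 0 i))) => //.
  + by elim: k f hf {IH hg} => // k IH f /CkW; exact: IH.
  + by rewrite -x0; exact: UV.
  + move=> c; apply/(is_derive_lineP (fun x => g x 0 c)).
    by rewrite -x0; exact: Ck_der (hg c) Ux.
- move=> i; apply: Ck_sum => // c _; apply: Ck_mul => //; first exact: Ck_partial.
  by apply: (IH _ (Ck_partial c hf)) => c'; exact: CkW.
Qed.

(** * A smooth step function *)

Section FlatFunction.
Context (R : realType).

(* The derivatives at x > 0 of exp (-1/x), extended by 0, are combinations of
   these functions; the family is stable under derivation. *)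
Definition flat (j : nat) (x : R) : R :=
  if 0 < x then x^-1 ^+ j * expR (- x^-1) else 0.

(** With y = 1/x, the exponential of y dominates y^(j+2) / (j+2)!, so y^j exp(-y) is at most (j+2)!
    / y^2. The quadratic bound forces derivative 0 at the origin. *)
Lemma flat_le_square j x : `|flat j x| <= (j.+2)`!%:R * x ^+ 2.
Proof.
rewrite /flat; case: ifPn => [x0|_]; last by rewrite normr0 mulr_ge0 // sqr_ge0.
have y0 : 0 < x^-1 by rewrite invr_gt0.
rewrite ger0_norm; last by rewrite mulr_ge0 ?expR_ge0 // exprn_ge0 // ltW.
rewrite expRN ler_pdivrMr ?expR_gt0 //.
have h : x^-1 ^+ j.+2 <= (j.+2)`!%:R * expR x^-1.
  rewrite mulrC -ler_pdivrMr ?ltr0n ?fact_gt0 //.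
  by apply: le_trans (expR_ge1Dxn j.+1 (ltW y0)); rewrite lerDr.
have -> : x^-1 ^+ j = x ^+ 2 * x^-1 ^+ j.+2.
  by rewrite -[j.+2]/(2 + j)%N exprD mulrA -exprMn divff ?expr1n ?mul1r // gt_eqF.
have -> : (j.+2)`!%:R * x ^+ 2 * expR x^-1 = x ^+ 2 * ((j.+2)`!%:R * expR x^-1).
  by ring.
by apply: ler_wpM2l h; rewrite sqr_ge0.
Qed.

Lemma is_derive_quadratic (f : R -> R) (C x : R) :
  f x = 0 -> (forall h, `|f (h + x)| <= C * h ^+ 2) -> is_derive x 1 f 0.
Proof.
move=> f0 hf; suff cv : h^-1 *: (f (h *: 1 + x) - f x) @[h --> 0^'] --> (0 : R).
  by split; [apply/cvg_ex; eexists; exact: cv|exact: cvg_lim cv].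
apply/cvgrPdist_le => e e0.
have C0 : 0 < `|C| + 1 by rewrite ltr_wpDl.
have d0 : 0 < e / (`|C| + 1) by rewrite divr_gt0.
near=> h; rewrite sub0r normrN f0 subr0 [h *: 1]mulr1 normrM.
have h0 : h != 0 by near: h; exact: nbhs_dnbhs_neq.
have hd : `|h| < e / (`|C| + 1) by near: h; apply: dnbhs0_lt.
rewrite normfV ler_pdivrMl ?normr_gt0 //.
apply: le_trans (hf h) _; apply: (@le_trans _ _ ((`|C| + 1) * `|h| ^+ 2)).
  rewrite real_normK ?num_real // ler_wpM2r ?sqr_ge0 //.
  by rewrite (le_trans (ler_norm C)) // lerDl.
rewrite expr2 mulrCA ler_wpM2l // mulrC -ler_pdivlMr //; exact: ltW.
Unshelve. all: by end_near. Qed.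

Lemma is_derive_flat j (x : R) :
  is_derive x 1 (flat j) (- j%:R * flat j.+1 x + flat j.+2 x).
Proof.
have [x0|x0|x0] := ltgtP 0 x.
- have H : is_derive x 1 (fun x : R => x^-1 ^+ j * expR (- x^-1))
      (- j%:R * flat j.+1 x + flat j.+2 x).
    have xn0 : x != 0 by rewrite gt_eqF.
    have dV : is_derive x 1 (fun x : R => x^-1) (- x^-1 ^+ 2).
      apply: is_derive_eq (is_deriveV xn0 (is_derive_id _ _)) _.
      by rewrite exprVn [LHS]mulr1.
    have dE : is_derive x 1 (fun x : R => expR (- x^-1))
        (expR (- x^-1) * x^-1 ^+ 2).
      have := is_derive_chain (is_derive_opp dV) (is_derive_expR (- x^-1)).
      by rewrite opprK.
    apply: is_derive_eq (is_derive_mul (is_derive_exp j dV) dE) _.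
    rewrite /flat x0; case: j => [|j].
      by rewrite !mul0r oppr0 mul0r !add0r expr0 mul1r mulrC.
    by rewrite /= !exprS; ring.
  apply: near_eq_is_derive H; near=> y; rewrite /flat ifT //.
  by near: y; exact: lt_nbhsr.
- have -> : - j%:R * flat j.+1 x + flat j.+2 x = 0.
    by rewrite /flat !ltNge ltW //= mulr0 addr0.
  apply: (near_eq_is_derive _ (is_derive_cst (0 : R) x 1)).
  near=> y; rewrite /flat ifN // -leNgt ltW //.
  by near: y; exact: lt_nbhsl.
- rewrite -{x}x0; have f0 i : flat i 0 = 0 by rewrite /flat ltxx.
  rewrite !f0 mulr0 addr0.
  apply: (@is_derive_quadratic _ (j.+2)`!%:R) => // h.
  by rewrite addr0; exact: flat_le_square.
Unshelve. all: by end_near. Qed.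

Lemma flat_cont j (x : R) : {for x, continuous (flat j)}.
Proof. exact: is_derive_cont (is_derive_flat j x). Qed.

Lemma Ck_flat n k (U : set 'rV[R]_n) (f : 'rV[R]_n -> R) j : open U ->
  Ck k U f -> Ck k U (fun x => flat j (f x)).
Proof.
move=> oU; elim: k j => [|k IH] j hf.
  split=> // x Ux; apply: continuous_comp; first exact: Ck_cont hf Ux.
  exact: flat_cont.
apply: (Ck_intro oU (df := fun i x =>
   (- j%:R * flat j.+1 (f x) + flat j.+2 (f x)) * 'D_(delta_mx 0 i) f x)).
- move=> x Ux; apply: continuous_comp; first exact: Ck_cont hf Ux.
  exact: flat_cont.
- move=> i x Ux; have x0 : x = x + 0 *: delta_mx 0 i by rewrite scale0r addr0.
  rewrite [X in is_derive X]x0.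
  apply/(is_derive_lineP (fun x => flat j (f x))).
  have d1 : is_derive (0 : R) 1 (fun s : R => f (x + s *: delta_mx 0 i))
      ('D_(delta_mx 0 i) f x).
    by apply/is_derive_lineP; rewrite -x0; exact: Ck_der hf Ux.
  have := is_derive_flat j (f x); rewrite [X in f X]x0 => d2.
  by have := is_derive_chain d1 d2; rewrite -x0.
- move=> i; have hp := Ck_partial i hf; apply: Ck_mul => //.
  apply: Ck_add => //; last exact/IH/CkW.
  by apply: Ck_mul => //; [exact: Ck_cst|exact/IH/CkW].
Qed.

Definition step (x : R) : R := flat 0 x / (flat 0 x + flat 0 (1 - x)).

Lemma flat0_ge0 x : 0 <= flat 0 x.
Proof. by rewrite /flat; case: ifP => // _; rewrite expr0 mul1r expR_ge0. Qed.

Lemma flat0_gt0 x : 0 < x -> 0 < flat 0 x.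
Proof. by move=> x0; rewrite /flat x0 expr0 mul1r expR_gt0. Qed.

Lemma flat0_le0 j x : x <= 0 -> flat j x = 0.
Proof. by move=> x0; rewrite /flat ltNge x0. Qed.

(** At least one of x and 1 - x is positive; this makes [step] a smooth quotient. *)
Lemma step_denom_gt0 x : 0 < flat 0 x + flat 0 (1 - x).
Proof.
have [x0|x0] := ltP 0 x; first by rewrite ltr_pwDl ?flat0_gt0 ?flat0_ge0.
by rewrite ltr_wpDl ?flat0_gt0 ?flat0_ge0 // subr_gt0 (le_lt_trans x0).
Qed.

Lemma step_le0 x : x <= 0 -> step x = 0.
Proof. by move=> x0; rewrite /step flat0_le0 // mul0r. Qed.

Lemma step_ge1 x : 1 <= x -> step x = 1.
Proof.
move=> x1; rewrite /step [flat 0 (1 - x)]flat0_le0 ?subr_le0 // addr0 divff //.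
by rewrite gt_eqF // flat0_gt0 // (lt_le_trans ltr01).
Qed.

Lemma Ck_step n k (U : set 'rV[R]_n) (f : 'rV[R]_n -> R) : open U ->
  Ck k U f -> Ck k U (fun x => step (f x)).
Proof.
move=> oU hf; apply: Ck_mul => //; first exact: Ck_flat.
apply: Ck_inv => //; first by move=> x _; rewrite gt_eqF // step_denom_gt0.
apply: Ck_add => //; first exact: Ck_flat.
apply: Ck_flat => //; apply: Ck_add => //; first exact: Ck_cst.
under eq_fun do rewrite -mulN1r.
by apply: Ck_mul => //; exact: Ck_cst.
Qed.

End FlatFunction.

(** * Manifolds and bump functions *)

(** The structure that is carried from the base to the total space in [total_space_pre]. The
    Hausdorff axiom is what makes bump functions available. *)
Record is_premanifold (R : realType) (M : atlas R) : Prop := IsPremanifold {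
  pre_cover : forall x : M, exists i, cdom i x;
  pre_inj : forall (i : chart M) (x y : M),
    cdom i x -> cdom i y -> crd i x = crd i y -> x = y;
  pre_open : forall j : chart M, open_in (cdom j);
  pre_smooth : forall (j : chart M) (c : 'I_(mdim M)),
    smooth_on (cdom j) (fun x => crd j x 0 c);
  pre_hausdorff : forall x y : M, x <> y -> exists U V : set M,
    [/\ open_in U, open_in V, U x, V y & U `&` V = set0]
}.

Arguments pre_open {R M} _ j.
Arguments pre_smooth {R M} _ j c.

Lemma manifold_pre (R : realType) (M : atlas R) :
  is_manifold M -> is_premanifold M.
Proof. by case. Qed.

Section Premanifolds.
Context (R : realType) (M : atlas R) (HM : is_premanifold M).
Implicit Types (W : set M) (f g : M -> R).

Lemma open_inT : open_in [set: M].
Proof. by move=> i; have := pre_open HM i i; rewrite setIid setIT. Qed.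

Lemma open_inI W W' : open_in W -> open_in W' -> open_in (W `&` W').
Proof.
move=> oW oW' i.
rewrite (_ : _ @` _ = crd i @` (cdom i `&` W) `&` crd i @` (cdom i `&` W')).
  by apply: openI; [exact: oW|exact: oW'].
apply/seteqP; split=> [_ [x [dx [Wx W'x]] <-]|z [[x [dx Wx] <-] [y [dy Wy] yx]]].
  by split; exists x.
by exists x => //; rewrite -(pre_inj HM dy dx yx) in Wx *; split.
Qed.

Arguments open_inI {W W'} _ _.

Lemma open_in_local W :
  (forall x, W x -> exists W', [/\ open_in W', W' x & W' `<=` W]) -> open_in W.
Proof.
move=> h i; rewrite openE => _ [x [dx Wx] <-].
have [W' [oW' W'x sW']] := h x Wx.
apply: (filterS (P := crd i @` (cdom i `&` W'))).
  by move=> _ [y [dy /sW' Wy] <-]; exists y.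
by apply: open_nbhs_nbhs; split; [exact: oW'|exists x].
Qed.

Lemma smooth_onS W W' f : W' `<=` W -> smooth_on W f -> smooth_on W' f.
Proof.
move=> sW hf i; have [g [gs fg]] := hf i; exists g; split.
  by move=> k; apply: Ck_sub (gs k) => _ [x [dx /sW Wx] <-]; exists x.
by move=> x dx /sW; exact: fg.
Qed.

Lemma smooth_on_eq W f g : (forall x, W x -> f x = g x) -> smooth_on W f ->
  smooth_on W g.
Proof.
move=> fg hf i; have [h [hs fh]] := hf i; exists h; split=> // x dx Wx.
by rewrite -fg // fh.
Qed.

(** The composite of f with the inverse of the chart, and 0 off the image of W. [smooth_on] only
    supplies some representative, depending on the open set; this canonical one allows local
    representatives to be glued. *)
Definition local_rep (i : chart M) W f (z : 'rV[R]_(mdim M)) : R :=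
  xget 0 [set r | exists x, [/\ cdom i x, W x, crd i x = z & r = f x]].

Lemma local_repE i W f x : cdom i x -> W x ->
  local_rep i W f (crd i x) = f x.
Proof.
move=> dx Wx; rewrite /local_rep; case: xgetP => [r _ [y [dy Wy yx ->]]|].
  by rewrite (pre_inj HM dy dx yx).
by move=> /(_ (f x)); case; exists x.
Qed.

Lemma smooth_on_local W f : open_in W ->
  (forall x, W x -> exists W', [/\ open_in W', W' x & smooth_on W' f]) ->
  smooth_on W f.
Proof.
move=> oW h i; exists (local_rep i W f); split; last first.
  by move=> x dx Wx; rewrite local_repE.
move=> k; apply: Ck_local => _ [x [dx Wx] <-].
have [W' [oW' W'x hW']] := h x Wx; have [g [gs fg]] := hW' i.
exists (crd i @` (cdom i `&` (W `&` W'))); split.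
- exact: open_inI.
- by exists x.
apply: (@Ck_eq _ _ _ _ g); first exact: open_inI.
  by move=> _ [y [dy [Wy W'y]] <-]; rewrite local_repE // -fg.
by apply: Ck_sub (gs k) => _ [y [dy [Wy W'y]] <-]; exists y.
Qed.

Lemma chart_change (i j : chart M) : exists h : 'rV[R]_(mdim M) -> 'rV[R]_(mdim M),
  (forall c k, Ck k (crd j @` (cdom j `&` cdom i)) (fun z => h z 0 c)) /\
  (forall x, cdom j x -> cdom i x -> h (crd j x) = crd i x).
Proof.
pose h z : 'rV[R]_(mdim M) :=
  \row_c local_rep j (cdom i) (fun x => crd i x 0 c) z.
exists h; split=> [c k|x dj di]; last first.
  by apply/rowP => c; rewrite mxE local_repE.
have [g [gs fg]] := pre_smooth HM i c j.
apply: (@Ck_eq _ _ _ _ g) (gs k); first exact: pre_open.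
by move=> _ [x [dj di] <-]; rewrite mxE local_repE // fg.
Qed.

Lemma open_in_chart (i : chart M) (O : set 'rV[R]_(mdim M)) : open O ->
  open_in (cdom i `&` crd i @^-1` O).
Proof.
move=> oO j; have [h [hs hE]] := chart_change i j.
rewrite openE => _ [x [dj [di Ox]] <-].
have ox : open (crd j @` (cdom j `&` cdom i)) by exact: pre_open.
have cx : (crd j @` (cdom j `&` cdom i)) (crd j x) by exists x.
have hc : {for crd j x, continuous h}.
  apply: (@rV_cvg _ _ _ (nbhs (crd j x))) => c.
  exact: Ck_cont (hs c 0%N) cx.
have h1 : nbhs (crd j x) (h @^-1` O).
  by apply: hc; apply: open_nbhs_nbhs; split; rewrite ?hE.
apply: filterS (filterI h1 (open_nbhs_nbhs (conj ox cx))).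
move=> z [Oz [y [ej ei] yz]]; exists y => //; split=> //; split=> //.
by move: Oz; rewrite -yz /= hE.
Qed.

Lemma open_in_smooth W f (O : set R) : open_in W -> smooth_on W f -> open O ->
  open_in (W `&` f @^-1` O).
Proof.
move=> oW hf oO j; have [g [gs fg]] := hf j.
rewrite openE => _ [x [dj [Wx Ox]] <-].
have cx : (crd j @` (cdom j `&` W)) (crd j x) by exists x.
have h1 : nbhs (crd j x) (g @^-1` O).
  apply: (Ck_cont (gs 0%N) cx); apply: open_nbhs_nbhs; split=> //.
  by rewrite -fg.
apply: filterS (filterI h1 (open_nbhs_nbhs (conj (oW j) cx))).
move=> z [Oz [y [ej ei] yz]]; exists y => //; split=> //; split=> //.
by move: Oz; rewrite -yz /= fg.
Qed.

(** A single chart suffices to test smoothness inside its domain, since the changes of charts are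
    smooth. *)
Lemma smooth_on_chart (i : chart M) W f (g : 'rV[R]_(mdim M) -> R) :
  open_in W -> W `<=` cdom i -> smooth_coord (crd i @` (cdom i `&` W)) g ->
  (forall x, W x -> f x = g (crd i x)) -> smooth_on W f.
Proof.
move=> oW sW gs fg j; have [h [hs hE]] := chart_change i j.
exists (fun z => g (h z)); split=> [k|x dj Wx]; last first.
  by rewrite (hE _ dj (sW _ Wx)) fg.
apply: (@Ck_comp _ _ _ _ _ (crd i @` (cdom i `&` W))) => //.
- move=> _ [x [dj Wx] <-]; have di := sW _ Wx; by rewrite hE //; exists x.
- by move=> c; apply: Ck_sub (hs c k) => _ [x [dj /sW di] <-]; exists x.
Qed.

Lemma smooth_on_cst W (c : R) : open_in W -> smooth_on W (fun=> c).
Proof. by move=> oW i; exists (fun=> c); split=> // k; exact: Ck_cst. Qed.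

Lemma smooth_on_add W f g : open_in W -> smooth_on W f -> smooth_on W g ->
  smooth_on W (fun x => f x + g x).
Proof.
move=> oW hf hg i; have [f' [fs fE]] := hf i; have [g' [gs gE]] := hg i.
exists (fun z => f' z + g' z); split; first by move=> k; apply: Ck_add.
by move=> x dx Wx; rewrite fE // gE.
Qed.

Lemma smooth_on_mul W f g : open_in W -> smooth_on W f -> smooth_on W g ->
  smooth_on W (fun x => f x * g x).
Proof.
move=> oW hf hg i; have [f' [fs fE]] := hf i; have [g' [gs gE]] := hg i.
exists (fun z => f' z * g' z); split; first by move=> k; apply: Ck_mul.
by move=> x dx Wx; rewrite fE // gE.
Qed.

Lemma smooth_on_sum W (I : Type) (r : seq I) (P : pred I) (F : I -> M -> R) :
  open_in W -> (forall i, P i -> smooth_on W (F i)) ->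
  smooth_on W (fun x => \sum_(i <- r | P i) F i x).
Proof.
move=> oW h; elim: r => [|a r IH].
  by under eq_fun do rewrite big_nil; exact: smooth_on_cst.
under eq_fun do rewrite big_cons.
by case Pa : (P a) => //; apply: smooth_on_add => //; exact: h.
Qed.

Lemma smooth_on_inv W f : open_in W -> (forall x, W x -> f x != 0) ->
  smooth_on W f -> smooth_on W (fun x => (f x)^-1).
Proof.
move=> oW f0 hf i; have [f' [fs fE]] := hf i.
exists (fun z => (f' z)^-1); split; last by move=> x dx Wx; rewrite fE.
move=> k; apply: Ck_inv => // _ [x [dx Wx] <-].
by rewrite -fE // f0.
Qed.

(** Compact sets are closed in a Hausdorff space. The open neighbourhoods of p generate the explicit
    filter [F], and compactness is used in the near-covering form over [F]. *)
Lemma compact_chart_closed (i : chart M) (K : set 'rV[R]_(mdim M)) :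
  compact K -> K `<=` crd i @` cdom i ->
  open_in (~` (cdom i `&` crd i @^-1` K)).
Proof.
move=> cK sK; apply: open_in_local => p hp.
pose F : set_system M := [set S | exists U, [/\ open_in U, U p & U `<=` S]].
have FF : Filter F.
  split.
  - by exists setT; split=> //; exact: open_inT.
  - move=> P Q [U [oU Up sU]] [V [oV Vp sV]]; exists (U `&` V).
    by split=> //; [exact: open_inI|move=> x [/sU Px /sV Qx]].
  - by move=> P Q PQ [U [oU Up sU]]; exists U; split=> // x /sU /PQ.
pose P (m : M) (z : 'rV[R]_(mdim M)) : Prop :=
  forall q, cdom i q -> crd i q = z -> m <> q.
have := (compact_near_coveringP K).1 cK M F P FF.
case=> [z Kz|U [oU Up sU]].
  have [q dq qz] := sK _ Kz.
  have pq : p <> q.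
    by move=> pq; apply: hp; rewrite pq; split=> //=; rewrite qz.
  have [U [V [oU oV Up Vq UV]]] := pre_hausdorff HM pq.
  exists (crd i @` (cdom i `&` V), U) => /=.
    split; last by exists U; split.
    by apply: open_nbhs_nbhs; split; [exact: oV|exists q].
  move=> [_ m] [/= [q' [dq' Vq'] <-] Um] q'' dq'' /(pre_inj HM dq'' dq') -> mq.
  have : (U `&` V) q' by rewrite -[X in _ X]mq; split=> //; rewrite mq.
  by rewrite UV.
exists U; split=> // m Um [dm Km].
exact: (sU m Um _ Km m dm).
Qed.

Lemma continuous_dist (V : normedModType R) (x : V) :
  continuous (fun z : V => `|x - z|).
Proof.
move=> z; apply/cvgrPdist_lt => e e0; apply: (near_dist e0) => y zy.
apply: le_lt_trans (ler_dist_dist _ _) _.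
by rewrite opprB addrC addrA subrK distrC.
Qed.

(** The open set Z of zeros covers M together with W. Hence a product of chi with an object that is
    smooth on W is smooth on each of two open sets, and so everywhere. *)
Lemma bump_function (W : set M) (p : M) : open_in W -> W p ->
  exists (chi : M -> R) (V Z : set M),
    [/\ smooth_on setT chi, open_in V /\ V p, (forall x, V x -> chi x = 1),
        open_in Z /\ (forall x, Z x -> chi x = 0) & forall x, W x \/ Z x].
Proof.
move=> oW Wp; have [i di] := pre_cover HM p; pose z0 := crd i p.
have : nbhs z0 (crd i @` (cdom i `&` W)).
  by apply: open_nbhs_nbhs; split; [exact: oW|exists p].
move=> /(nbhs_dist _ _).1[e e0 he].
pose e' := e / 2; have e'0 : 0 < e' by rewrite divr_gt0.
pose K : set 'rV[R]_(mdim M) := [set z | `|z0 - z| <= e'].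
have sK : K `<=` crd i @` (cdom i `&` W).
  move=> z Kz; apply: he; apply: le_lt_trans Kz _.
  by rewrite /e' ltr_pdivrMr // ltr_pMr // ltr1n.
have cK : compact K.
  apply: bounded_closed_compact.
    exists (`|z0| + e'); split; first exact: num_real.
    move=> x hx z Kz; apply: ltW; apply: le_lt_trans hx.
    rewrite -[z](subKr z0) (le_trans (ler_normB _ _)) // lerD2l.
    exact: Kz.
  have -> : K = (fun z => `|z0 - z|) @^-1` [set r | r <= e'] by [].
  apply: closed_comp; last exact: closed_le.
  by move=> z _; exact: continuous_dist.
have oZ : open_in (~` (cdom i `&` crd i @^-1` K)).
  by apply: compact_chart_closed => // z /sK[x [dx _] <-]; exists x.
(* The norm is the maximum norm, so the ball K is a cube, and a product over the coordinates
   vanishes exactly off its interior. *)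
pose beta (z : 'rV[R]_(mdim M)) : R :=
  \prod_c flat 0 (e' ^+ 2 - (z 0 c - z0 0 c) * (z 0 c - z0 0 c)).
pose b := beta z0.
have b0 : 0 < b.
  apply: prodr_gt0 => c _; rewrite subrr mul0r subr0.
  by apply: flat0_gt0; rewrite exprn_gt0.
have betas k : Ck k [set: 'rV[R]_(mdim M)] beta.
  have oT : open [set: 'rV[R]_(mdim M)] by exact: openT.
  have h1 c : Ck k [set: 'rV[R]_(mdim M)] (fun z => z 0 c - z0 0 c).
    by apply: Ck_add => //; [exact: Ck_coord|exact: Ck_cst].
  apply: Ck_prod => // c; apply: Ck_flat => //.
  apply: Ck_add => //; first exact: Ck_cst.
  by under eq_fun do rewrite -mulN1r; apply: Ck_mul; [|exact: Ck_cst|exact: Ck_mul].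
(* The factor 2 / b makes the argument at least 1, hence the value equal to 1, wherever beta is at
   least half its value at the centre. *)
pose th z := step (2 / b * beta z).
have ths k : Ck k [set: 'rV[R]_(mdim M)] th.
  by apply: Ck_step; [exact: openT|apply: Ck_mul => //; [exact: openT|apply: Ck_cst; exact: openT]].
pose chi (x : M) : R := if pselect (cdom i x) then th (crd i x) else 0.
have chiE x : cdom i x -> chi x = th (crd i x).
  by move=> dx; rewrite /chi; case: pselect.
have chiZ x : (~` (cdom i `&` crd i @^-1` K)) x -> chi x = 0.
  move=> nx; rewrite /chi; case: pselect => // dx.
  have /existsNP[c /negP] : ~ (forall c, `|(z0 - crd i x) 0 c| <= e').
    by move=> h; apply: nx; split=> //; apply: rV_norm_le => //; exact: ltW.
  rewrite -ltNge !mxE => hc; rewrite /th step_le0 //.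
  rewrite /beta (bigD1 c) //= flat0_le0 ?mul0r ?mulr0 //.
  rewrite subr_le0 -expr2 -[leRHS]real_normK ?num_real // distrC.
  by rewrite ler_pXn2r ?nnegrE ?normr_ge0 //; exact: ltW.
exists chi, (cdom i `&` crd i @^-1` [set z | b / 2 < beta z]), (~` (cdom i `&` crd i @^-1` K)).
split; last 2 first.
- by split; [exact: oZ|exact: chiZ].
- move=> x; case: (pselect ((cdom i `&` crd i @^-1` K) x)) => h; last by right.
  left; have [dx /sK[y [dy Wy] yx]] := h.
  by rewrite -(pre_inj HM dy dx yx).
- apply: smooth_on_local; first exact: open_inT.
  move=> x _; case: (pselect (cdom i x)) => dx.
    exists (cdom i); split=> //; first exact: pre_open.
    apply: (@smooth_on_chart i _ _ th) => //; first exact: pre_open.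
    by move=> k; exact: Ck_sub (ths k).
  exists (~` (cdom i `&` crd i @^-1` K)); split => //; first by case.
  by apply: (@smooth_on_eq _ (fun=> 0)); [move=> y /chiZ|exact: smooth_on_cst].
- split; last by split=> //=; rewrite ltr_pdivrMr // ltr_pMr // ltr1n.
  apply: open_in_chart; apply: (@open_comp _ _ beta [set r | b / 2 < r]).
    by move=> z _; exact: (Ck_cont (betas 0%N)).
  exact: open_gt.
- move=> x [dx /=]; rewrite chiE // => hb; apply: step_ge1.
  rewrite mulrAC ler_pdivlMr // mul1r -ler_pdivrMl // mulrC; exact: ltW.
Qed.

End Premanifolds.

Arguments open_inI {R M} HM {W W'} _ _.
Arguments open_inT {R M} HM.

(** * Vector bundles *)

Arguments tdom_open {R M A} _ i.

Definition smooth_sect_on (R : realType) (M : atlas R) (A : prebundle M)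
    (W : set M) (s : sect A) : Prop :=
  forall (i : tchart A) (c : 'I_(brank A)),
    smooth_on (W `&` tdom i) (fun x => triv i (s x) 0 c).

Section BundleTheory.
Context (R : realType) (M : atlas R) (HM : is_premanifold M).

Context (A : prebundle M) (HA : is_vbundle A).
Implicit Types (W : set M) (s t : sect A).

Section Fibers.
Context (i : tchart A) (x : M) (dx : tdom i x).

Lemma triv0 : triv i (0 : A x) = 0.
Proof.
have := triv_linear HA dx 1 0 0; rewrite scaler0 addr0 scale1r => /eqP.
by rewrite eq_sym -subr_eq0 addrK => /eqP.
Qed.

Lemma trivD (e e' : A x) : triv i (e + e') = triv i e + triv i e'.
Proof. by have := triv_linear HA dx 1 e e'; rewrite !scale1r. Qed.

Lemma trivZ (a : R) (e : A x) : triv i (a *: e) = a *: triv i e.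
Proof. by have := triv_linear HA dx a e 0; rewrite !addr0 triv0 addr0. Qed.

Lemma triv_sum (I : Type) (r : seq I) (P : pred I) (F : I -> A x) :
  triv i (\sum_(j <- r | P j) F j) = \sum_(j <- r | P j) triv i (F j).
Proof.
elim: r => [|a r IH]; first by rewrite !big_nil triv0.
by rewrite !big_cons; case: ifP => // _; rewrite trivD IH.
Qed.

Lemma triv_inj (e e' : A x) : triv i e = triv i e' -> e = e'.
Proof. exact: (bij_inj (triv_bij HA dx)). Qed.

Lemma frameE c : triv i (frame i c x) = delta_mx 0 c.
Proof.
rewrite /frame; case: xgetP => // h.
by have [g _ gK] := triv_bij HA dx; have := h (g (delta_mx 0 c)); rewrite /= gK.
Qed.

Lemma frame_decomp (e : A x) : e = \sum_c triv i e 0 c *: frame i c x.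
Proof.
apply: triv_inj; rewrite triv_sum.
rewrite [LHS]row_sum_delta; apply: eq_bigr => c _.
by rewrite trivZ frameE.
Qed.

End Fibers.

Lemma smooth_sectT s : smooth_sect s <-> smooth_sect_on setT s.
Proof. by split=> h i c; move: (h i c); rewrite setTI. Qed.

Lemma smooth_sect_onS W W' s : W' `<=` W -> smooth_sect_on W s ->
  smooth_sect_on W' s.
Proof. by move=> sW h i c; apply: smooth_onS (h i c); exact: setSI. Qed.

Lemma smooth_sectW W s : smooth_sect s -> smooth_sect_on W s.
Proof. by move=> /smooth_sectT; exact: smooth_sect_onS. Qed.

Lemma smooth_sect_on_eq W s t : (forall x, W x -> s x = t x) ->
  smooth_sect_on W s -> smooth_sect_on W t.
Proof.
by move=> st h i c; apply: smooth_on_eq (h i c) => x [Wx _]; rewrite st.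
Qed.

Lemma smooth_sect_on_local W s : open_in W ->
  (forall x, W x -> exists W', [/\ open_in W', W' x & smooth_sect_on W' s]) ->
  smooth_sect_on W s.
Proof.
move=> oW h i c; apply: (smooth_on_local HM).
  exact (open_inI HM oW (tdom_open HA i)).
move=> x [/h[W' [oW' W'x hW']] dx]; exists (W' `&` tdom i); split=> //.
exact (open_inI HM oW' (tdom_open HA i)).
Qed.

Lemma smooth_sect_on_triv (i : tchart A) W s : open_in W -> W `<=` tdom i ->
  (forall c, smooth_on W (fun x => triv i (s x) 0 c)) -> smooth_sect_on W s.
Proof.
move=> oW sW h j c; have [T [hT TE]] := triv_smooth HA i j.
have oWj := open_inI HM oW (tdom_open HA j).
apply: (@smooth_on_eq _ _ _ (fun x => \sum_a triv i (s x) 0 a * T x a c)).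
  by move=> x [/sW di dj]; rewrite (TE x di dj) mxE.
apply: smooth_on_sum => // a _; apply: smooth_on_mul => //.
  by apply: smooth_onS (h a); exact: subIsetl.
by apply: smooth_onS (hT a c); exact: setSI.
Qed.

Lemma smooth_sect_on_add W s t : open_in W -> smooth_sect_on W s ->
  smooth_sect_on W t -> smooth_sect_on W (fun x => s x + t x).
Proof.
move=> oW hs ht i c.
apply: (@smooth_on_eq _ _ _ (fun x => triv i (s x) 0 c + triv i (t x) 0 c)).
  by move=> x [_ dx]; rewrite trivD // mxE.
by apply: smooth_on_add => //; exact (open_inI HM oW (tdom_open HA i)).
Qed.

Lemma smooth_sect_on_scale W (f : M -> R) s : open_in W -> smooth_on W f ->
  smooth_sect_on W s -> smooth_sect_on W (fun x => f x *: s x).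
Proof.
move=> oW hf hs i c.
apply: (@smooth_on_eq _ _ _ (fun x => f x * triv i (s x) 0 c)).
  by move=> x [_ dx]; rewrite trivZ // mxE.
apply: smooth_on_mul => //; first exact (open_inI HM oW (tdom_open HA i)).
by apply: smooth_onS hf; exact: subIsetl.
Qed.

Lemma smooth_sect_on0 W : open_in W -> smooth_sect_on W (fun x => 0 : A x).
Proof.
move=> oW i c; apply: (@smooth_on_eq _ _ _ (fun=> 0)).
  by move=> x [_ dx]; rewrite triv0 // mxE.
by apply: smooth_on_cst; exact (open_inI HM oW (tdom_open HA i)).
Qed.

Lemma smooth_sect_on_sum W (I : Type) (r : seq I) (P : pred I)
    (F : I -> sect A) : open_in W -> (forall i, P i -> smooth_sect_on W (F i)) ->
  smooth_sect_on W (fun x => \sum_(i <- r | P i) F i x).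
Proof.
move=> oW h; elim: r => [|a r IH].
  apply: (@smooth_sect_on_eq _ (fun x => 0 : A x)); last exact: smooth_sect_on0.
  by move=> x _; rewrite big_nil.
case Pa : (P a).
  apply: (@smooth_sect_on_eq _ (fun x => F a x + \sum_(i <- r | P i) F i x)).
    by move=> x _; rewrite big_cons Pa.
  by apply: smooth_sect_on_add => //; exact: h.
by apply: smooth_sect_on_eq IH => x _; rewrite big_cons Pa.
Qed.

Lemma smooth_frame i c : smooth_sect_on (tdom i) (frame i c : sect A).
Proof.
apply: (@smooth_sect_on_triv i) => //; first exact (tdom_open HA i).
move=> a; apply: (@smooth_on_eq _ _ _ (fun=> (delta_mx 0 c : 'rV[R]_(brank A)) 0 a)).
  by move=> x dx; rewrite frameE.
exact/smooth_on_cst/(tdom_open HA i).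
Qed.

End BundleTheory.

(** The tool for making local data global: connections and brackets act on global sections only, so
    local functions and frames are first multiplied by chi and extended by zero. One chi serves
    functions and sections of every bundle. *)
Lemma cutoff (R : realType) (M : atlas R) (HM : is_premanifold M) (W : set M)
    (p : M) : open_in W -> W p ->
  exists (chi : M -> R) (V : set M),
    [/\ smooth_on setT chi,
        [/\ open_in V, V p & forall x, V x -> chi x = 1],
        forall x, W x \/ chi x = 0,
        forall f : M -> R, smooth_on W f -> smooth_on setT (fun x => chi x * f x)
      & forall A : prebundle M, is_vbundle A -> forall s : sect A,
          smooth_sect_on W s -> smooth_sect (fun x => chi x *: s x)].
Proof.
move=> oW Wp.
have [chi [V [Z [hc [oV Vp] c1 [oZ c0] WZ]]]] := bump_function HM oW Wp.
exists chi, V; split=> //; first by move=> x; case: (WZ x) => h; [left|right; exact: c0].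
- move=> f hf; apply: (smooth_on_local HM); first exact (open_inT HM).
  move=> x _; have [Wx|Zx] := WZ x.
    by exists W; split=> //; apply: smooth_on_mul => //; exact: smooth_onS hc.
  exists Z; split=> //; apply: (@smooth_on_eq _ _ _ (fun=> 0)).
    by move=> y Zy; rewrite c0 // mul0r.
  exact: smooth_on_cst.
- move=> A HA s hs; apply/smooth_sectT.
  apply: (smooth_sect_on_local HM HA); first exact (open_inT HM).
  move=> x _; have [Wx|Zx] := WZ x.
    exists W; split=> //; apply: (smooth_sect_on_scale HM HA) => //.
    exact: smooth_onS hc.
  exists Z; split=> //; apply: (@smooth_sect_on_eq _ _ _ _ (fun x => 0 : A x)).
    by move=> y Zy; rewrite c0 // scale0r.
  exact: (smooth_sect_on0 HM HA).
Qed.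

Lemma sect_through (R : realType) (M : atlas R) (HM : is_premanifold M)
    (A : prebundle M) (HA : is_vbundle A) x (e : A x) :
  exists s : sect A, smooth_sect s /\ s x = e.
Proof.
have [i di] := tdom_cover HA x.
have oi := tdom_open HA i.
have [chi [V [_ [_ Vx c1] _ _ hs]]] := cutoff HM oi di.
exists (fun y => chi y *: \sum_c triv i e 0 c *: frame i c y); split.
  apply: hs => //; apply: (smooth_sect_on_sum HM HA) => // c _.
  apply: (smooth_sect_on_scale HM HA) => //; last exact: (smooth_frame HM HA).
  exact: smooth_on_cst.
by rewrite c1 // scale1r -(frame_decomp HA di e).
Qed.

(** * The total space of a vector bundle and its pullback bundle *)

Section TotalSpace.
Context (R : realType) (B : atlas R) (HB : is_premanifold B).
Context (E : prebundle B) (HE : is_vbundle E).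
Let TE := total_space E.
Let n := mdim B.
Let r := brank E.

Lemma lsubmx_cont : continuous (lsubmx : 'rV[R]_(n + r) -> 'rV[R]_n).
Proof.
move=> z; apply: (@rV_cvg _ _ _ (nbhs z)) => c; rewrite mxE.
by under eq_cvg do rewrite mxE; exact: coord_continuous.
Qed.

Lemma Ck_lsubmx k (U : set 'rV[R]_n) (V : set 'rV[R]_(n + r)) g : open U ->
  open V -> (forall z, V z -> U (lsubmx z)) -> Ck k U g ->
  Ck k V (fun z => g (lsubmx z)).
Proof.
move=> oU oV VU hg; apply: (Ck_comp oV oU VU hg) => c.
by under eq_fun do rewrite mxE; exact: Ck_coord.
Qed.

(** In a chart the image is the full cylinder over the image downstairs, because trivializations are
    onto on each fibre. *)
Lemma open_in_pull (W : set B) : open_in W ->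
  open_in ((@bproj R B E : TE -> B) @^-1` W).
Proof.
move=> oW [i j] /=.
rewrite (_ : _ @` _ =
    lsubmx @^-1` (crd i @` (cdom i `&` (tdom j `&` W)))); last first.
  apply/seteqP; split.
    move=> _ [[b e] [[/= di dj] Wb] <-]; exists b; rewrite ?row_mxKl //.
  move=> z /= [b [di [dj Wb]] bz].
  have [g _ gK] := triv_bij HE dj.
  exists (existT _ b (g (rsubmx z))) => //=.
  by rewrite gK bz hsubmxK.
apply: open_comp; first by move=> z _; exact: lsubmx_cont.
exact (open_inI HB (tdom_open HE j) oW i).
Qed.

Arguments open_in_pull {W} _.

Lemma smooth_on_pull (W : set B) (f : B -> R) : open_in W -> smooth_on W f ->
  smooth_on ((@bproj R B E : TE -> B) @^-1` W) (fun v => f (bproj v)).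
Proof.
move=> oW hf [i j]; have [g [gs fg]] := hf i.
exists (fun z => g (lsubmx z)); split; last first.
  by move=> [b e] /= [di dj] Wb; rewrite row_mxKl; exact: fg.
move=> k; apply: (Ck_lsubmx _ _ _ (gs k)); first exact (oW i).
  exact (open_in_pull oW (i, j)).
by move=> _ [[b e] [[/= di dj] Wb] <-]; rewrite row_mxKl; exists b.
Qed.

(** Read in another trivialization l, the fibre coordinate is linear in the fibre coordinates of l,
    with the smooth transition matrix as coefficients. *)
Lemma smooth_on_fiber (j : tchart E) c :
  smooth_on ((@bproj R B E : TE -> B) @^-1` tdom j)
    (fun v => triv j (projT2 v) 0 c).
Proof.
move=> [i l]; have [T [hT TE']] := triv_smooth HE l j.
have oU : open (crd ((i, l) : chart TE) @`
   (cdom ((i, l) : chart TE) `&` (@bproj R B E : TE -> B) @^-1` tdom j)).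
  exact (open_in_pull (tdom_open HE j) (i, l)).
have oV : open (crd i @` (cdom i `&` (tdom l `&` tdom j))).
  exact (open_inI HB (tdom_open HE l) (tdom_open HE j) i).
have [g hg] := choice (fun a => hT a c i).
exists (fun z : 'rV[R]_(n + r) => \sum_a z 0 (rshift n a) * g a (lsubmx z)); split.
  move=> k; apply: Ck_sum => // a _; apply: Ck_mul => //; first exact: Ck_coord.
  apply: (Ck_lsubmx oV oU _ ((hg a).1 k)).
  by move=> _ [[b e] [[/= di dl] dj] <-]; rewrite row_mxKl; exists b.
move=> [b e] /= [di dl] dj; rewrite (TE' b dl dj) mxE.
apply: eq_bigr => a _; rewrite row_mxKl row_mxEr; congr (_ * _).
by rewrite (hg a).2.
Qed.

Lemma total_space_pre : is_premanifold TE.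
Proof.
have HO (ij : chart TE) : open_in (cdom ij).
  rewrite (_ : cdom ij = (@bproj R B E : TE -> B) @^-1` (cdom ij.1 `&` tdom ij.2)) //.
  apply: open_in_pull; exact (open_inI HB (pre_open HB ij.1) (tdom_open HE ij.2)).
have HC (ij : chart TE) c : smooth_on (cdom ij) (fun x => crd ij x 0 c).
  case: ij c => i j c; rewrite -(splitK (c : 'I_(n + r))); case: (fintype.split _) => a /=.
    apply: (@smooth_on_eq _ _ _ (fun x : TE => crd i (bproj x) 0 a)).
      by move=> x _; rewrite row_mxEl.
    have := smooth_on_pull (pre_open HB i) (pre_smooth HB i a).
    by apply: smooth_onS => x [].
  apply: (@smooth_on_eq _ _ _ (fun x : TE => triv j (projT2 x) 0 a)).
    by move=> x _; rewrite row_mxEr.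
  by apply: smooth_onS (smooth_on_fiber j a) => x [].
have HI (ij : chart TE) (x y : TE) :
    cdom ij x -> cdom ij y -> crd ij x = crd ij y -> x = y.
  case: ij x y => i j [b e] [b' e'] /= [di dj] [di' dj'] /eq_row_mx[h1 h2].
  have bb := pre_inj HB di di' h1; case: _ / bb in e' dj' h2 di' *.
  by congr existT; exact: (triv_inj HE dj h2).
split=> //.
- move=> [b e]; have [i di] := pre_cover HB b; have [j dj] := tdom_cover HE b.
  by exists (i, j).
(* Points over distinct base points are separated downstairs. Points of one fibre differ in some
   fibre coordinate, and are separated at the midpoint m of its two values. *)
- move=> x y xy; case: (pselect (bproj x = bproj y)) => [bb|nb]; last first.
    have [U [V [oU oV Ux Vy UV]]] := pre_hausdorff HB nb.
    exists ((@bproj R B E : TE -> B) @^-1` U), ((@bproj R B E : TE -> B) @^-1` V).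
    split=> //; try exact: open_in_pull.
    apply/seteqP; split=> // z [Uz Vz].
    by have : (U `&` V) (bproj z) by []; rewrite UV.
  have [i di] := pre_cover HB (bproj x); have [j dj] := tdom_cover HE (bproj x).
  pose f (v : TE) c := triv j (projT2 v) 0 c.
  have [c hc] : exists c, f x c != f y c.
    apply: contrapT => /forallNP h; apply: xy; apply: (HI (i, j)).
    + by [].
    + by rewrite /cdom /= -/(bproj y) -bb.
    + case: x y bb di dj h => b e [b' e'] /= bb di dj h.
      rewrite -/(bproj (existT _ b e)) in bb *; rewrite /bproj /= in bb *.
      case: _ / bb in e' h *; congr row_mx; apply/rowP => c.
      by apply/eqP/negPn/negP; exact: h.
  pose m := (f x c + f y c) / 2.
  have oj := open_in_pull (tdom_open HE j).
  have hpre := @smooth_on_fiber j c.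
  have dy : tdom j (bproj y) by rewrite -bb.
  have [P [Q [oP oP' [Px Qy PQ]]]] : exists P Q : set R,
      [/\ open P, open Q & [/\ P (f x c), Q (f y c) & P `&` Q = set0]].
    have [lt|gt|eq] := ltgtP (f x c) (f y c); last by rewrite eq eqxx in hc.
      exists [set t | t < m], [set t | t > m]; split.
      + exact: open_lt.
      + exact: open_gt.
      + split=> /=; rewrite ?midf_lt //.
        by apply/seteqP; split=> // t [/= h1 h2]; have := lt_trans h1 h2; rewrite ltxx.
    exists [set t | t > m], [set t | t < m]; split.
    + exact: open_gt.
    + exact: open_lt.
    + split=> /=; rewrite /m ?[f x c + _]addrC ?midf_lt //.
      by apply/seteqP; split=> // t [/= h1 h2]; have := lt_trans h1 h2; rewrite ltxx.
  exists ((@bproj R B E : TE -> B) @^-1` tdom j `&` (fun v => f v c) @^-1` P).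
  exists ((@bproj R B E : TE -> B) @^-1` tdom j `&` (fun v => f v c) @^-1` Q).
  have hO (S0 : set R) : open S0 -> open_in
    ((@bproj R B E : TE -> B) @^-1` tdom j `&` (fun v => f v c) @^-1` S0).
    move=> oS i'; rewrite openE => _ [v [di' [dv Qv]] <-].
    have [g [gs fg]] := hpre i'.
    have cx : (crd i' @` (cdom i' `&` (@bproj R B E : TE -> B) @^-1` tdom j))
       (crd i' v) by exists v.
    have h1 : nbhs (crd i' v) (g @^-1` S0).
      apply: (Ck_cont (gs 0%N) cx); apply: open_nbhs_nbhs; split=> //.
      by rewrite -fg.
    apply: filterS (filterI h1 (open_nbhs_nbhs (conj (oj i') cx))).
    move=> z [Oz [y' [ej ei] yz]]; exists y' => //; split=> //; split=> //.
    by move: Oz; rewrite -yz /= -fg.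
  split=> //; [exact: hO|exact: hO|].
  apply/seteqP; split=> // z [[_ h1] [_ h2]].
  by have : (P `&` Q) (f z c) by []; rewrite PQ.
Qed.

Lemma pull_smooth (s : sect E) : smooth_sect s -> smooth_sect (pull_sect s).
Proof. by move=> hs i c; apply: smooth_on_pull (hs i c); exact (tdom_open HE i). Qed.

Lemma euler_smooth : smooth_sect (@euler R B E).
Proof. by move=> i c; exact: smooth_on_fiber. Qed.

Lemma pullE_vbundle : is_vbundle (pullE E).
Proof.
split.
- by move=> v; exact: (tdom_cover HE).
- by move=> i; exact (open_in_pull (tdom_open HE i)).
- by move=> i v dv; exact: (triv_linear HE dv).
- by move=> i v dv; exact: (triv_bij HE dv).
- move=> i j; have [T [hT TE']] := triv_smooth HE i j.
  exists (fun v => T (bproj v)); split; last by move=> v di dj; exact: TE'.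
  move=> a b; have := smooth_on_pull _ (hT a b); apply.
  exact (open_inI HB (tdom_open HE i) (tdom_open HE j)).
Qed.

End TotalSpace.

Arguments open_in_pull {R B} HB {E} HE {W} _.

(** * Linear differential equations *)

Section Antiderivative.
Context (R : realType).

Local Notation primitive a x f :=
  (\int[@lebesgue_measure R]_(t in `[a, x]) (f t : R)).

Lemma continuous_integrable (f : R -> R) (a b : R) : continuous f ->
  (@lebesgue_measure R).-integrable `[a, b] (EFin \o f).
Proof.
move=> cf; apply: continuous_compact_integrable; first exact: segment_compact.
exact: continuous_subspaceT.
Qed.

Lemma primitive_shift (f : R -> R) (a b x : R) : continuous f -> a <= b ->
  b <= x -> primitive a x f - primitive b x f = primitive a b f - primitive b b f.
Proof.
move=> cf ab bx.
have h1 := @Rintegral_itvB R f (BLeft a) (BRight x) b (continuous_integrable a x cf).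
have h2 := @Rintegral_itvB R f (BLeft b) (BRight x) b (continuous_integrable b x cf).
have alg (p q t u d : R) : p - q = d -> t - u = d -> p - t = q - u by lra.
exact: alg (h1 ab bx) (h2 (lexx b) bx).
Qed.

(** An integral over [[a, x]] is 0 for x < a, so no fixed base point serves the whole line. The base
    point b x lies to the left of both x and 0, and [primitive_shift] shows that its choice does not
    affect the difference. *)
Lemma antiderivative (f : R -> R) : continuous f ->
  exists G : R -> R, G 0 = 0 /\ forall x : R, is_derive x 1 G (f x).
Proof.
move=> cf; pose b (x : R) : R := - (`|x| + 1).
exists (fun x => primitive (b x) x f - primitive (b x) 0 f).
split=> [|x]; first exact: subrr.
(* A base point to the left of b y for every y within distance 1 of x, so that a single primitive
   can be differentiated at x. *)
pose a : R := - (`|x| + 2).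
have ax : a < x.
  by rewrite /a ltrNl; apply: le_lt_trans (ler_norm (- x)) _; rewrite normrN ltrDl.
have [h1 h2] := continuous_FTC1_closed (ltr_pwDr ltr01 (lexx x))
  (@continuous_integrable f a (x + 1) cf) ax (cf x).
have h : is_derive x 1 (fun y => primitive a y f) (f x).
  exact: DeriveDef h1 (etrans (esym (derive1E _ _)) h2).
have := is_derive_add h (is_derive_cst (- primitive a 0 f) x 1).
rewrite addr0; apply: near_eq_is_derive.
near=> y.
have yx : `|y| <= `|x| + 1.
  rewrite -[y](subrK x) (le_trans (ler_normD _ _)) // addrC lerD2l distrC ltW //.
have ab : a <= b y by rewrite /a /b lerN2; lra.
have by0 : b y <= 0 by rewrite oppr_le0 addr_ge0.
have byy : b y <= y.
  by rewrite /b lerNl (le_trans (ler_norm _)) // normrN lerDl.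
have alg (p q t u d : R) : p - q = d -> t - u = d -> p - t = q - u by lra.
exact: alg (primitive_shift cf ab byy) (primitive_shift cf ab by0).
Unshelve. all: by end_near. Qed.

(** Integration gains a factor 1/K in the norm weighted by exp(-K|x|), so Picard iteration contracts
    on the whole line at once. For x >= 0 the difference c exp(K x) - G x is nondecreasing;
    reflection gives the other side. *)
Lemma exp_comparison (G g : R -> R) (c K : R) : 0 <= c -> 0 < K -> G 0 = 0 ->
  (forall x : R, is_derive x 1 G (g x)) ->
  (forall x, `|g x| <= c * K * expR (K * `|x|)) ->
  forall x, `|G x| <= c * expR (K * `|x|).
Proof.
move=> c0 K0.
have pos (H h : R -> R) : H 0 = 0 -> (forall x : R, is_derive x 1 H (h x)) ->
    (forall x, `|h x| <= c * K * expR (K * `|x|)) ->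
    forall x, 0 <= x -> H x <= c * expR (K * x).
  move=> H0 hd hb x x0.
  pose F y := c * expR (K * y) - H y.
  have dF (y : R) : is_derive y 1 F (c * (expR (K * y) * K) - h y).
    have dK : is_derive y 1 (fun y : R => K * y) K.
      apply: is_derive_eq (is_derive_mul (is_derive_cst K y 1) (is_derive_id _ _)) _.
      by rewrite mul0r add0r mulr1.
    have := is_derive_chain dK (is_derive_expR (K * y)) => dE.
    apply: is_derive_eq (is_derive_add (is_derive_mul (is_derive_cst c y 1) dE)
      (is_derive_opp (hd y))) _.
    by rewrite mul0r add0r.
  have [y /andP[y0 _] E] := mean_value x0 (fun y _ => dF y).
  have : 0 <= F x - F 0.
    rewrite E subr0 mulr_ge0 // subr_ge0 (le_trans (ler_norm _)) //.
    by apply: le_trans (hb y) _; rewrite ger0_norm // -mulrA [K * _]mulrC.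
  rewrite /F H0 mulr0 expR0 subr0 mulr1; lra.
move=> G0 hd hb x; wlog x0 : G g x G0 hd hb / 0 <= x.
  move=> hw; have [x0|x0] := leP 0 x; first exact: hw hd hb x0.
  have := hw (fun y => G (- y)) (fun y => g (- y) * -1) (- x).
  rewrite opprK normrN; apply.
  - by rewrite oppr0.
  - by move=> y; rewrite mulrN1 normrN -(normrN y).
  - by rewrite oppr_ge0 ltW.
rewrite (ger0_norm x0) ler_norml; apply/andP; split; last exact: pos hd hb _ x0.
rewrite lerNl; apply: (pos (fun y => - G y) (fun y => - g y)) => //.
- by rewrite G0 oppr0.
- by move=> y; rewrite normrN.
Qed.

(** The radius 2 c / 2^n is the tail of the geometric series, so the intervals of that radius around
    the u n are nested, and the supremum of their left ends lies in all of them. *)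
Lemma geometric_limit (u : nat -> R) (c : R) :
  (forall n, `|u n.+1 - u n| <= c / 2 ^+ n) ->
  exists l, forall n, `|l - u n| <= 2 * c / 2 ^+ n.
Proof.
move=> hu; pose v n := u n + 2 * c / 2 ^+ n; pose w n := u n - 2 * c / 2 ^+ n.
have half n : 2 * c / 2 ^+ n.+1 = c / 2 ^+ n.
  by rewrite exprS; field; rewrite expf_neq0.
have two n : 2 * c / 2 ^+ n = c / 2 ^+ n + c / 2 ^+ n by field; rewrite expf_neq0.
have c0 n : 0 <= c / 2 ^+ n by apply: le_trans (hu n).
have vdec n m : (n <= m)%N -> v m <= v n.
  elim: m => [|m IH]; first by rewrite leqn0 => /eqP ->.
  rewrite leq_eqVlt => /predU1P[-> //|/IH]; apply: le_trans.
  rewrite /v half two; have := hu m; rewrite ler_norml => /andP[_]; lra.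
have winc n m : (n <= m)%N -> w n <= w m.
  elim: m => [|m IH]; first by rewrite leqn0 => /eqP ->.
  rewrite leq_eqVlt => /predU1P[-> //|/IH]; move/le_trans; apply.
  rewrite /w half two; have := hu m; rewrite ler_norml => /andP[+ _]; lra.
have wv n m : w n <= v m.
  have nm : w (maxn n m) <= v (maxn n m).
    by rewrite /w /v two; have := c0 (maxn n m); lra.
  apply: le_trans (winc _ _ (leq_maxl n m)) _.
  exact: le_trans nm (vdec _ _ (leq_maxr n m)).
exists (sup (range w)) => n; rewrite ler_distl; apply/andP; split.
  by apply: ub_le_sup; [exists (v 0%N) => _ [m _ <-]|exists n].
by apply: ge_sup; [exists (w 0%N), 0%N|move=> _ [m _ <-]; exact: wv].
Qed.

End Antiderivative.

Section LinearODE.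
Context (R : realType).

Lemma sum_mul_bound (I : finType) (u a : I -> R) (c C : R) :
  (forall j, `|u j| <= c) -> (forall j, `|a j| <= C) ->
  `|\sum_j u j * a j| <= #|I|%:R * (c * C).
Proof.
move=> hu ha; apply: le_trans (ler_norm_sum _ _ _) _.
rewrite mulr_natl -sumr_const; apply: ler_sum => j _.
by rewrite normrM ler_pM.
Qed.

Lemma linear_ode_step (I : finType) (A : R -> I -> I -> R) (x0 : I -> R)
    (X : R -> I -> R) :
  (forall j k, continuous (fun s => A s j k)) ->
  (forall k, continuous (fun s => X s k)) ->
  exists Y : R -> I -> R, (forall k, Y 0 k = x0 k) /\
    forall (s : R) k,
      is_derive s 1 (fun s => Y s k) (\sum_j X s j * A s j k).
Proof.
move=> cA cX.
have cf k : continuous (fun s => \sum_j X s j * A s j k).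
  move=> s; apply: (@continuous_sumr R R) => j _.
  by apply: continuousM; [exact: cX|exact: cA].
have [G hG] := choice (fun k => antiderivative (cf k)).
exists (fun s k => x0 k + G k s); split=> [k|s k]; first by rewrite (hG k).1 addr0.
by rewrite -[X in is_derive _ _ _ X]add0r; apply: is_derive_add; exact: (hG k).2.
Qed.

(** Picard iteration on the whole line. Unknowns are row vectors, multiplied by A on the right. *)
Lemma linear_ode_exists (I : finType) (A : R -> I -> I -> R) (C : R)
    (x0 : I -> R) :
  (forall j k, continuous (fun s => A s j k)) ->
  (forall s j k, `|A s j k| <= C) ->
  exists x : R -> I -> R, (forall k, x 0 k = x0 k) /\
    forall (s : R) k,
      is_derive s 1 (fun s => x s k) (\sum_j x s j * A s j k).
Proof.
(* K exceeds twice the bound m |C| of the linear map, so each iteration halves the weighted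
   distance; the 1 makes K positive. *)
move=> cA bA; pose m : R := #|I|%:R; pose K : R := 2 * (m * `|C|) + 1.
pose M : R := \sum_j `|x0 j|.
have bA' s j k : `|A s j k| <= `|C| by apply: le_trans (bA s j k) (ler_norm C).
have m0 : 0 <= m by rewrite ler0n.
have mC0 : 0 <= m * `|C| by rewrite mulr_ge0.
have K0 : 0 < K by rewrite ltr_wpDl // mulr_ge0.
have M0 : 0 <= M by rewrite sumr_ge0.
have mK (c : R) : 0 <= c -> m * (c * `|C|) <= (c / 2) * K.
  move=> c0; rewrite /K; have : 0 <= c * (m * `|C|) by rewrite mulr_ge0.
  by move: c0; lra.
(* The iteration step chooses antiderivatives, which exist for continuous curves; bundling
   continuity turns the choice into a self-map. *)
pose T := {X : R -> I -> R | forall k, continuous (fun s => X s k)}.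
have [F hF] : {F : T -> T & forall X : T, (forall k, sval (F X) 0 k = x0 k) /\
    forall (s : R) k, is_derive s 1 (fun s => sval (F X) s k)
      (\sum_j sval X s j * A s j k)}.
  apply: (@choice _ _ (fun X Y : T => (forall k, sval Y 0 k = x0 k) /\
    forall (s : R) k, is_derive s 1 (fun s => sval Y s k)
      (\sum_j sval X s j * A s j k))) => -[X cX].
  have [Y [Y0 dY]] := linear_ode_step x0 cA cX.
  have cY k : continuous (fun s => Y s k).
    by move=> s; exact: is_derive_cont (dY s k).
  by exists (exist _ Y cY).
have cX0 k : continuous (fun s : R => (fun _ => x0) s k).
  by move=> s; exact: cst_continuous.
pose X n := sval (iter n F (exist _ (fun _ : R => x0) cX0 : T)).
have X0 n k : X n 0 k = x0 k by case: n => [|n] //; exact: (hF _).1.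
have XS n (s : R) k : is_derive s 1 (fun s => X n.+1 s k) (\sum_j X n s j * A s j k).
  exact: (hF _).2.
have XC n k : continuous (fun s => X n s k).
  exact: svalP (iter n F _) k.
have e1 (s : R) : 1 <= expR (K * `|s|).
  by apply: le_trans (expR_ge1Dx _); rewrite lerDl mulr_ge0 // ltW.
have bD n (s : R) k : `|X n.+1 s k - X n s k| <= (M * expR (K * `|s|)) / 2 ^+ n.
  rewrite mulrAC; elim: n s k => [|n IH] s k.
    apply: (@exp_comparison _ (fun s => X 1%N s k - X 0%N s k)
        (fun s => \sum_j x0 j * A s j k)) => //.
    + by rewrite expr0 divr1.
    + by rewrite !X0 subrr.
    + move=> t; rewrite -[X in is_derive _ _ _ X]subr0.
      apply: (is_derive_add (XS 0%N t k)); apply: is_derive_opp.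
      exact: is_derive_cst.
    + move=> t; have hx j : `|x0 j| <= M.
        by rewrite /M (bigD1 j) //= lerDl sumr_ge0.
      apply: le_trans (sum_mul_bound hx (fun j => bA' t j k)) _.
      apply: le_trans (mK _ M0) _; rewrite expr0 divr1.
      apply: (@le_trans _ _ (M * K)).
        by rewrite ler_wpM2r ?(ltW K0) // ler_pdivrMr // ler_peMr // ler1n.
      by rewrite ler_peMr // mulr_ge0 // ltW.
  have c0 : 0 <= M / 2 ^+ n.+1 by rewrite divr_ge0 // exprn_ge0.
  apply: (@exp_comparison _ (fun s => X n.+2 s k - X n.+1 s k)
      (fun s => \sum_j (X n.+1 s j - X n s j) * A s j k)) => //.
  + by rewrite !X0 subrr.
  + move=> t; under eq_bigr do rewrite mulrBl; rewrite sumrB.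
    by apply: (is_derive_add (XS n.+1 t k)); apply: is_derive_opp; exact: XS.
  + move=> t; apply: le_trans (sum_mul_bound (IH t) (fun j => bA' t j k)) _.
    apply: le_trans (mK _ _) _.
      by rewrite mulr_ge0 ?divr_ge0 ?exprn_ge0 // (le_trans ler01).
    rewrite le_eqVlt; apply/orP; left; apply/eqP; rewrite exprS; field.
    by rewrite expf_neq0.
have [x hx] : {x : R -> I -> R & forall s k n,
    `|x s k - X n s k| <= 2 * (M * expR (K * `|s|)) / 2 ^+ n}.
  have h s := choice (fun k => geometric_limit (fun n => bD n s k)).
  have [x hx] : {x : R -> I -> R & forall s k n,
    `|x s k - X n s k| <= 2 * (M * expR (K * `|s|)) / 2 ^+ n}.
    apply: (@choice _ _ (fun s (xs : I -> R) => forall k n,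
      `|xs k - X n s k| <= 2 * (M * expR (K * `|s|)) / 2 ^+ n)) => s.
    by have [xs hxs] := h s; exists xs.
  by exists x.
have small (c e : R) : 0 <= c -> 0 < e -> exists n, c / 2 ^+ n < e.
  move=> c0 e0; exists (Num.bound (c / e)).
  by rewrite ltr_pdivrMr ?exprn_gt0 // mulrC -ltr_pdivrMr // upper_nthrootP.
have cx k : continuous (fun s => x s k).
  move=> s; apply/cvgrPdist_lt => e e0.
  have c0 : 0 <= 2 * (M * expR (K * (`|s| + 1))) by rewrite !mulr_ge0 // expR_ge0.
  have [n hn] := small _ _ c0 (divr_gt0 e0 (ltr0n _ 3)).
  have e30 : 0 < e / 3 by rewrite divr_gt0.
  have /cvgrPdist_lt/(_ _ e30) hc := XC n k s.
  have /cvgrPdist_lt/(_ _ ltr01) hs1 : t @[t --> s] --> s by exact: cvg_id.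
  near=> t.
  have st : `|s - t| < 1 by near: t; exact: hs1.
  have bt (u : R) : `|u| <= `|s| + 1 -> `|x u k - X n u k| < e / 3.
    move=> hu; apply: le_lt_trans (hx u k n) (le_lt_trans _ hn).
    rewrite ler_wpM2r ?invr_ge0 ?exprn_ge0 // ler_wpM2l // ler_wpM2l //.
    by rewrite ler_expR ler_wpM2l // ltW.
  have b1 : `|x s k - X n s k| < e / 3 by apply: bt; rewrite lerDl.
  have b2 : `|x t k - X n t k| < e / 3.
    apply: bt; rewrite -[t](subrK s) (le_trans (ler_normD _ _)) // addrC lerD2l.
    by rewrite distrC ltW.
  have b3 : `|X n s k - X n t k| < e / 3 by near: t; exact: hc.
  rewrite (_ : x s k - x t k = (x s k - X n s k) + (X n s k - X n t k) -
    (x t k - X n t k)); last by ring.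
  apply: le_lt_trans (ler_normB _ _) _.
  have := ler_normD (x s k - X n s k) (X n s k - X n t k); lra.
(* The limit x is shown to equal its own Picard image Y: the distance from Y to the iterate n + 1 is
   controlled by that from x to the iterate n. *)
have [Y [Y0 dY]] := linear_ode_step x0 cA cx.
have xY (s : R) k : x s k = Y s k.
  apply/eqP; rewrite -subr_eq0 -normr_le0; apply/ler_addgt0Pl => e e0.
  have c0 : 0 <= 2 * (M * expR (K * `|s|)) by rewrite !mulr_ge0 // expR_ge0.
  have [n hn] := small _ _ c0 (divr_gt0 e0 (ltr0n _ 2)).
  have h1 : `|Y s k - X n.+1 s k| <= (M / 2 ^+ n) * expR (K * `|s|).
    apply: (@exp_comparison _ (fun s => Y s k - X n.+1 s k)
      (fun s => \sum_j (x s j - X n s j) * A s j k)) => //.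
    + by rewrite divr_ge0 // exprn_ge0.
    + by rewrite Y0 X0 subrr.
    + move=> t; under eq_bigr do rewrite mulrBl; rewrite sumrB.
      by apply: (is_derive_add (dY t k)); apply: is_derive_opp; exact: XS.
    + move=> t; have hx' j := hx t j n.
      apply: le_trans (sum_mul_bound hx' (fun j => bA' t j k)) _.
      apply: le_trans (mK _ _) _.
        by rewrite divr_ge0 ?exprn_ge0 // !mulr_ge0 // (le_trans ler01).
      rewrite le_eqVlt; apply/orP; left; apply/eqP; field.
      by rewrite expf_neq0.
  have h2 := hx s k n.+1.
  rewrite addr0 -(subrKA (X n.+1 s k)) (le_trans (ler_normD _ _)) //.
  rewrite [X in _ + X]distrC.
  have E : 2 * (M * expR (K * `|s|)) / 2 ^+ n.+1 = M / 2 ^+ n * expR (K * `|s|).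
    by rewrite exprS; field; rewrite expf_neq0.
  rewrite E in h2.
  have E2 : 2 * (M * expR (K * `|s|)) / 2 ^+ n = 2 * (M / 2 ^+ n * expR (K * `|s|)).
    by field; rewrite expf_neq0.
  rewrite E2 in hn; move: h1 h2 hn; lra.
exists x; split=> [k|s k]; first by rewrite xY Y0.
have := dY s k; apply: near_eq_is_derive; apply: filterE => t; exact/esym/xY.
Unshelve. all: by end_near. Qed.

End LinearODE.

Section Gronwall.
Context (R : realType).

(** Q is chosen before the interval, the matrix and the forcing term, so one constant serves all
    nearby parameters. Derivatives are asked in the open interval only, which suits curves that are
    known on one side of the endpoints. The proof shows that (|z|^2 + m beta^2) exp(-L t) does not
    increase. *)
Lemma gronwall (I : finType) (C T : R) : 0 <= C -> 0 <= T ->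
  exists Q : R, 0 <= Q /\ forall (a c beta : R) (z b : R -> I -> R)
      (A : R -> I -> I -> R),
    a <= c -> c - a <= T -> 0 <= beta ->
    (forall k, {within `[a, c], continuous (fun s => z s k)}) ->
    (forall s : R, a < s < c -> forall k, is_derive s 1 (fun s => z s k)
      (\sum_j z s j * A s j k + b s k)) ->
    (forall s, a < s < c -> forall j k, `|A s j k| <= C) ->
    (forall s, a < s < c -> forall k, `|b s k| <= beta) ->
    (forall k, `|z a k| <= beta) ->
    forall s k, a <= s <= c -> `|z s k| <= Q * beta.
Proof.
move=> C0 T0; pose m : R := #|I|%:R; pose L : R := 2 * C * m + 1.
have m0 : 0 <= m by rewrite ler0n.
have Cm0 : 0 <= 2 * C * m by rewrite !mulr_ge0.
have L1 : 1 <= L by rewrite lerDr.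
(* The estimate bounds the square of z by Q beta^2; since Q is at least 1, this is at most (Q
   beta)^2, which avoids a square root. *)
pose Q := 1 + 2 * m * expR (L * T).
have Q1 : 1 <= Q by rewrite lerDl !mulr_ge0 // expR_ge0.
have Q0 : 0 <= Q by apply: le_trans Q1.
exists Q; split=> // a c beta z b A ac cT beta0 cz dz bA bb za s k /andP[ax xc].
pose g (t : R) := \sum_k z t k * z t k.
pose G (t : R) := (g t + m * beta ^+ 2) * expR (- L * t).
have g0 t : 0 <= g t by apply: sumr_ge0 => j _; rewrite -expr2 sqr_ge0.
pose dg (t : R) := \sum_k ((\sum_j z t j * A t j k + b t k) * z t k +
  z t k * (\sum_j z t j * A t j k + b t k)).
have dgE t : a < t < c -> is_derive t 1 g (dg t).
  by move=> tac; apply: is_derive_sumr => j _; apply: is_derive_mul; exact: dz.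
have dgle t : a < t < c -> dg t <= L * (g t + m * beta ^+ 2).
  move=> tac; have : dg t <= \sum_k (\sum_j C * (z t k * z t k + z t j * z t j)
      + (z t k * z t k + beta ^+ 2)).
    apply: ler_sum => j _.
    have h1 : 2 * (z t j * \sum_i z t i * A t i j) <=
        \sum_i C * (z t j * z t j + z t i * z t i).
      rewrite !mulr_sumr; apply: ler_sum => i _.
      have hA := bA t tac i j.
      apply: (@le_trans _ _ (C * (2 * `|z t j * z t i|))).
        rewrite [leRHS]mulrCA; apply: ler_wpM2l => //.
        apply: le_trans (ler_norm _) _; rewrite mulrA normrM [leRHS]mulrC.
        exact: ler_wpM2l.
      rewrite ler_wpM2l // normrM -!expr2 -[z t j ^+ 2]real_normK ?num_real //.
      rewrite -[z t i ^+ 2]real_normK ?num_real //.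
      by have := sqr_ge0 (`|z t j| - `|z t i|); rewrite sqrrB; lra.
    have h2 : 2 * (z t j * b t j) <= z t j * z t j + beta ^+ 2.
      apply: (@le_trans _ _ (z t j * z t j + b t j ^+ 2)).
        by have := sqr_ge0 (z t j - b t j); rewrite sqrrB -expr2; lra.
      rewrite lerD2l -[b t j ^+ 2]real_normK ?num_real //.
      by rewrite lerXn2r ?nnegrE // bb.
    move: h1 h2; lra.
  move/le_trans; apply; rewrite big_split /= -/(g t).
  rewrite (_ : \sum_i \sum_j C * (z t i * z t i + z t j * z t j) =
     2 * C * m * g t).
    rewrite [X in _ + X]big_split /= -/(g t) sumr_const -[beta ^+ 2 *+ _]mulr_natl.
    rewrite -/m /L; have : 0 <= 2 * C * m * (m * beta ^+ 2).
      by rewrite mulr_ge0 // mulr_ge0 // sqr_ge0.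
    lra.
  have S1 i : \sum_j C * (z t i * z t i + z t j * z t j) =
      C * (m * (z t i * z t i) + g t).
    by rewrite -mulr_sumr big_split /= sumr_const -[_ *+ _]mulr_natl.
  rewrite (eq_bigr _ (fun i _ => S1 i)) -mulr_sumr big_split /=.
  rewrite -mulr_sumr sumr_const -[_ *+ _]mulr_natl -/m -/(g t).
  have alg (u v w : R) : u * (v * w + v * w) = 2 * u * v * w by ring.
  exact: alg.
have dE (t : R) : is_derive t 1 (fun t : R => expR (- L * t)) (expR (- L * t) * - L).
  have dK : is_derive t 1 (fun y : R => - L * y) (- L).
    apply: is_derive_eq (is_derive_mul (is_derive_cst (- L) t 1) (is_derive_id _ _)) _.
    by rewrite mul0r add0r mulr1.
  exact: is_derive_chain dK (is_derive_expR (- L * t)).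
have dG t : a < t < c -> is_derive t 1 G
    (dg t * expR (- L * t) + (g t + m * beta ^+ 2) * (expR (- L * t) * - L)).
  move=> tac; apply: is_derive_mul (dE t).
  by rewrite -[X in is_derive _ _ _ X]addr0; apply: is_derive_add (dgE t tac) _.
have cG : {within `[a, c], continuous G}.
  have c1 : {within `[a, c], continuous (fun t => \sum_k z t k * z t k)}.
    move=> t; apply: (@continuous_sumr R (subspace `[a, c])) => j _.
    exact: (continuousM (cz j t) (cz j t)).
  have c2 : continuous (fun t : R => expR (- L * t)).
    by move=> y; exact: is_derive_cont (dE y).
  move=> t; have c3 := continuousD (c1 t) (@cst_continuous (subspace `[a, c]) R (m * beta ^+ 2) t).
  have c4 : {within `[a, c], continuous (fun t : R => expR (- L * t))}.
    exact: continuous_subspaceT.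
  exact (continuousM c3 (c4 t)).
have : G s <= G a.
  apply: (@ler0_derive1_nincr _ G a c) => //.
  - by move=> t; rewrite in_itv /= => tac; have [] := dG t tac.
  - move=> t; rewrite in_itv /= => tac; rewrite derive1E.
    have [_ ->] := dG t tac.
    have E : (g t + m * beta ^+ 2) * (expR (- L * t) * - L) =
       - (L * (g t + m * beta ^+ 2)) * expR (- L * t) by ring.
    by rewrite E -mulrDl mulr_le0_ge0 ?expR_ge0 // subr_le0 dgle.
rewrite /G => hG.
have h1 : g s + m * beta ^+ 2 <= (g a + m * beta ^+ 2) * expR (L * (s - a)).
  rewrite -(ler_pM2r (expR_gt0 (- L * s))) -mulrA -expRD.
  by rewrite (_ : L * (s - a) + - L * s = - L * a) //; ring.
have ga : g a <= m * beta ^+ 2.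
  rewrite /m mulr_natl -sumr_const; apply: ler_sum => j _.
  by rewrite -expr2 -real_normK ?num_real // lerXn2r ?nnegrE.
have sT : expR (L * (s - a)) <= expR (L * T).
  rewrite ler_expR ler_wpM2l ?(le_trans ler01) //.
  by apply: le_trans cT; rewrite lerD2r.
have zk : z s k * z s k <= Q * beta ^+ 2.
  apply: (@le_trans _ _ (g s)).
    rewrite /g (bigD1 k) //= lerDl sumr_ge0 // => j _.
    by rewrite -expr2 sqr_ge0.
  have mb0 : 0 <= m * beta ^+ 2 by rewrite mulr_ge0 // sqr_ge0.
  apply: (@le_trans _ _ (2 * (m * beta ^+ 2) * expR (L * T))).
    apply: (@le_trans _ _ ((g a + m * beta ^+ 2) * expR (L * (s - a)))).
      by move: h1 mb0; lra.
    apply: ler_pM => //; first by rewrite addr_ge0.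
    by move: ga; lra.
  have alg (u v w : R) : 0 <= u -> 2 * (v * u) * w <= (1 + 2 * v * w) * u.
    by move=> u0; rewrite (_ : (1 + 2 * v * w) * u = u + 2 * (v * u) * w); [lra|ring].
  exact: alg (sqr_ge0 _).
rewrite -(@ler_pXn2r _ 2) ?nnegrE ?mulr_ge0 // real_normK ?num_real //.
rewrite expr2 (le_trans zk) // exprMn ler_wpM2r ?sqr_ge0 // expr2.
by rewrite ler_peMl.
Qed.

Lemma ode_unique (I : finType) (A : R -> I -> I -> R) (C : R)
    (x y : R -> I -> R) (s : R) : 0 <= s ->
  (forall s j k, `|A s j k| <= C) ->
  (forall k, x 0 k = y 0 k) ->
  (forall (s : R) k, is_derive s 1 (fun s => x s k) (\sum_j x s j * A s j k)) ->
  (forall (s : R) k, is_derive s 1 (fun s => y s k) (\sum_j y s j * A s j k)) ->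
  forall k, x s k = y s k.
Proof.
move=> s0 bA xy0 dx dy k.
have [Q [Q0 hQ]] := @gronwall I `|C| s (normr_ge0 _) s0.
have dz (t : R) l : is_derive t 1 (fun t => x t l - y t l)
    (\sum_j (x t j - y t j) * A t j l + 0).
  rewrite addr0; under eq_bigr do rewrite mulrBl; rewrite sumrB.
  by apply: (is_derive_add (dx t l)); apply: is_derive_opp; exact: dy.
have := hQ 0 s 0 (fun s k => x s k - y s k) (fun _ _ => 0) A s0 _ (lexx 0).
rewrite subr0 => /(_ (lexx s)) h.
apply/eqP; rewrite -subr_eq0 -normr_le0 -(mulr0 Q); apply: h.
- by move=> l; apply: continuous_subspaceT => t; exact: is_derive_cont (dz t l).
- by move=> t _ j l; exact: le_trans (bA t j l) (ler_norm C).
- by move=> t _ l; rewrite normr0.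
- by move=> l; rewrite xy0 subrr normr0.
- by rewrite s0 lexx.
Qed.

End Gronwall.

(** * Smooth dependence on parameters *)

Section ParametricFunctions.
Context (R : realType) (n : nat).
Implicit Types (U : set 'rV[R]_n) (a : R -> 'rV[R]_n -> R).

(* The values at all times are controlled together: the functions used below
   are obtained from functions on a compact time interval by clamping. *)
Definition param_cont U a : Prop :=
  [/\ forall p, U p -> continuous (fun s => a s p),
      forall p, U p -> forall e : R, 0 < e ->
        \forall q \near p, forall s, `|a s q - a s p| <= e
    & forall p, U p -> exists C : R, forall s, `|a s p| <= C].

Fixpoint PCk (k : nat) U a : Prop :=
  param_cont U a /\
  (if k is k'.+1 then
     forall i : 'I_n, exists da : R -> 'rV[R]_n -> R,
       (forall s p, U p -> is_derive p (delta_mx 0 i) (a s) (da s p)) /\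
       PCk k' U da
   else True).

Lemma PCk_cont k U a : PCk k U a -> param_cont U a.
Proof. by case: k => [|k] []. Qed.

Lemma PCkW k U a : PCk k.+1 U a -> PCk k U a.
Proof.
elim: k a => [|k IH] a [h1 h2]; split=> // i.
by have [da [h3 h4]] := h2 i; exists da; split=> //; exact: IH.
Qed.

Lemma param_cont_cst U (c : R) : param_cont U (fun _ _ => c).
Proof.
split=> p _; first by move=> s; exact: cst_continuous.
  by move=> e e0; apply: filterE => q s; rewrite subrr normr0 ltW.
by exists `|c|.
Qed.

Lemma PCk_cst k U (c : R) : PCk k U (fun _ _ => c).
Proof.
elim: k c => [|k IH] c; split=> //; try exact: param_cont_cst.
move=> i; exists (fun _ _ => 0); split=> // s p _.
exact: is_derive_cst.
Qed.

Lemma param_cont_add U a b : param_cont U a -> param_cont U b ->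
  param_cont U (fun s p => a s p + b s p).
Proof.
move=> [a1 a2 a3] [b1 b2 b3]; split=> p Up.
- by move=> s; exact (continuousD (a1 p Up s) (b1 p Up s)).
- move=> e e0; have e20 : 0 < e / 2 by rewrite divr_gt0.
  move: (a2 p Up _ e20) (b2 p Up _ e20); apply: filterS2 => q h1 h2 s.
  rewrite opprD addrACA (le_trans (ler_normD _ _)) // [leRHS]splitr.
  by rewrite lerD.
- have [C hC] := a3 p Up; have [D hD] := b3 p Up; exists (C + D) => s.
  by rewrite (le_trans (ler_normD _ _)) // lerD.
Qed.

Lemma param_cont_mul U a b : param_cont U a -> param_cont U b ->
  param_cont U (fun s p => a s p * b s p).
Proof.
move=> [a1 a2 a3] [b1 b2 b3]; split=> p Up.
- by move=> s; exact (continuousM (a1 p Up s) (b1 p Up s)).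
- move=> e e0; have [C hC] := a3 p Up; have [D hD] := b3 p Up.
  have C0 : 0 <= C by apply: le_trans (hC 0).
  have D0 : 0 <= D by apply: le_trans (hD 0).
  (* The three parts of the increment of the product are bounded by d * 1, d * D and d * C; the
     first uses d <= 1. *)
  pose d := Num.min 1 (e / (C + D + 1)).
  have CD0 : 0 < C + D + 1 by rewrite ltr_wpDl // addr_ge0.
  have d0 : 0 < d by rewrite lt_min ltr01 divr_gt0.
  move: (a2 p Up _ d0) (b2 p Up _ d0); apply: filterS2 => q h1 h2 s.
  have -> : a s q * b s q - a s p * b s p = (a s q - a s p) * (b s q - b s p) +
    (a s q - a s p) * b s p + a s p * (b s q - b s p) by ring.
  have d1 : d <= 1 by rewrite ge_min lexx.
  have dd : d * (C + D + 1) <= e by rewrite -ler_pdivlMr // ge_min lexx orbT.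
  apply: le_trans dd.
  have x1 : `|(a s q - a s p) * (b s q - b s p)| <= d * 1.
    by rewrite normrM ler_pM // (le_trans (h2 s)).
  have x2 : `|(a s q - a s p) * b s p| <= d * D by rewrite normrM ler_pM.
  have x3 : `|a s p * (b s q - b s p)| <= d * C.
    by rewrite normrM mulrC ler_pM.
  rewrite (le_trans (ler_normD _ _)) // -[d * (_ + _)]/(d * (C + D + 1)).
  rewrite (_ : d * (C + D + 1) = d * 1 + d * D + d * C); last by ring.
  by rewrite lerD // (le_trans (ler_normD _ _)) // lerD.
- have [C hC] := a3 p Up; have [D hD] := b3 p Up; exists (C * D) => s.
  by rewrite normrM ler_pM.
Qed.

Lemma PCk_add k U a b : PCk k U a -> PCk k U b ->
  PCk k U (fun s p => a s p + b s p).
Proof.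
elim: k a b => [|k IH] a b [a1 a2] [b1 b2]; split=> //;
  try exact: param_cont_add.
move=> i; have [da [ha pa]] := a2 i; have [db [hb pb]] := b2 i.
exists (fun s p => da s p + db s p); split; last exact: IH.
by move=> s p Up; exact: is_derive_add (ha s p Up) (hb s p Up).
Qed.

Lemma PCk_mul k U a b : PCk k U a -> PCk k U b ->
  PCk k U (fun s p => a s p * b s p).
Proof.
elim: k a b => [|k IH] a b ka kb.
  by split=> //; exact: param_cont_mul (PCk_cont ka) (PCk_cont kb).
split; first exact: param_cont_mul (PCk_cont ka) (PCk_cont kb).
move=> i; have [da [ha pa]] := ka.2 i; have [db [hb pb]] := kb.2 i.
exists (fun s p => da s p * b s p + a s p * db s p); split.
  by move=> s p Up; exact: is_derive_mul (ha s p Up) (hb s p Up).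
by apply: PCk_add; apply: IH => //; exact: PCkW.
Qed.

Lemma PCk_sum k U (I : Type) (r : seq I) (P : pred I)
    (F : I -> R -> 'rV[R]_n -> R) :
  (forall i, P i -> PCk k U (F i)) ->
  PCk k U (fun s p => \sum_(i <- r | P i) F i s p).
Proof.
move=> h; elim: r => [|x r IH].
  have -> : (fun s p => \sum_(i <- [::] | P i) F i s p) = (fun _ _ => 0).
    by apply/funext => s; apply/funext => p; rewrite big_nil.
  exact: PCk_cst.
have -> : (fun s p => \sum_(i <- x :: r | P i) F i s p) =
    (fun s p => (if P x then F x s p else 0) + \sum_(i <- r | P i) F i s p).
  apply/funext => s; apply/funext => p; rewrite big_cons.
  by case: ifP => // _; rewrite add0r.
apply: PCk_add => //; case Px : (P x); first exact: h.
exact: PCk_cst.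
Qed.

Lemma PCk_space k U (f : 'rV[R]_n -> R) : Ck k U f -> PCk k U (fun _ p => f p).
Proof.
have base g : (forall p, U p -> {for p, continuous g}) ->
    param_cont U (fun _ p => g p).
  move=> cg; split=> p Up; first by move=> s; exact: cst_continuous.
    move=> e e0; have /cvgrPdist_le/(_ _ e0) := cg p Up.
    by apply: filterS => q hq s; rewrite distrC.
  by exists `|g p|.
elim: k f => [|k IH] f hf.
  by split=> //; apply: base => p; exact: Ck_cont hf.
split; first by apply: base => p; exact: Ck_cont hf.
move=> i; exists (fun _ p => 'D_(delta_mx 0 i) f p); split.
  by move=> _ p Up; exact: Ck_der hf Up.
by apply: IH; exact: Ck_partial.
Qed.

Lemma PCk_time k U (f : R -> R) (C : R) : continuous f ->
  (forall s, `|f s| <= C) -> PCk k U (fun s _ => f s).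
Proof.
move=> cf hC.
have base : param_cont U (fun s _ => f s).
  split=> p Up; [exact: cf| |by exists C].
  by move=> e e0; apply: filterE => q s; rewrite subrr normr0 ltW.
case: k => [|k]; split=> //.
move=> i; exists (fun _ _ => 0); split; last exact: PCk_cst.
by move=> s p _; exact: is_derive_cst.
Qed.

(** The difference quotient converges uniformly in time: the mean value theorem compares it with
    [da] at a nearby parameter, and [da] is equicontinuous there. *)
Lemma param_quotient U a (da : R -> 'rV[R]_n -> R) i p e : open U -> U p ->
  (forall s q, U q -> is_derive q (delta_mx 0 i) (a s) (da s q)) ->
  param_cont U da -> 0 < e ->
  \forall h \near (0 : R), forall s,
    `|a s (p + h *: delta_mx 0 i) - a s p - h * da s p| <= e * `|h|.
Proof.
move=> oU Up hd [_ c2 _] e0.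
have [d d0 hx] := (nbhs_dist p _).1
  (filterI (open_nbhs_nbhs (conj oU Up)) (c2 p Up e e0)).
have /cvgrPdist_lt/(_ _ d0) : h @[h --> (0 : R)] --> (0 : R) by exact: cvg_id.
apply: filterS => h; rewrite sub0r normrN => hd0 s.
pose q (t : R) := p + t *: (h *: delta_mx 0 i : 'rV[R]_n).
have qin t : 0 <= t <= 1 -> U (q t) /\ forall s, `|da s (q t) - da s p| <= e.
  move=> /andP[t0 t1]; apply: hx; rewrite /q opprD addrA subrr sub0r normrN.
  apply: le_lt_trans hd0; apply: rV_norm_le => // j; rewrite !mxE !normrM.
  rewrite (ger0_norm t0) -[leRHS]mul1r ler_pM ?mulr_ge0 //.
  rewrite ler_piMr //; case: (_ && _); rewrite ?normr1 ?normr0 ?lexx //.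
have qder (t : R) : 0 <= t <= 1 -> is_derive t 1 (fun t => a s (q t)) (h * da s (q t)).
  move=> /qin[Uq _].
  have -> : (fun t => a s (q t)) =
      (fun t : R => a s (p + (t * h) *: delta_mx 0 i)).
    by apply/funext => u; rewrite /q scalerA.
  rewrite mulrC.
  apply: (@is_derive_chain _ (fun t : R => t * h)
    (fun u => a s (p + u *: delta_mx 0 i))).
    apply: is_derive_eq (is_derive_mul (is_derive_id _ _)
      (is_derive_cst _ _ _)) _.
    by rewrite mul1r mulr0 addr0.
  by apply/is_derive_lineP; rewrite -scalerA; exact: hd.
have [t t01] := mean_value ler01 qder.
rewrite /q scale1r scale0r addr0 subr0 mulr1 => ->.
have [_ /(_ s) ht] := qin t t01.
by rewrite -mulrBr normrM mulrC ler_wpM2r.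
Qed.

End ParametricFunctions.

Lemma continuous_dist_le (R : realType) (V : normedModType R) (f : V -> R)
    (p : V) : (forall e : R, 0 < e -> \forall q \near p, `|f p - f q| <= e) ->
  {for p, continuous f}.
Proof. by move=> h; apply/cvgrPdist_le. Qed.

Lemma cvg_line (R : realType) (V : normedModType R) (p v : V) :
  p + h *: v @[h --> (0 : R)] --> p.
Proof.
have : p + h *: v @[h --> (0 : R)] --> p + 0 *: v.
  by apply: cvgD; [exact: cvg_cst|apply: cvgZr_tmp; exact: cvg_id].
by rewrite scale0r addr0.
Qed.

Section ODEParameters.
Context (R : realType) (n : nat).

Definition ode_solution (I : finType) (A : R -> I -> I -> R)
    (x : R -> I -> R) : Prop :=
  forall (s : R) l, is_derive s 1 (fun s => x s l) (\sum_j x s j * A s j l).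

Lemma ode_bounded (I : finType) (A : R -> I -> I -> R) (C s : R)
    (x : R -> I -> R) : 0 <= s -> (forall t j l, `|A t j l| <= C) ->
  ode_solution A x -> exists X : R, 0 <= X /\
    forall t, 0 <= t <= s -> forall l, `|x t l| <= X.
Proof.
move=> s0 bA dx; have [Q [Q0 hQ]] := @gronwall R I `|C| s (normr_ge0 _) s0.
pose M : R := \sum_l `|x 0 l|.
have M0 : 0 <= M by rewrite sumr_ge0.
exists (Q * M); split=> [|t ts l]; first by rewrite mulr_ge0.
apply: (hQ 0 s M x (fun _ _ => 0) A) => //.
- by rewrite subr0.
- by move=> k; apply: continuous_subspaceT => u; exact: is_derive_cont (dx u k).
- by move=> u _ k; rewrite addr0; exact: dx.
- by move=> u _ j k; exact: le_trans (bA u j k) (ler_norm C).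
- by move=> u _ k; rewrite normr0.
- by move=> k; rewrite /M (bigD1 k) //= lerDl sumr_ge0.
Qed.

Section Families.
Context (I : finType) (U : set 'rV[R]_n) (A : R -> 'rV[R]_n -> I -> I -> R).
Hypothesis pA : forall j l, param_cont U (fun s p => A s p j l).

Lemma family_bounded p : U p -> exists C : R, forall s j l, `|A s p j l| <= C.
Proof.
move=> Up; have h (jl : I * I) : exists C : R, forall s, `|A s p jl.1 jl.2| <= C.
  by have [_ _] := pA jl.1 jl.2; exact.
have [C hC] := choice h; exists (\sum_jl `|C jl|) => s j l.
apply: le_trans (hC (j, l) s) (le_trans (ler_norm _) _).
by rewrite (bigD1 (j, l)) //= lerDl sumr_ge0.
Qed.

Lemma family_unif p (e : R) : U p -> 0 < e ->
  \forall q \near p, forall s j l, `|A s q j l - A s p j l| <= e.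
Proof.
move=> Up e0.
have h (jl : I * I) : \forall q \near p, forall s,
    `|A s q jl.1 jl.2 - A s p jl.1 jl.2| <= e.
  by have [_ + _] := pA jl.1 jl.2; exact.
have := @filter_forall _ _ (fun (jl : I * I) q => forall s,
  `|A s q jl.1 jl.2 - A s p jl.1 jl.2| <= e) (nbhs p) (nbhs_filter p) h.
by apply: filterS => q hq s j l; exact: (hq (j, l)).
Qed.

Lemma family_near_bounded p : U p -> exists C : R, 0 <= C /\
  \forall q \near p, forall s j l, `|A s q j l| <= C.
Proof.
move=> Up; have [C hC] := family_bounded Up; exists (`|C| + 1); split.
  by rewrite addr_ge0.
apply: filterS (family_unif Up ltr01) => q hq s j l.
rewrite -[A s q j l](subrK (A s p j l)) (le_trans (ler_normD _ _)) // addrC.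
by rewrite lerD // (le_trans (hC s j l)) // ler_norm.
Qed.

(** The difference of the solutions at p and q solves the equation with matrix A(q) and forcing term
    x(p) (A(p) - A(q)), which is uniformly small; [gronwall] concludes. *)
Lemma ode_param_cont (x : R -> 'rV[R]_n -> I -> R) (x0 : I -> R) (s : R) p l :
  (forall p, U p -> forall l, x 0 p l = x0 l) ->
  (forall p, U p -> ode_solution (A ^~ p) (x ^~ p)) -> 0 <= s ->
  open U -> U p -> {for p, continuous (fun p => x s p l)}.
Proof.
move=> hx0 hx s0 oU Up; have [C [C0 hC]] := family_near_bounded Up.
have [C' hC'] := family_bounded Up.
have [X [X0 hX]] := ode_bounded s0 hC' (hx p Up).
have [Q [Q0 hQ]] := @gronwall R I C s C0 s0.
apply: (@continuous_dist_le R _ _ p) => e e0.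
pose m : R := #|I|%:R; have mX0 : 0 <= Q * (m * X) by rewrite !mulr_ge0 ?ler0n.
pose e' : R := e / (Q * (m * X) + 1).
have e'0 : 0 < e' by rewrite divr_gt0 // ltr_wpDl.
have b0 : 0 <= m * (X * e').
  by apply: mulr_ge0; [rewrite ler0n|apply: mulr_ge0 => //; exact: ltW].
have hU := open_nbhs_nbhs (conj oU Up).
have hu := family_unif Up e'0.
near=> q.
have Uq : U q by near: q; exact: hU.
have bq : forall s j l, `|A s q j l| <= C by near: q; exact: hC.
have uq : forall s j l, `|A s q j l - A s p j l| <= e' by near: q; exact: hu.
apply: (@le_trans _ _ (Q * (m * (X * e')))); last first.
  rewrite (_ : Q * (m * (X * e')) = (Q * (m * X)) * e'); last by ring.
  rewrite /e' mulrCA ger_pMr // ler_pdivrMr ?ltr_wpDl // mul1r lerDl; exact: ler01.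
apply: (hQ 0 s _ (fun s l => x s p l - x s q l)
  (fun s l => \sum_j x s p j * (A s p j l - A s q j l)) (A ^~ q)) => //.
- by rewrite subr0.
- move=> k; apply: continuous_subspaceT => u.
  exact (continuousB (is_derive_cont (hx p Up u k)) (is_derive_cont (hx q Uq u k))).
- move=> u _ k; have hd := is_derive_add (hx p Up u k) (is_derive_opp (hx q Uq u k)).
  apply: is_derive_eq hd _; rewrite -sumrB -big_split /=; apply: eq_bigr => j _; ring.
- move=> u /andP[u0 us] k; apply: sum_mul_bound => j.
    by apply: hX; rewrite !ltW.
  by rewrite distrC.
- by move=> k; rewrite !hx0 // subrr normr0.
- by rewrite s0 lexx.
Unshelve. all: by end_near. Qed.

End Families.

(* The partial derivatives in the parameter of a solution x of x' = x A solve,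
   together with x, the linear system with matrix [[A, dA], [0, A]]. *)
Definition augmented (I : finType) (A dA : R -> 'rV[R]_n -> I -> I -> R)
    (s : R) (p : 'rV[R]_n) (j l : I + I) : R :=
  match j, l with
  | inl j, inl l => A s p j l
  | inl j, inr l => dA s p j l
  | inr j, inr l => A s p j l
  | inr _, inl _ => 0
  end.

(** The candidate derivative is the second half of the solution of the doubled system. The
    difference quotient minus this candidate starts at 0 and solves the equation at the displaced
    parameter with a forcing term that tends to 0 uniformly, so [gronwall] applies. *)
Lemma ode_partial (I : finType) (U : set 'rV[R]_n)
    (A dA : R -> 'rV[R]_n -> I -> I -> R) (x : R -> 'rV[R]_n -> I -> R)
    (x0 : I -> R) (i : 'I_n) : open U ->
  (forall j l, param_cont U (fun s p => A s p j l)) ->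
  (forall j l, param_cont U (fun s p => dA s p j l)) ->
  (forall s j l p, U p ->
    is_derive p (delta_mx 0 i) (fun p => A s p j l) (dA s p j l)) ->
  (forall p, U p -> forall l, x 0 p l = x0 l) ->
  (forall p, U p -> ode_solution (A ^~ p) (x ^~ p)) ->
  exists w : R -> 'rV[R]_n -> I + I -> R,
    [/\ forall p, U p -> forall l, w 0 p l = if l is inl l then x0 l else 0,
        forall p, U p -> ode_solution (augmented A dA ^~ p) (w ^~ p)
      & forall (s : R) l p, 0 <= s -> U p ->
          is_derive p (delta_mx 0 i) (fun p => x s p l) (w s p (inr l))].
Proof.
move=> oU pA pdA hd hx0 hx.
have paug j l : param_cont U (fun s p => augmented A dA s p j l).
  by case: j => j; case: l => l //=; exact: param_cont_cst.
have hw p : exists wp : R -> I + I -> R, U p ->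
    (forall l, wp 0 l = if l is inl l then x0 l else 0) /\
    ode_solution (augmented A dA ^~ p) wp.
  case: (pselect (U p)) => Up; last by exists (fun _ _ => 0).
  have [C hC] := family_bounded paug Up.
  have [|wp [w0 dw]] := @linear_ode_exists R _ (augmented A dA ^~ p) C
    (fun l : I + I => if l is inl l then x0 l else 0) _ hC.
    by move=> j l; have [+ _ _] := paug j l; exact.
  by exists wp.
have [w' hw'] := choice hw; pose w s p := w' p s.
exists w; split; [by move=> p /hw'[]|by move=> p /hw'[]|].
move=> s l p s0 Up; have [w0 dw] := hw' p Up.
have [C [C0 hC]] := family_near_bounded pA Up.
have [C' hC'] := family_bounded pA Up.
have [C2 hC2] := family_bounded paug Up.
have [X [X0 hX]] := ode_bounded s0 hC2 dw.
have dwl (t : R) k : is_derive t 1 (fun t => w t p (inl k))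
    (\sum_j w t p (inl j) * A t p j k).
  apply: is_derive_eq (dw t (inl k)) _; rewrite big_sumType /=.
  by rewrite [X in _ + X]big1 ?addr0 // => j _; rewrite mulr0.
have dwr (t : R) k : is_derive t 1 (fun t => w t p (inr k))
    (\sum_j w t p (inl j) * dA t p j k + \sum_j w t p (inr j) * A t p j k).
  by apply: is_derive_eq (dw t (inr k)) _; rewrite big_sumType.
have xw (t : R) k : 0 <= t -> x t p k = w t p (inl k).
  move=> t0; have h0 j : x 0 p j = w 0 p (inl j) by rewrite hx0 // /w w0.
  exact: (@ode_unique R I (A ^~ p) C' (x ^~ p) (fun t k => w t p (inl k)) t t0
    hC' h0 (hx p Up) dwl k).
have [Q [Q0 hQ]] := @gronwall R I C s C0 s0.
suff cv : h^-1 *: (x s (h *: delta_mx 0 i + p) l - x s p l)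
    @[h --> (0 : R)^'] --> w s p (inr l).
  by split; [apply/cvg_ex; eexists; exact: cv|exact: cvg_lim cv].
apply/cvgrPdist_le => e e0.
pose m : R := #|I|%:R; have m0 : 0 <= m by rewrite ler0n.
(* The forcing term consists of two sums, each at most m * (X * e'); the 1 keeps the denominator
   positive. *)
pose e' : R := e / (Q * (2 * (m * X)) + 1).
have mX0 : 0 <= Q * (2 * (m * X)) by rewrite !mulr_ge0.
have e'0 : 0 < e' by rewrite divr_gt0 // ltr_wpDl.
have b0 : 0 <= 2 * (m * (X * e')).
  by rewrite mulr_ge0 // mulr_ge0 // mulr_ge0 //; exact: ltW.
have quo : \forall h \near (0 : R), forall jk : I * I, forall t,
    `|A t (p + h *: delta_mx 0 i) jk.1 jk.2 - A t p jk.1 jk.2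
      - h * dA t p jk.1 jk.2| <= e' * `|h|.
  apply: (@filter_forall _ _ (fun (jk : I * I) h => forall t,
    `|A t (p + h *: delta_mx 0 i) jk.1 jk.2 - A t p jk.1 jk.2
      - h * dA t p jk.1 jk.2| <= e' * `|h|) (nbhs (0 : R)) _) => -[j k].
  exact: (@param_quotient _ _ U (fun s p => A s p j k) (fun s p => dA s p j k)).
have lin : p + h *: delta_mx 0 i @[h --> (0 : R)] --> p by exact: cvg_line.
have near1 : \forall h \near (0 : R), let q := p + h *: delta_mx 0 i in
   [/\ U q, forall t j k, `|A t q j k| <= C
     & forall t j k, `|A t q j k - A t p j k| <= e'].
  have hU := open_nbhs_nbhs (conj oU Up).
  have hu := family_unif pA Up e'0.
  near=> h; split.
  - by near: h; exact: lin hU.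
  - by near: h; exact: lin hC.
  - by near: h; exact: lin hu.
near=> h.
have h0 : h != 0 by near: h; exact: nbhs_dnbhs_neq.
have [Uq bq uq] : let q := p + h *: delta_mx 0 i in
   [/\ U q, forall t j k, `|A t q j k| <= C
     & forall t j k, `|A t q j k - A t p j k| <= e'].
  by near: h; exact: nbhs_dnbhs near1.
have hq : forall jk : I * I, forall t,
    `|A t (p + h *: delta_mx 0 i) jk.1 jk.2 - A t p jk.1 jk.2
      - h * dA t p jk.1 jk.2| <= e' * `|h|.
  by near: h; exact: nbhs_dnbhs quo.
rewrite [h *: _ + p]addrC distrC.
move: Uq bq uq hq; set q := p + h *: _ => Uq bq uq hq.
apply: (@le_trans _ _ (Q * (2 * (m * (X * e'))))); last first.
  rewrite (_ : Q * (2 * (m * (X * e'))) = (Q * (2 * (m * X))) * e'); last by ring.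
  rewrite /e' mulrCA ger_pMr // ler_pdivrMr ?ltr_wpDl // mul1r lerDl; exact: ler01.
apply: (hQ 0 s _ (fun t k => h^-1 * (x t q k - x t p k) - w t p (inr k))
  (fun t k => \sum_j w t p (inl j) *
      (h^-1 * (A t q j k - A t p j k) - dA t p j k) +
    \sum_j w t p (inr j) * (A t q j k - A t p j k)) (A ^~ q)) => //.
- by rewrite subr0.
- move=> k; apply: continuous_subspaceT => u.
  apply: is_derive_cont; apply: is_derive_add (is_derive_opp (dwr u k)).
  apply: is_derive_mul (is_derive_cst h^-1 u 1) _.
  exact: is_derive_add (hx q Uq u k) (is_derive_opp (hx p Up u k)).
- move=> u /andP[u0 us] k.
  have hd' := is_derive_add (is_derive_mul (is_derive_cst h^-1 u 1)
    (is_derive_add (hx q Uq u k) (is_derive_opp (hx p Up u k))))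
    (is_derive_opp (dwr u k)).
  apply: is_derive_eq hd' _; rewrite mul0r add0r -sumrB mulr_sumr -!big_split /=.
  rewrite -sumrB; apply: eq_bigr => j _.
  by rewrite -[w u p (inl j)]xw ?ltW // /cst /=; ring.
- move=> u /andP[u0 us] k; have u0s : 0 <= u <= s by rewrite !ltW.
  rewrite mulrDl mul1r (le_trans (ler_normD _ _)) //.
  apply: lerD; apply: sum_mul_bound => j //; try exact: hX.
  have -> : h^-1 * (A u q j k - A u p j k) - dA u p j k =
      h^-1 * (A u q j k - A u p j k - h * dA u p j k).
    by rewrite [RHS]mulrBr mulKf.
  by rewrite normrM normfV ler_pdivrMl ?normr_gt0 // [leRHS]mulrC; exact: (hq (j, k)).
- by move=> k; rewrite !hx0 // subrr mulr0 /w w0 subr0 normr0.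
- by rewrite s0 lexx.
Unshelve. all: by end_near. Qed.

(** Induction on k over all finite index types at once: a partial derivative of x is a component of
    a solution of the doubled system, whose coefficients have one derivative less. *)
Theorem ode_Ck (k : nat) (I : finType) (U : set 'rV[R]_n)
    (A : R -> 'rV[R]_n -> I -> I -> R) (x : R -> 'rV[R]_n -> I -> R)
    (x0 : I -> R) (s : R) l : open U ->
  (forall j l, PCk k U (fun s p => A s p j l)) ->
  (forall p, U p -> forall l, x 0 p l = x0 l) ->
  (forall p, U p -> ode_solution (A ^~ p) (x ^~ p)) -> 0 <= s ->
  Ck k U (fun p => x s p l).
Proof.
elim: k I A x x0 l => [|k IH] I A x x0 l oU pA hx0 hx s0.
  split=> // p Up; apply: (ode_param_cont (U := U)) hx0 hx s0 oU Up.
  by move=> j l'; exact: PCk_cont (pA j l').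
have pA0 j l' : param_cont U (fun s p => A s p j l') := PCk_cont (pA j l').
have hi i : exists w : R -> 'rV[R]_n -> I + I -> R,
    (forall l p, U p ->
       is_derive p (delta_mx 0 i) (fun p => x s p l) (w s p (inr l))) /\
    forall l, Ck k U (fun p => w s p l).
  have hdA (jl : I * I) : exists da : R -> 'rV[R]_n -> R,
      (forall s p, U p ->
         is_derive p (delta_mx 0 i) (fun p => A s p jl.1 jl.2) (da s p)) /\
      PCk k U da.
    by have [_ +] := pA jl.1 jl.2; exact.
  have [dA' hdA'] := choice hdA.
  pose dA s p j l := dA' (j, l) s p.
  have pdA j l' : param_cont U (fun s p => dA s p j l').
    by have [_ /PCk_cont] := hdA' (j, l').
  have ddA t j l' p : U p ->
      is_derive p (delta_mx 0 i) (fun p => A t p j l') (dA t p j l').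
    by have [+ _] := hdA' (j, l'); exact.
  have [w [w0 dw hw]] := ode_partial oU pA0 pdA ddA hx0 hx.
  exists w; split=> [l' p Up|l']; first exact: hw.
  apply: (IH _ (augmented A dA) w
    (fun l : I + I => if l is inl l then x0 l else 0)) => //.
  case=> j [] j' /=; try exact: PCkW (pA j j').
  - by have [_ +] := hdA' (j, j').
  - exact: PCk_cst.
have [w hw] := choice hi.
apply: (Ck_intro oU (df := fun i p => w i s p (inr l))).
- by move=> p Up; exact (ode_param_cont pA0 hx0 hx s0 oU Up).
- by move=> i p Up; exact ((hw i).1 l p Up).
- by move=> i; exact ((hw i).2 (inr l)).
Qed.

End ODEParameters.

(** * Alternating forms *)

(** A plain-function version of the update in [is_form], convertible to it, as [form_upd] uses. *)
Definition upd (I : eqType) (T : Type) (u : I -> T) (i : I) (e : T) : I -> T :=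
  fun j => if j == i then e else u j.

Lemma upd_same (I : eqType) (T : Type) (u : I -> T) i : upd u i (u i) = u.
Proof. by apply/funext => j; rewrite /upd; case: eqVneq => [->|]. Qed.

Lemma updE (I : eqType) (T : Type) (u : I -> T) i e : upd u i e i = e.
Proof. by rewrite /upd eqxx. Qed.

Lemma upd_ne (I : eqType) (T : Type) (u : I -> T) i e j :
  j != i -> upd u i e j = u j.
Proof. by rewrite /upd => /negbTE ->. Qed.

Lemma upd_lift (T : Type) n (u : 'I_n.+1 -> T) (i : 'I_n.+1) e (l : 'I_n) :
  upd u i e (lift i l) = u (lift i l).
Proof. by rewrite upd_ne // eq_sym neq_lift. Qed.

Lemma upd_lift_comp (T : Type) n (u : 'I_n.+1 -> T) (i : 'I_n.+1) (l : 'I_n) e :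
  (fun m => upd u (lift i l) e (lift i m)) = upd (fun m => u (lift i m)) l e.
Proof.
by apply/funext => m; rewrite /upd (inj_eq (@lift_inj _ i)).
Qed.

(** Written like the argument in [insert_euler], so that the two are convertible. *)
Definition ocons (T : Type) (n : nat) (e : T) (u : 'I_n -> T) : 'I_n.+1 -> T :=
  fun l => oapp u e (unlift ord0 l).

Lemma ocons0 (T : Type) n (e : T) (u : 'I_n -> T) : ocons e u ord0 = e.
Proof. by rewrite /ocons unlift_none. Qed.

Lemma oconsS (T : Type) n (e : T) (u : 'I_n -> T) l : ocons e u (lift ord0 l) = u l.
Proof. by rewrite /ocons liftK. Qed.

Lemma ocons_eta (T : Type) n (u : 'I_n.+1 -> T) :
  ocons (u ord0) (fun l => u (lift ord0 l)) = u.
Proof. by apply/funext => l; case: (unliftP ord0 l) => [j|] ->; rewrite ?oconsS ?ocons0. Qed.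

Lemma ocons_upd0 (T : Type) n (e e' : T) (u : 'I_n -> T) :
  upd (ocons e u) ord0 e' = ocons e' u.
Proof.
apply/funext => l; case: (unliftP ord0 l) => [j|] ->.
  by rewrite upd_lift !oconsS.
by rewrite updE ocons0.
Qed.

Lemma ocons_updS (T : Type) n (e e' : T) (u : 'I_n -> T) (j : 'I_n) :
  upd (ocons e u) (lift ord0 j) e' = ocons e (upd u j e').
Proof.
apply/funext => l; case: (unliftP ord0 l) => [m|] ->.
  by rewrite oconsS /upd (inj_eq (@lift_inj _ ord0)) oconsS.
by rewrite upd_ne ?ocons0 // neq_lift.
Qed.

Lemma enum_lift n (i : 'I_n.+1) :
  [seq m <- enum 'I_n.+1 | m != i] = map (lift i) (enum 'I_n).
Proof.
apply: (inj_map val_inj).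
have Pi : [seq val m | m <- [seq m <- enum 'I_n.+1 | m != i]] =
    [seq m <- iota 0 n.+1 | m != val i].
  by rewrite -(val_enum_ord n.+1) [RHS]filter_map; congr (map _ _); exact: eq_filter.
rewrite Pi; apply: (irr_sorted_eq ltn_trans ltnn).
- exact: (sorted_filter ltn_trans _ (iota_ltn_sorted _ _)).
- rewrite -map_comp.
  rewrite (_ : map _ _ = map (bump i) (iota 0 n)); last first.
    by rewrite -(val_enum_ord n) -map_comp; exact: eq_map.
  rewrite sorted_map; apply: sub_sorted (iota_ltn_sorted 0 n) => a b ab.
  by rewrite /= /bump; move: ab; do 2!case: leqP; lia.
- move=> m; rewrite mem_filter mem_iota /= add0n; apply/andP/idP.
    move=> [mi mn]; apply/mapP; have mi' : Ordinal mn != i by [].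
    exists (Ordinal mn) => //; apply/mapP.
    case: (unliftP i (Ordinal mn)) mi' => [j ->|->]; last by rewrite eqxx.
    by move=> _; exists j => //; rewrite mem_enum.
  case/mapP => a /mapP[j _ ->] ->; split; last exact: ltn_ord.
  by rewrite (inj_eq val_inj) eq_sym neq_lift.
Qed.

(** Removes the lists from the Koszul formula: once two indices are deleted, the others are reached
    by two successive [lift]s. *)
Lemma nth_koszul (T : nmodType) k (g : 'I_k.+2 -> T) (b : T) (i : 'I_k.+2)
    (j : 'I_k.+1) (l : 'I_k.+1) :
  nth 0 (b :: [seq g m | m <- enum 'I_k.+2 & (m != i) && (m != lift i j)]) l =
  ocons b (fun q => g (lift i (lift j q))) l.
Proof.
have -> : [seq m <- enum 'I_k.+2 | (m != i) && (m != lift i j)] =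
    [seq lift i (lift j q) | q <- enum 'I_k].
  rewrite (eq_filter (a2 := predI (fun m => m != lift i j) (fun m => m != i))).
    rewrite filter_predI enum_lift filter_map (map_comp (lift i) (lift j)).
    congr map; rewrite -enum_lift; apply: eq_filter => m /=.
    by rewrite (inj_eq (@lift_inj _ i)).
  by move=> m /=; rewrite andbC.
rewrite -map_comp; case: (unliftP ord0 l) => [q|] ->; last by rewrite ocons0.
rewrite oconsS (_ : nat_of_ord (lift ord0 q) = q.+1) //=.
by rewrite (nth_map q) ?size_enum_ord // nth_ord_enum.
Qed.

Section Alternating.
Context (R : realType) (M : atlas R) (A F : prebundle M) (k : nat).
Context (w : preform A F k) (hw : is_form w) (x : M).
Implicit Types (u : 'I_k -> A x).

Lemma form_upd u i c (e e' : A x) :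
  w (upd u i (c *: e + e')) = c *: w (upd u i e) + w (upd u i e').
Proof. exact: (form_multilinear hw u i c e e'). Qed.

Lemma form_upd0 u i : w (upd u i (0 : A x)) = 0.
Proof.
have := form_upd u i 1 0 0; rewrite scaler0 addr0 scale1r => /eqP.
by rewrite eq_sym -subr_eq0 addrK => /eqP.
Qed.

Lemma form_zero_slot u i : u i = 0 -> w u = 0.
Proof. by move=> ui; rewrite -(upd_same u i) ui form_upd0. Qed.

Lemma form_updD u i (e e' : A x) :
  w (upd u i (e + e')) = w (upd u i e) + w (upd u i e').
Proof. by have := form_upd u i 1 e e'; rewrite !scale1r. Qed.

Lemma form_updZ u i c (e : A x) : w (upd u i (c *: e)) = c *: w (upd u i e).
Proof. by have := form_upd u i c e 0; rewrite !addr0 form_upd0 addr0. Qed.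

Lemma form_upd_sum u i (I : Type) (r : seq I) (c : I -> R) (e : I -> A x) :
  w (upd u i (\sum_(a <- r) c a *: e a)) = \sum_(a <- r) c a *: w (upd u i (e a)).
Proof.
elim: r => [|a r IH]; first by rewrite !big_nil form_upd0.
by rewrite !big_cons form_upd IH.
Qed.

(** Polarization: expand the form with the sum of the two vectors placed in both slots, where it
    vanishes. *)
Lemma form_swap u (i j : 'I_k) : i != j ->
  w (upd (upd u i (u j)) j (u i)) = - w u.
Proof.
move=> ij; have ji : j != i by rewrite eq_sym.
pose v (a b : A x) := upd (upd u i a) j b.
have updC a b : v a b = upd (upd u j b) i a.
  apply/funext => l; rewrite /v /upd; case: (eqVneq l j) => [->|//].
  by rewrite (negbTE ji).
have v0 a : w (v a a) = 0.
  apply: (form_alternating hw ij); rewrite /v updE upd_ne // updE //.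
have vD1 a a' b : w (v (a + a') b) = w (v a b) + w (v a' b).
  by rewrite !updC form_updD.
have vD2 a b b' : w (v a (b + b')) = w (v a b) + w (v a b') by exact: form_updD.
have := v0 (u i + u j); rewrite vD1 !vD2 !v0 add0r addr0 => /eqP.
rewrite addrC addr_eq0 -/(v (u j) (u i)) => /eqP ->; congr (- w _).
apply/funext => l; rewrite /v /upd; case: (eqVneq l j) => [->//|_].
by case: eqVneq => [->|].
Qed.

End Alternating.

(** Induction on the position: one adjacent transposition moves the vector from slot p + 1 to slot p
    and costs a sign. *)
Lemma form_to_front (R : realType) (M : atlas R) (A F : prebundle M) (k : nat)
    (w : preform A F k.+1) (hw : is_form w) (x : M) (u : 'I_k.+1 -> A x) (p : 'I_k.+1) :
  w x u = (-1) ^+ p *: w x (ocons (u p) (fun q => u (lift p q))).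
Proof.
case: p => p; elim: p u => [|p IH] u pk.
  have -> : Ordinal pk = ord0 by exact: val_inj.
  by rewrite expr0 scale1r ocons_eta.
have pk' : (p < k.+1)%N by exact: ltnW.
pose i := Ordinal pk'; pose j := Ordinal pk.
have ij : i != j by rewrite -val_eqE /= neq_ltn ltnSn.
have ji : j != i by rewrite eq_sym.
pose v := upd (upd u i (u j)) j (u i).
have E : w x u = - w x v by rewrite /v (form_swap hw) // opprK.
rewrite E (IH v pk') -/i exprS mulN1r scaleNr; congr (- (_ *: w x _)).
apply/funext => l; case: (unliftP ord0 l) => [q|] ->; last first.
  by rewrite !ocons0 /v upd_ne // updE.
rewrite !oconsS /v /upd.
have nj : (lift j q == j) = false by rewrite eq_sym; exact/negbTE/neq_lift.
have [qp|pq|qp] := ltngtP q p.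
- have -> : lift i q = lift j q.
    by apply: val_inj; rewrite /= /bump leqNgt qp ltnNge ltnW.
  rewrite nj ifN // -val_eqE /= /bump ltnNge (ltnW qp) add0n.
  by rewrite neq_ltn qp.
- have -> : lift i q = lift j q.
    by apply: val_inj; rewrite /= /bump pq ltnW.
  rewrite nj ifN // -val_eqE /= /bump pq add1n.
  by rewrite neq_ltn [(p < q.+1)%N]ltnS (ltnW pq) orbT.
- have -> : lift i q = j by apply: val_inj; rewrite /= /bump qp leqnn.
  by rewrite eqxx; congr u; apply: val_inj; rewrite /= /bump qp ltnn.
Qed.

(** * Connections and the Koszul formula *)

(** [form_smooth] concerns local frames only. They are exchanged for the given sections one slot at
    a time, each section being expanded in the frame. *)
Lemma form_eval_smooth (R : realType) (M : atlas R) (HM : is_premanifold M)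
    (A F : prebundle M) (HA : is_vbundle A) (HF : is_vbundle F) (k : nat)
    (w : preform A F k) (W : set M) (s : 'I_k -> sect A) :
  is_form w -> open_in W -> (forall l, smooth_sect_on W (s l)) ->
  smooth_sect_on W (fun x => w x (fun l => s l x)).
Proof.
move=> hw oW hs j c.
have oWj := open_inI HM oW (tdom_open HF j).
apply: (smooth_on_local HM) => // x [Wx dj].
have [i di] := tdom_cover HA x.
pose W' := W `&` tdom j `&` tdom i.
have oW' : open_in W' by exact (open_inI HM oWj (tdom_open HA i)).
exists W'; split=> //.
pose hyb m (b : 'I_k -> 'I_(brank A)) y : 'I_k -> A y :=
  fun l => if (l < m)%N then s l y else frame i (b l) y.
have H m b : (m <= k)%N -> smooth_on W' (fun y => triv j (w y (hyb m b y)) 0 c).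
  elim: m b => [|m IH] b mk.
    by apply: smooth_onS (form_smooth hw i j b c) => y [[_ dj'] di']; split.
  pose lm := Ordinal mk.
  have E y : W' y -> triv j (w y (hyb m.+1 b y)) 0 c =
      \sum_a triv i (s lm y) 0 a * triv j (w y (hyb m (upd b lm a) y)) 0 c.
    move=> [[_ dj'] di'].
    have -> : hyb m.+1 b y = upd (hyb m b y) lm (s lm y).
      apply/funext => l; rewrite /hyb /upd; have [->|ne] := eqVneq l lm.
        by rewrite ltnSn.
      rewrite ltnS leq_eqVlt (negbTE (_ : val l != m)) //.
    rewrite [s lm y](frame_decomp HA di') (form_upd_sum hw) (triv_sum HF dj').
    rewrite summxE; apply: eq_bigr => a _.
    rewrite (trivZ HF dj') mxE -(frame_decomp HA di'); congr (_ * triv j (w y _) 0 c).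
    apply/funext => l; rewrite /hyb /upd; have [->|//] := eqVneq l lm.
    by rewrite ltnn.
  apply: (@smooth_on_eq _ _ _ _ _ (fun y Wy => esym (E y Wy))).
  apply: smooth_on_sum => // a _; apply: smooth_on_mul => //; last exact/IH/ltnW.
  by apply: smooth_onS (hs lm i a) => y [[Wy _] di']; split.
(* The argument starts from some choice b of frame vectors. In rank 0 there is one only if k = 0;
   otherwise the form vanishes, all its arguments being 0. *)
case: (posnP (brank A)) => [r0|r0].
  case: (posnP k) => [k0|k0].
    have b : 'I_k -> 'I_(brank A) by move=> l; have := ltn_ord l; rewrite {2}k0.
    apply: smooth_on_eq (H k b (leqnn k)) => y _; congr (triv j (w y _) 0 c).
    by apply/funext => l; rewrite /hyb ltn_ord.
  apply: (@smooth_on_eq _ _ _ (fun=> 0)); last exact: smooth_on_cst.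
  move=> y [[_ dj'] di'].
  rewrite (form_zero_slot hw (i := Ordinal k0)) ?(triv0 HF dj') ?mxE //.
  apply: (triv_inj HA di'); rewrite (triv0 HA di'); apply/rowP => a.
  by have := ltn_ord a; rewrite {2}r0.
apply: smooth_on_eq (H k (fun _ => Ordinal r0) (leqnn k)) => y _.
congr (triv j (w y _) 0 c); apply/funext => l.
by rewrite /hyb ltn_ord.
Qed.

Lemma sect_ext (R : realType) (M : atlas R) (A : prebundle M) (s t : sect A) :
  (forall y, s y = t y) -> s = t.
Proof. by move=> st; apply: functional_extensionality_dep. Qed.

Section Connections.
Context (R : realType) (M : atlas R) (HM : is_premanifold M).
Context (A F : prebundle M) (HA : is_vbundle A) (HF : is_vbundle F).
Context (rho : forall x : M, A x -> (M -> R) -> R).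
Context (br : sect A -> sect A -> sect A).
Context (nabla : forall x : M, A x -> sect F -> F x).
Context (hbr : is_lie_algebroid rho br) (hc : is_connection rho nabla).

Lemma smooth_sect_add (G : prebundle M) (HG : is_vbundle G) (s t : sect G) :
  smooth_sect s -> smooth_sect t -> smooth_sect (fun y => s y + t y).
Proof.
move=> /smooth_sectT hs /smooth_sectT ht; apply/smooth_sectT.
apply: (smooth_sect_on_add HM HG) => //; exact (open_inT HM).
Qed.

Lemma smooth_sect_scale (G : prebundle M) (HG : is_vbundle G) (f : M -> R)
    (s : sect G) : smooth_on setT f -> smooth_sect s ->
  smooth_sect (fun y => f y *: s y).
Proof.
move=> hf /smooth_sectT hs; apply/smooth_sectT.
apply: (smooth_sect_on_scale HM HG) => //; exact (open_inT HM).
Qed.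

Lemma smooth_sect_sum (G : prebundle M) (HG : is_vbundle G) (I : Type)
    (r : seq I) (P : pred I) (s : I -> sect G) :
  (forall i, P i -> smooth_sect (s i)) ->
  smooth_sect (fun y => \sum_(i <- r | P i) s i y).
Proof.
move=> hs; apply/smooth_sectT; apply: (smooth_sect_on_sum HM HG).
  exact (open_inT HM).
by move=> i Pi; apply/smooth_sectT; exact: hs.
Qed.

Lemma smooth_sect0 (G : prebundle M) (HG : is_vbundle G) :
  smooth_sect (fun y => 0 : G y).
Proof. by apply/smooth_sectT; apply: (smooth_sect_on0 HM HG); exact (open_inT HM). Qed.

Lemma smooth_cst (c : R) : smooth_on [set: M] (fun=> c).
Proof. by apply: smooth_on_cst; exact (open_inT HM). Qed.

Lemma nabla_dir0 x (r : sect F) : smooth_sect r -> nabla (0 : A x) r = 0.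
Proof.
move=> hr; have := conn_linear hc 1 (0 : A x) 0 hr.
rewrite scaler0 addr0 scale1r => /eqP.
by rewrite eq_sym -subr_eq0 addrK => /eqP.
Qed.

Lemma nabla_dirD x (a b : A x) (r : sect F) : smooth_sect r ->
  nabla (a + b) r = nabla a r + nabla b r.
Proof. by move=> hr; have := conn_linear hc 1 a b hr; rewrite !scale1r. Qed.

Lemma nabla_dirZ x c (a : A x) (r : sect F) : smooth_sect r ->
  nabla (c *: a) r = c *: nabla a r.
Proof.
by move=> hr; have := conn_linear hc c a 0 hr; rewrite addr0 nabla_dir0 // addr0.
Qed.

Lemma nabla_dir_sum x (I : Type) (s : seq I) (c : I -> R) (a : I -> A x)
    (r : sect F) : smooth_sect r ->
  nabla (\sum_(i <- s) c i *: a i) r = \sum_(i <- s) c i *: nabla (a i) r.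
Proof.
move=> hr; elim: s => [|i s IH]; first by rewrite !big_nil nabla_dir0.
by rewrite !big_cons nabla_dirD // nabla_dirZ // IH.
Qed.

Lemma nabla0 x (a : A x) : nabla a (fun y => 0 : F y) = 0.
Proof.
have h0 := smooth_sect0 HF.
have := conn_add hc a h0 h0.
rewrite (_ : (fun y => 0 + 0 : F y) = (fun y => 0 : F y)); last first.
  by apply: sect_ext => y; rewrite addr0.
by move=> /eqP; rewrite eq_sym -subr_eq0 addrK => /eqP.
Qed.

Lemma nabla_sum x (a : A x) (I : Type) (s : seq I) (r : I -> sect F) :
  (forall i, smooth_sect (r i)) ->
  nabla a (fun y => \sum_(i <- s) r i y) = \sum_(i <- s) nabla a (r i).
Proof.
move=> hr; elim: s => [|i s IH].
  rewrite big_nil -[RHS](nabla0 a); congr nabla.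
  by apply: sect_ext => y; rewrite big_nil.
rewrite big_cons -IH -(conn_add hc) //; last exact: smooth_sect_sum.
by congr nabla; apply: sect_ext => y; rewrite big_cons.
Qed.

(** Cut off inside V: chi r and chi r' coincide globally, and in the Leibniz rule at x the terms
    with the derivative of chi agree because r x = r' x. *)
Lemma nabla_local x (a : A x) (V : set M) (r r' : sect F) : open_in V -> V x ->
  smooth_sect r -> smooth_sect r' -> (forall y, V y -> r y = r' y) ->
  nabla a r = nabla a r'.
Proof.
move=> oV Vx hr hr' rr'.
have [chi [V' [hchi [_ V'x c1] c0 _ _]]] := cutoff HM oV Vx.
have E : (fun y => chi y *: r y) = (fun y => chi y *: r' y).
  by apply: sect_ext => y; have [/rr' -> //|->] := c0 y; rewrite !scale0r.
have := conn_leibniz hc a hchi hr; rewrite E (conn_leibniz hc a hchi hr').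
by rewrite c1 // !scale1r rr' // => /addIr.
Qed.

Lemma br_local x (V : set M) (s t t' : sect A) : open_in V -> V x ->
  smooth_sect s -> smooth_sect t -> smooth_sect t' ->
  (forall y, V y -> t y = t' y) -> br s t x = br s t' x.
Proof.
move=> oV Vx hs ht ht' tt'.
have [chi [V' [hchi [_ V'x c1] c0 _ _]]] := cutoff HM oV Vx.
have E : (fun y => chi y *: t y) = (fun y => chi y *: t' y).
  by apply: sect_ext => y; have [/tt' -> //|->] := c0 y; rewrite !scale0r.
have := br_leibniz hbr hs ht hchi x; rewrite E (br_leibniz hbr hs ht' hchi x).
by rewrite c1 // !scale1r tt' // => /addIr.
Qed.

Lemma brDr x (s t t' : sect A) : smooth_sect s -> smooth_sect t ->
  smooth_sect t' -> br s (fun y => t y + t' y) x = br s t x + br s t' x.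
Proof.
move=> hs ht ht'; have htt := smooth_sect_add HA ht ht'.
rewrite (br_antisym hbr hs htt) (br_antisym hbr hs ht) (br_antisym hbr hs ht').
have := br_linear hbr 1 ht ht' hs x; rewrite scale1r.
rewrite (_ : (fun y => 1 *: t y + t' y) = (fun y => t y + t' y)).
  by move=> ->; rewrite opprD.
by apply: sect_ext => y; rewrite scale1r.
Qed.

Lemma br_mulr x (f : M -> R) (s t t' : sect A) : smooth_on setT f ->
  smooth_sect s -> smooth_sect t -> smooth_sect t' ->
  br s (fun y => f y *: t y + t' y) x =
    f x *: br s t x + rho (s x) f *: t x + br s t' x.
Proof.
move=> hf hs ht ht'; rewrite (@brDr x s (fun y => f y *: t y)) //.
  by rewrite (br_leibniz hbr).
exact: smooth_sect_scale.
Qed.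

Lemma br_mull x (f : M -> R) (s t t' : sect A) : smooth_on setT f ->
  smooth_sect s -> smooth_sect t -> smooth_sect t' ->
  br (fun y => f y *: t y + t' y) s x =
    f x *: br t s x - rho (s x) f *: t x + br t' s x.
Proof.
move=> hf hs ht ht'; have hft := smooth_sect_scale HA hf ht.
rewrite (br_antisym hbr) //; last exact: smooth_sect_add.
rewrite br_mulr // (br_antisym hbr hs ht) (br_antisym hbr hs ht') !opprD.
by rewrite scalerN !opprK.
Qed.

Lemma nabla_mul x (a : A x) (f : M -> R) (r r' : sect F) : smooth_on setT f ->
  smooth_sect r -> smooth_sect r' ->
  nabla a (fun y => f y *: r y + r' y) =
    f x *: nabla a r + rho a f *: r x + nabla a r'.
Proof.
move=> hf hr hr'; rewrite (conn_add hc) ?(conn_leibniz hc) //.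
exact: smooth_sect_scale.
Qed.

End Connections.

Lemma upd_at (I : eqType) (X : Type) (T : X -> Type) (s : I -> forall y, T y) i
    (e : forall y, T y) y :
  (fun l => upd s i e l y) = upd (fun l => s l y) i (e y).
Proof. by apply/funext => l; rewrite /upd; case: eqP. Qed.

Lemma upd_upd (I : eqType) (T : Type) (u : I -> T) i e e' :
  upd (upd u i e) i e' = upd u i e'.
Proof. by apply/funext => l; rewrite /upd; case: eqP. Qed.

Lemma lift_lift_swap n (i j : 'I_n.+2) (m p : 'I_n.+1) (q : 'I_n) :
  j = lift i m -> i = lift j p -> lift i (lift m q) = lift j (lift p q).
Proof.
move=> /(congr1 val) /= ji /(congr1 val) /= ij; apply: val_inj => /=.
move: ji ij; rewrite /bump; do ![case: leqP => ? //=]; lia.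
Qed.

Section KoszulTerms.
Context (R : realType) (M : atlas R) (A F : prebundle M).
Context (rho : forall x : M, A x -> (M -> R) -> R).
Context (br : sect A -> sect A -> sect A).
Context (nabla : forall x : M, A x -> sect F -> F x).
Context (k : nat) (w : preform A F k) (s : 'I_k.+1 -> sect A) (x : M).
Arguments w : clear implicits.

Definition nabla_term (i : 'I_k.+1) : F x :=
  (-1) ^+ i *: nabla (s i x) (fun y => w y (fun l => s (lift i l) y)).

Definition bracket_term (i j : 'I_k.+1) : F x :=
  (-1) ^+ (i + j) *: w x (fun l : 'I_k => nth 0
    (br (s i) (s j) x
       :: [seq s m x | m <- enum 'I_k.+1 & (m != i) && (m != j)]) l).

(* The defect of f-linearity of the i-th term when a slot is multiplied by f. *)
Definition anchor_term (f : M -> R) (i : 'I_k.+1) : F x :=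
  (-1) ^+ i *: (rho (s i x) f *: w x (fun l => s (lift i l) x)).

Lemma koszul_terms : koszul br nabla w s x =
  \sum_i nabla_term i + \sum_(i < k.+1) \sum_(j < k.+1 | (i < j)%N) bracket_term i j.
Proof. by []. Qed.

End KoszulTerms.

Lemma bracket_termE (R : realType) (M : atlas R) (A F : prebundle M)
    (br : sect A -> sect A -> sect A) k (w : preform A F k.+1)
    (s : 'I_k.+2 -> sect A) (x : M) (i : 'I_k.+2) (m : 'I_k.+1) :
  bracket_term br w s x i (lift i m) = (-1) ^+ (i + lift i m) *:
    w x (ocons (br (s i) (s (lift i m)) x) (fun q => s (lift i (lift m q)) x)).
Proof.
congr (_ *: w x _); apply/funext => l.
exact: (nth_koszul (fun l => s l x)).
Qed.

(** * The Koszul formula is tensorial *)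

Section Koszul.
Context (R : realType) (M : atlas R) (HM : is_premanifold M).
Context (A F : prebundle M) (HA : is_vbundle A) (HF : is_vbundle F).
Context (rho : forall x : M, A x -> (M -> R) -> R).
Context (br : sect A -> sect A -> sect A).
Context (nabla : forall x : M, A x -> sect F -> F x).
Context (hbr : is_lie_algebroid rho br) (hc : is_connection rho nabla).

Lemma form_sect_smooth k (w : preform A F k) (s : 'I_k -> sect A) : is_form w ->
  (forall l, smooth_sect (s l)) -> smooth_sect (fun y => w y (fun l => s l y)).
Proof.
move=> hw hs; apply/smooth_sectT; apply: (form_eval_smooth HM HA HF hw).
  exact (open_inT HM).
by move=> l; exact/smooth_sectT.
Qed.

Lemma upd_smooth k (s : 'I_k -> sect A) j (t : sect A) :
  (forall l, smooth_sect (s l)) -> smooth_sect t ->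
  forall l, smooth_sect (upd s j t l).
Proof. by move=> hs ht l; rewrite /upd; case: eqP. Qed.

Section Slot.
Context (f : M -> R) (hf : smooth_on setT f) (t : sect A) (ht : smooth_sect t).
Context (x : M).

Lemma nabla_term_slot k (w : preform A F k) (s : 'I_k.+1 -> sect A) j i :
  is_form w -> (forall l, smooth_sect (s l)) ->
  nabla_term nabla w (upd s j (fun y => f y *: s j y + t y)) x i =
  f x *: nabla_term nabla w s x i + nabla_term nabla w (upd s j t) x i
    + (if i == j then 0 else anchor_term rho w s x f i).
Proof.
move=> hw hs; rewrite /nabla_term; case: eqVneq => [->|ij].
  rewrite addr0 !updE.
  have E (e : sect A) : (fun y => w y (fun l => upd s j e (lift j l) y)) =
      (fun y => w y (fun l => s (lift j l) y)).
    by apply: sect_ext => y; congr (w y _); apply/funext => l; rewrite upd_lift.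
  have hr : smooth_sect (fun y => w y (fun l => s (lift j l) y)).
    exact: form_sect_smooth.
  rewrite !E (nabla_dirD hc) // (nabla_dirZ hc) // scalerDr !scalerA.
  by rewrite [f x * _]mulrC.
have [l jl] : exists l, j = lift i l.
  case: (unliftP i j) => [l ->|ji]; first by exists l.
  by rewrite ji eqxx in ij.
have E (e : sect A) : (fun y => w y (fun m => upd s j e (lift i m) y)) =
    (fun y => w y (upd (fun m => s (lift i m) y) l (e y))).
  apply: sect_ext => y; congr (w y _).
  rewrite -(upd_at (fun m => s (lift i m))) -upd_lift_comp.
  by rewrite jl.
have hl (e : sect A) : smooth_sect e ->
    smooth_sect (fun y => w y (upd (fun m => s (lift i m) y) l (e y))).
  move=> he; rewrite -E; apply: form_sect_smooth => // m; exact: upd_smooth.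
rewrite !upd_ne // !E.
have -> : (fun y => w y (upd (fun m => s (lift i m) y) l (f y *: s j y + t y))) =
   (fun y => f y *: w y (fun m => s (lift i m) y) +
      w y (upd (fun m => s (lift i m) y) l (t y))).
  apply: sect_ext => y; rewrite (form_upd hw); congr (_ *: w y _ + _).
  by rewrite jl (upd_same (fun m => s (lift i m) y)).
rewrite (nabla_mul HM HF hc) //; [|exact: form_sect_smooth|exact: hl].
rewrite /anchor_term !scalerDr !scalerA [f x * _]mulrC -!addrA; congr (_ + _).
by rewrite addrC.
Qed.

(** A bracket fails to be linear over functions only when it involves slot j; the Leibniz rule then
    leaves s j in front, and [form_to_front] returns it to its place, which produces the sign of an
    [anchor_term]. *)
Lemma bracket_term_slot k (w : preform A F k) (s : 'I_k.+1 -> sect A) (j i i' : 'I_k.+1) :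
  is_form w -> (forall l, smooth_sect (s l)) -> (i < i')%N ->
  bracket_term br w (upd s j (fun y => f y *: s j y + t y)) x i i' =
  f x *: bracket_term br w s x i i' + bracket_term br w (upd s j t) x i i'
    - (if i == j then anchor_term rho w s x f i' else 0)
    - (if i' == j then anchor_term rho w s x f i else 0).
Proof.
case: k w s j i i' => [|k] w s j i i' hw hs; first by rewrite !ord1.
case: (unliftP i i') => [m ->|->]; last by rewrite ltnn.
move=> im; have im' : (lift i m) = m.+1 :> nat.
  move: im; rewrite /= /bump; have [im|mi] := leqP i m; rewrite ?add1n //.
  by move/ltnW; rewrite leqNgt mi.
rewrite !bracket_termE.
pose u := fun q => s (lift i (lift m q)) x.
have hu (e : sect A) : (forall q, j != lift i (lift m q)) ->
    (fun q => upd s j e (lift i (lift m q)) x) = u.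
  by move=> jq; apply/funext => q; rewrite upd_ne // eq_sym.
have wD c c' (a b d : A x) : w x (ocons (c *: a + c' *: b + d) u) =
    c *: w x (ocons a u) + c' *: w x (ocons b u) + w x (ocons d u).
  rewrite -(ocons_upd0 0 (_ + d)) (form_updD hw) (form_upd hw) (form_updZ hw).
  by rewrite !ocons_upd0.
have [ij|ij] := eqVneq i j.
  have nj : lift i m == j = false by rewrite -ij eq_sym; exact/negbTE/neq_lift.
  have jq q : j != lift i (lift m q) by rewrite -ij neq_lift.
  rewrite nj subr0 !hu // -ij !updE !upd_ne // ?(eq_sym _ i) ?neq_lift //.
  rewrite (br_mull HM HA hbr) // -scaleNr wD.
  have [p jp] : exists p, i = lift (lift i m) p.
    case: (unliftP (lift i m) i) => [p ?|E]; first by exists p.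
    by move: nj; rewrite -ij -E eqxx.
  (* Since i is below [lift i m], deleting the latter does not shift i. *)
  have pE : p = i :> nat.
    have := congr1 val jp; rewrite /= /bump -/(bump i m) [bump i m]im'.
    move: im; rewrite im'; move: (i : nat) (m : nat) (p : nat) => a b c.
    by case: (ltnP b c) => /=; lia.
  rewrite /anchor_term (form_to_front hw (fun l => s (lift (lift i m) l) x) p) -jp pE.
  rewrite (_ : (fun q => s (lift (lift i m) (lift p q)) x) = u); last first.
    by apply/funext => q; rewrite -(lift_lift_swap _ (erefl _) jp).
  rewrite exprD !scalerDr !scalerA -[RHS]addrAC -scaleNr; congr (_ *: _ + _ *: _ + _); ring.
rewrite subr0; have [ij'|ij'] := eqVneq (lift i m) j.
  have jq q : j != lift i (lift m q).
    by rewrite -ij' (inj_eq (@lift_inj _ i)) neq_lift.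
  rewrite !hu // -ij' !updE !upd_ne // ?neq_lift // (br_mulr HM HA hbr) // wD.
  rewrite /anchor_term (form_to_front hw (fun l => s (lift i l) x) m) im'.
  rewrite exprD exprS !scalerDr !scalerA -[RHS]addrAC -scaleNr.
  by congr (_ *: _ + _ *: _ + _); ring.
rewrite subr0 !upd_ne //.
have [l jl] : exists l, j = lift i l.
  by case: (unliftP i j) => [l ?|ji]; [exists l|rewrite ji eqxx in ij].
have [q0 lq] : exists q0, l = lift m q0.
  case: (unliftP m l) => [q ?|lm]; first by exists q.
  by rewrite jl lm eqxx in ij'.
have E (e : sect A) : (fun q => upd s j e (lift i (lift m q)) x) = upd u q0 (e x).
  rewrite -(upd_at (fun q => s (lift i (lift m q)))); apply/funext => q.
  by rewrite jl lq /upd !(inj_eq (@lift_inj _ _)).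
rewrite !E -!ocons_updS (form_upd hw) !ocons_updS.
rewrite (_ : upd u q0 (s j x) = u); last by rewrite jl lq upd_same.
by rewrite scalerDr !scalerA mulrC.
Qed.

End Slot.
Section Tensoriality.
Context (k : nat) (w : preform A F k) (hw : is_form w).
Implicit Types (s : 'I_k.+1 -> sect A).

Lemma koszul_ext s s' x : (forall l y, s l y = s' l y) ->
  koszul br nabla w s x = koszul br nabla w s' x.
Proof.
move=> ss'; have -> // : s = s'.
by apply/funext => l; apply: sect_ext => y; exact: ss'.
Qed.

(** For every i other than j, the [anchor_term] of i arises once from the derivative along s i and
    is cancelled by the bracket of s i and s j; the two sums over i > j and i < j match the two
    positions of j in the bracket. *)
Lemma koszul_slot s j (f : M -> R) (t : sect A) x : smooth_on setT f ->
  smooth_sect t -> (forall l, smooth_sect (s l)) ->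
  koszul br nabla w (upd s j (fun y => f y *: s j y + t y)) x =
  f x *: koszul br nabla w s x + koszul br nabla w (upd s j t) x.
Proof.
move=> hf ht hs; rewrite !koszul_terms.
rewrite (eq_bigr _ (fun i _ => nabla_term_slot hf ht x j i hw hs)).
rewrite !big_split /= -scaler_sumr.
pose ex i := anchor_term rho w s x f i.
under [X in _ + X = _]eq_bigr => i _.
  under eq_bigr => i' ii' do rewrite bracket_term_slot //.
  rewrite !sumrB big_split /= -scaler_sumr; over.
rewrite !sumrB big_split /= -scaler_sumr.
have E0 : \sum_(i < k.+1) (if i == j then 0 else ex i) = \sum_(i | i != j) ex i.
  by rewrite [RHS]big_mkcond; apply: eq_bigr => i _; case: eqP.
have E1 : \sum_(i < k.+1) \sum_(i' < k.+1 | (i < i')%N) (if i == j then ex i' else 0)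
    = \sum_(i' < k.+1 | (j < i')%N) ex i'.
  rewrite (bigD1 j) //= eqxx [X in _ + X]big1 ?addr0 // => i /negbTE ->.
  by rewrite big1.
have E2 : \sum_(i < k.+1) \sum_(i' < k.+1 | (i < i')%N) (if i' == j then ex i else 0)
    = \sum_(i < k.+1 | (i < j)%N) ex i.
  rewrite [RHS]big_mkcond; apply: eq_bigr => i _; case: ifPn => ij.
    by rewrite (bigD1 j) //= eqxx big1 ?addr0 // => i' /andP[_ /negbTE ->].
  by rewrite big1 // => i' ii'; case: eqP => // e; rewrite e (negbTE ij) in ii'.
have E : \sum_(i | i != j) ex i =
    \sum_(i' < k.+1 | (j < i')%N) ex i' + \sum_(i < k.+1 | (i < j)%N) ex i.
  rewrite (bigID (fun i : 'I_k.+1 => (j < i)%N)) /=; congr (_ + _).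
    by apply: eq_bigl => i; rewrite -val_eqE /=; case: ltngtP.
  by apply: eq_bigl => i; rewrite -val_eqE /=; case: ltngtP.
rewrite E0 E1 E2 {}E.
move: (\sum_(i' < k.+1 | (j < i')%N) _) (\sum_(i < k.+1 | (i < j)%N) _) => a b.
rewrite scalerDr -(addrA _ (- a)) -opprD.
by rewrite [LHS]addrACA subrr addr0 addrACA.
Qed.

Lemma koszul_slot0 s j x : (forall l, smooth_sect (s l)) ->
  koszul br nabla w (upd s j (fun y => 0 : A y)) x = 0.
Proof.
move=> hs; have h0 := smooth_sect0 HM HA.
have := @koszul_slot (upd s j (fun y => 0 : A y)) j (fun=> 1) _ x
  (smooth_cst HM 1) h0 (upd_smooth _ hs h0).
rewrite updE !upd_upd scale1r.
rewrite (_ : (fun y => _) = (fun y => 0 : A y)); last first.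
  by apply: sect_ext => y; rewrite scaler0 addr0.
by move/eqP; rewrite eq_sym -subr_eq0 addrK => /eqP.
Qed.

Lemma koszul_sum_slot s j x (I : Type) (r : seq I) (f : I -> M -> R)
    (e : I -> sect A) : (forall l, smooth_sect (s l)) ->
  (forall a, smooth_on setT (f a)) -> (forall a, smooth_sect (e a)) ->
  koszul br nabla w (upd s j (fun y => \sum_(a <- r) f a y *: e a y)) x =
  \sum_(a <- r) f a x *: koszul br nabla w (upd s j (e a)) x.
Proof.
move=> hs hf he; elim: r => [|a r IH].
  rewrite big_nil -[RHS](koszul_slot0 j x hs); apply: koszul_ext => l y.
  by rewrite /upd; case: eqP => // _; rewrite big_nil.
rewrite big_cons -IH; set t := fun y => \sum_(a <- r) _.
have ht : smooth_sect t.
  by apply: (smooth_sect_sum HM HA) => i _; exact: (smooth_sect_scale HM HA).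
have := @koszul_slot (upd s j (e a)) j (f a) t x (hf a) ht (upd_smooth _ hs (he a)).
rewrite updE !upd_upd => <-; apply: koszul_ext => l y.
by rewrite /upd; case: eqP => // _; rewrite big_cons.
Qed.

(** Multiplication by chi^2, which is 1 at x, does not change the value. One factor chi globalizes
    the coefficients of s j in a local frame, the other globalizes the frame; these coefficients
    vanish at x. *)
Lemma koszul_zero_slot s j x : (forall l, smooth_sect (s l)) -> s j x = 0 ->
  koszul br nabla w s x = 0.
Proof.
move=> hs sx; have [i di] := tdom_cover HA x.
have [chi [V [hchi [oV Vx V1] c0 cf cs]]] := cutoff HM (tdom_open HA i) di.
pose f a y := chi y * triv i (s j y) 0 a.
pose e a : sect A := fun y => chi y *: frame i a y.
have hf a : smooth_on setT (f a) by apply: cf; exact: hs.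
have he a : smooth_sect (e a) by apply: (cs _ HA); exact: (smooth_frame HM HA).
have h0 := smooth_sect0 HM HA.
have := koszul_slot j x (smooth_on_mul (open_inT HM) hchi hchi) h0 hs.
rewrite koszul_slot0 // addr0 V1 // mulr1 scale1r => <-.
have -> : (fun y => (chi y * chi y) *: s j y + 0) =
    (fun y => \sum_a f a y *: e a y).
  apply: sect_ext => y; rewrite addr0; have [dy|chi0] := c0 y; last first.
    by rewrite chi0 mul0r scale0r big1 // => a _; rewrite /f chi0 mul0r scale0r.
  rewrite {1}(frame_decomp HA dy (s j y)) scaler_sumr; apply: eq_bigr => a _.
  by rewrite /f /e !scalerA; congr (_ *: _); ring.
rewrite koszul_sum_slot // big1 // => a _.
by rewrite /f sx (triv0 HA di) mxE mulr0 scale0r.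
Qed.

Lemma koszul_upd_eq s j (t : sect A) x : (forall l, smooth_sect (s l)) ->
  smooth_sect t -> s j x = t x ->
  koszul br nabla w (upd s j t) x = koszul br nabla w s x.
Proof.
move=> hs ht st; pose d : sect A := fun y => t y + (-1) *: s j y.
have hd : smooth_sect d.
  apply: (smooth_sect_add HM HA) => //.
  exact: (smooth_sect_scale HM HA (smooth_cst HM (-1))).
have := koszul_slot j x (smooth_cst HM 1) hd hs.
rewrite (@koszul_zero_slot (upd s j d) j); first last.
- by rewrite updE /d st scaleN1r subrr.
- exact: upd_smooth.
rewrite addr0 scale1r => <-; apply: koszul_ext => l y; rewrite /upd; case: eqP => // _.
by rewrite /d scale1r scaleN1r addrC subrK.
Qed.

(** The family s is turned into s' slot by slot. This is what gives the choice in [dA] a value. *)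
Lemma koszul_values s s' x : (forall l, smooth_sect (s l)) ->
  (forall l, smooth_sect (s' l)) -> (forall l, s l x = s' l x) ->
  koszul br nabla w s x = koszul br nabla w s' x.
Proof.
move=> hs hs' ss'; pose h m (l : 'I_k.+1) := if (l < m)%N then s' l else s l.
have hh m l : smooth_sect (h m l) by rewrite /h; case: ifP.
have H m : (m <= k.+1)%N -> koszul br nabla w (h m) x = koszul br nabla w s x.
  elim: m => [_|m IH mk]; first exact: koszul_ext.
  rewrite -IH; last exact: ltnW.
  rewrite -(@koszul_upd_eq (h m) (Ordinal mk) (s' (Ordinal mk))) //.
    apply: koszul_ext => l y; rewrite /h /upd ltnS leq_eqVlt.
    by have [->|ne] := eqVneq l (Ordinal mk); rewrite ?eqxx // (negbTE (_ : val l != m)).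
  by rewrite /h ltnn ss'.
rewrite -(H k.+1) //; apply: koszul_ext => l y.
by rewrite /h ltn_ord.
Qed.

Lemma dAE s x : (forall l, smooth_sect (s l)) ->
  dA br nabla w (fun l => s l x) = koszul br nabla w s x.
Proof.
move=> hs; have hy : [set y : F x | forall s' : 'I_k.+1 -> sect A,
    (forall i, smooth_sect (s' i)) -> (forall i, s' i x = s i x) ->
    koszul br nabla w s' x = y] (koszul br nabla w s x).
  by move=> s' hs' ss'; exact: koszul_values.
rewrite /dA; have := @xgetPex _ (0 : F x) _ (ex_intro _ _ hy).
by move=> /(_ s hs (fun=> erefl)) ->.
Qed.

Lemma dA_multilinear x (u : 'I_k.+1 -> A x) j c (e e' : A x) :
  dA br nabla w (upd u j (c *: e + e')) =
  c *: dA br nabla w (upd u j e) + dA br nabla w (upd u j e').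
Proof.
have [s hs] : exists s : 'I_k.+1 -> sect A,
    forall l, smooth_sect (s l) /\ s l x = u l.
  have [s hs] := choice (fun l => sect_through HM HA (u l)); by exists s.
have [t [ht tx]] := sect_through HM HA e.
have [t' [ht' tx']] := sect_through HM HA e'.
have hs1 l : smooth_sect (s l) by case: (hs l).
have U (r : sect A) : smooth_sect r ->
    dA br nabla w (upd u j (r x)) = koszul br nabla w (upd s j r) x.
  move=> hr; rewrite -dAE; last exact: upd_smooth.
  congr (dA _ _ w _); rewrite [RHS](upd_at s); congr (upd _ _ _).
  by apply/funext => l; case: (hs l).
have hct := smooth_sect_add HM HA
  (smooth_sect_scale HM HA (smooth_cst HM c) ht) ht'.
have := U _ hct; rewrite tx tx' => ->.
have := U _ ht; rewrite tx => ->; have := U _ ht'; rewrite tx' => ->.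
have := @koszul_slot (upd s j t) j (fun=> c) t' x (smooth_cst HM c) ht'
  (upd_smooth _ hs1 ht).
by rewrite updE !upd_upd.
Qed.

End Tensoriality.
End Koszul.

(** * The pullback algebroid *)

Section FiberCurves.
Context (R : realType) (B : atlas R) (HB : is_premanifold B).
Context (E : prebundle B) (HE : is_vbundle E).
Let TE := total_space E.
Let HT : is_premanifold TE := total_space_pre HB HE.

Lemma fiber_curve_crd (b : B) (i : chart B) (j : tchart E) (g : R -> E b) (t : R) :
  (forall c, {for t, continuous (fun s => triv j (g s) 0 c)}) ->
  {for t, continuous (fun s => crd ((i, j) : chart TE) (tpt (g s)))}.
Proof.
move=> hg; apply: rV_cvg => c; rewrite -(splitK c); case: (fintype.split c) => a /=.
  rewrite row_mxEl; under eq_cvg do rewrite row_mxEl; exact: cvg_cst.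
by rewrite row_mxEr; under eq_cvg do rewrite row_mxEr; exact: hg.
Qed.

Lemma fiber_curve_near (W : set TE) (b : B) (j : tchart E) (g : R -> E b) (t : R) :
  open_in W -> W (tpt (g t)) -> tdom j b ->
  (forall c, {for t, continuous (fun s => triv j (g s) 0 c)}) ->
  \forall s \near t, W (tpt (g s)).
Proof.
move=> oW Wt dj hg; have [i di] := pre_cover HB b.
have oV := oW (i, j).
pose z s : 'rV[R]_(mdim B + brank E) := crd ((i, j) : chart TE) (tpt (g s)).
have cz : z s @[s --> t] --> z t by exact: fiber_curve_crd.
have : \forall s \near t, (crd ((i, j) : chart TE) @`
    (cdom ((i, j) : chart TE) `&` W)) (z s).
  by apply: cz; apply: open_nbhs_nbhs; split=> //; exists (tpt (g t)).
apply: filterS => s [y [dy Wy] yz].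
by rewrite -(pre_inj HT dy _ yz).
Qed.

(** L is the vertical part of the differential of f in coordinates. A single L for all curves allows
    the derivative along a curve to be compared with that along a straight line, and carries the
    continuity in the base point of the derivative. *)
Lemma fiber_curve_derive (W : set TE) (f : TE -> R) (b : B) (j : tchart E) :
  open_in W -> smooth_on W f -> tdom j b ->
  exists L : E b -> 'I_(brank E) -> R,
    (forall (g : R -> E b) (t : R) dg, W (tpt (g t)) ->
      (forall c, is_derive t 1 (fun s => triv j (g s) 0 c) (dg c)) ->
      is_derive t 1 (fun s => f (tpt (g s))) (\sum_c dg c * L (g t) c)) /\
    (forall (g : R -> E b) (t : R) c, W (tpt (g t)) ->
      (forall c, {for t, continuous (fun s => triv j (g s) 0 c)}) ->
      {for t, continuous (fun s => L (g s) c)}).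
Proof.
move=> oW hf dj; have [i di] := pre_cover HB b.
have oV := oW (i, j); have [h [hs fh]] := hf (i, j).
pose z (e' : E b) : 'rV[R]_(mdim B + brank E) := crd ((i, j) : chart TE) (tpt e').
exists (fun e' c => 'D_(delta_mx 0 (rshift (mdim B) c)) h (z e')); split; last first.
  move=> g t c Wt hg.
  apply: (@continuous_comp _ _ _ (fun s => z (g s))
    (fun y => 'D_(delta_mx 0 (rshift (mdim B) c)) h y)).
    exact: fiber_curve_crd.
  by apply: (Ck_cont (Ck_partial (rshift (mdim B) c) (hs 1))); exists (tpt (g t)).
move=> g t dg Wt hg.
have Vz : (crd ((i, j) : chart TE) @` (cdom ((i, j) : chart TE) `&` W)) (z (g t)).
  by exists (tpt (g t)).
pose dz (c : 'I_(mdim B + brank E)) : R :=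
  match fintype.split c with inl _ => 0 | inr a => dg a end.
have hz (c : 'I_(mdim B + brank E)) : is_derive t 1 (fun s => z (g s) 0 c) (dz c).
  rewrite /dz -{1}(splitK c); case: (fintype.split c) => a /=.
    by rewrite /z /=; under eq_fun do rewrite row_mxEl; exact: is_derive_cst.
  by rewrite /z /=; under eq_fun do rewrite row_mxEr; exact: hg.
have H := is_derive_C1_curve oV (hs 1) Vz hz.
apply: is_derive_eq; first apply: near_eq_is_derive H.
  have cg c : {for t, continuous (fun s => triv j (g s) 0 c)}.
    exact: is_derive_cont (hg c).
  by have := fiber_curve_near oW Wt dj cg; apply: filterS => s Ws; rewrite fh.
rewrite big_split_ord /= big1 ?add0r => [|c _].
  by apply: eq_bigr => c _; rewrite /dz (unsplitK (inr c)).
by rewrite /dz (unsplitK (inl c)) mul0r.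
Qed.

Lemma is_derive_line (b : B) (e u : E b) (j : tchart E) (t : R) c : tdom j b ->
  is_derive t 1 (fun s => triv j (e + s *: u) 0 c) (triv j u 0 c).
Proof.
move=> dj.
have E1 : (fun s => triv j (e + s *: u) 0 c) =
    (fun s => triv j e 0 c + s * triv j u 0 c).
  by apply/funext => s; rewrite (trivD HE dj) (trivZ HE dj) !mxE.
rewrite E1; apply: is_derive_eq.
by rewrite scaler0 !add0r mul1r /GRing.scale /= mulr1.
Qed.

Lemma vliftE (W : set TE) (f : TE -> R) (b : B) (j : tchart E) (g : R -> E b)
    (t : R) (u : E b) : open_in W -> smooth_on W f -> W (tpt (g t)) ->
  tdom j b -> (forall c, is_derive t 1 (fun s => triv j (g s) 0 c) (triv j u 0 c)) ->
  is_derive t 1 (fun s => f (tpt (g s))) (vlift (u : pullE E (tpt (g t))) f).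
Proof.
move=> oW hf Wt dj hg.
have [L [hL _]] := fiber_curve_derive oW hf dj.
have H := hL _ _ _ Wt hg.
have H0 : is_derive (0 : R) 1 (fun s : R => f (tpt (g t + s *: u)))
    (\sum_c triv j u 0 c * L (g t) c).
  have := hL (fun s => g t + s *: u) (0 : R) (fun c => triv j u 0 c).
  rewrite scale0r addr0; apply=> // c; exact: is_derive_line.
by rewrite /vlift derive1E (@derive_val _ _ _ _ _ _ _ H0).
Qed.

Lemma vlift_cont (W : set TE) (f : TE -> R) (b : B) (j : tchart E) (g : R -> E b)
    (t : R) (u : E b) : open_in W -> smooth_on W f -> W (tpt (g t)) ->
  tdom j b -> (forall c, {for t, continuous (fun s => triv j (g s) 0 c)}) ->
  {for t, continuous (fun s => vlift (u : pullE E (tpt (g s))) f)}.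
Proof.
move=> oW hf Wt dj hg.
have [L [hL cL]] := fiber_curve_derive oW hf dj.
apply: (continuous_near_eq (f := fun s => \sum_c triv j u 0 c * L (g s) c)).
  have := fiber_curve_near oW Wt dj hg; apply: filterS => s Ws.
  have := hL (fun r => g s + r *: u) (0 : R) (fun c => triv j u 0 c).
  rewrite scale0r addr0 => H.
  have H0 := H Ws (fun c => is_derive_line (g s) u 0 c dj).
  by rewrite /vlift derive1E (@derive_val _ _ _ _ _ _ _ H0).
apply: continuous_sumr => c _.
exact (continuousM (@cst_continuous _ _ _ _) (cL g t c Wt hg)).
Qed.

Lemma vlift_local (V : set TE) (f f' : TE -> R) (v : TE) (u : pullE E v) :
  open_in V -> V v -> (forall y, V y -> f y = f' y) -> vlift u f = vlift u f'.
Proof.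
case: v u => b e u oV Vv ff'; rewrite /vlift !derive1E.
have [j dj] := tdom_cover HE b.
apply: near_eq_derive.
apply: filterS (fiber_curve_near (g := fun s => e + s *: u) (t := 0) oV _ dj _).
- by move=> s /=; exact: ff'.
- by rewrite scale0r addr0.
- by move=> c; exact: is_derive_cont (is_derive_line _ _ _ _ dj).
Qed.

Lemma vlift_cst (v : TE) (u : pullE E v) (c : R) : vlift u (fun=> c) = 0.
Proof. by rewrite /vlift derive1_cst. Qed.

Lemma vlift_coord (v : TE) (u : pullE E v) (j : tchart E) c :
  tdom j (bproj v) ->
  vlift u (fun y => triv j (projT2 y) 0 c) = triv j (u : E (bproj v)) 0 c.
Proof.
case: v u => b e u dj; rewrite /vlift derive1E.
exact: (@derive_val _ _ _ _ _ _ _ (is_derive_line e u 0 c dj)).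
Qed.

End FiberCurves.

Section PullbackAlgebroid.
Context (R : realType) (B : atlas R) (HB : is_premanifold B).
Context (E : prebundle B) (HE : is_vbundle E).
Let TE := total_space E.
Let HT : is_premanifold TE := total_space_pre HB HE.
Let HA : is_vbundle (pullE E) := pullE_vbundle HB HE.
Context (F : prebundle TE) (HF : is_vbundle F).
Context (br : sect (pullE E) -> sect (pullE E) -> sect (pullE E)).
Context (nabla : forall v : TE, pullE E v -> sect F -> F v).
Context (hbr : is_lie_algebroid (@vlift R B E) br).
Context (hpull : forall s1 s2 : sect E, smooth_sect s1 -> smooth_sect s2 ->
  forall v, br (pull_sect s1) (pull_sect s2) v = 0).
Context (hc : is_connection (@vlift R B E) nabla).

Lemma nablaZ (v : TE) (a : pullE E v) (c : R) (r : sect F) : smooth_sect r ->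
  nabla a (fun y => c *: r y) = c *: nabla a r.
Proof.
move=> hr; rewrite (conn_leibniz hc a (smooth_cst HT c) hr) vlift_cst.
by rewrite scale0r addr0.
Qed.

Lemma nabla_lincomb (v : TE) (a : pullE E v) (I : Type) (l : seq I) (c : I -> R)
    (r : I -> sect F) : (forall i, smooth_sect (r i)) ->
  nabla a (fun y => \sum_(i <- l) c i *: r i y) =
  \sum_(i <- l) c i *: nabla a (r i).
Proof.
move=> hr; rewrite (nabla_sum HT HF hc a l (r := fun i y => c i *: r i y)).
  by apply: eq_bigr => i _; rewrite nablaZ.
by move=> i; exact: (smooth_sect_scale HT HF (smooth_cst HT (c i))).
Qed.

Lemma sections_through k (v : TE) (u : 'I_k -> pullE E v) :
  exists S : 'I_k -> sect E, (forall l, smooth_sect (S l)) /\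
    (fun l => S l (bproj v)) = u.
Proof.
have [S hS] := choice (fun l => sect_through HB HE (u l : E (bproj v))).
by exists S; split=> [l|]; [case: (hS l)|apply/funext => l; case: (hS l)].
Qed.

(** A local frame of the pullback bundle agrees, near a given point, with pullbacks of global
    sections of E obtained by a cutoff on B. So smoothness of a form can be tested on pullbacks
    alone. *)
Lemma form_smooth_pull k (w : preform (pullE E) F k) :
  (forall S : 'I_k -> sect E, (forall l, smooth_sect (S l)) ->
     smooth_sect (fun v => w v (fun l => S l (bproj v) : pullE E v))) ->
  forall (i : tchart (pullE E)) (j : tchart F) (b : 'I_k -> 'I_(brank (pullE E))) c,
  smooth_on (tdom i `&` tdom j)
    (fun v => triv j (w v (fun l => frame i (b l) v)) 0 c).
Proof.
move=> hw i j b c.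
have oi := open_in_pull HB HE (tdom_open HE i).
have oj := tdom_open HF j.
apply: (smooth_on_local HT); first exact (open_inI HT oi oj).
move=> v [di dj].
have [chi [V [_ [oV Vv V1] _ _ cs]]] := cutoff HB (tdom_open HE i) di.
pose s (l : 'I_k) : sect E := fun y => chi y *: @frame R B E i (b l) y.
have hs l : smooth_sect (s l) by apply: (cs _ HE); exact: (smooth_frame HB HE).
have oV' := open_in_pull HB HE oV.
exists ((@bproj R B E) @^-1` V `&` tdom j); split; [exact (open_inI HT oV' oj)|by []|].
apply: (@smooth_on_eq _ _ _ (fun y : TE =>
    triv j (w y (fun l => s l (bproj y) : pullE E y)) 0 c)).
  move=> y [Vy _]; congr (triv j (w y _) 0 c).
  by apply/funext => l; rewrite /s V1 // scale1r.
by apply: smooth_onS (hw s hs j c) => y [].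
Qed.

Section Differential.
Context (k : nat) (w : preform (pullE E) F k) (hw : is_form w).

(** Pulled back sections commute, so the brackets drop out. As they span each fibre, this determines
    the differential. *)
Lemma dA_pull (s : 'I_k.+1 -> sect E) (v : TE) : (forall l, smooth_sect (s l)) ->
  dA br nabla w (fun l => s l (bproj v) : pullE E v) =
  \sum_(i < k.+1) (-1) ^+ i *: nabla (s i (bproj v) : pullE E v)
     (fun y => w (fun l => s (lift i l) (bproj y) : pullE E y)).
Proof.
move=> hs; have hps l : smooth_sect (pull_sect (s l)).
  exact: (pull_smooth HB HE).
rewrite (dAE HT HA HF hbr hc hw (s := fun l => pull_sect (s l))) // koszul_terms.
rewrite [X in _ + X]big1 ?addr0 // => i _; rewrite big1 // => j ij.
move: w hw s hs hps i j ij; case: k => [|n] w' hw' s hs hps i j.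
  by rewrite !ord1.
case: (unliftP i j) => [m ->|->]; last by rewrite ltnn.
rewrite bracket_termE (form_zero_slot hw' (i := ord0)) ?scaler0 //.
by rewrite ocons0 hpull.
Qed.

Lemma dA_smooth_pull (s : 'I_k.+1 -> sect E) : (forall l, smooth_sect (s l)) ->
  smooth_sect (fun v => dA br nabla w (fun l => s l (bproj v) : pullE E v)).
Proof.
move=> hs.
apply/smooth_sectT; apply: (@smooth_sect_on_eq _ _ _ _ _ _ (fun v _ => esym (dA_pull v hs))).
apply: (smooth_sect_on_sum HT HF); first exact (open_inT HT).
move=> i _; apply: (smooth_sect_on_scale HT HF); first exact (open_inT HT).
  exact: (smooth_cst HT).
apply/smooth_sectT; apply: (conn_smooth hc (s := pull_sect (s i))).
  exact: (pull_smooth HB HE).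
apply: (form_sect_smooth HT HA HF hw) => l; exact: (pull_smooth HB HE).
Qed.

Lemma dA_alternating (v : TE) (u : 'I_k.+1 -> pullE E v) (i j : 'I_k.+1) :
  i != j -> u i = u j -> dA br nabla w u = 0.
Proof.
move=> ij uij; have [s0 [hs0 su]] := sections_through u.
(* The two sections are made equal everywhere, not only at v; then w vanishes identically in every
   term that keeps both of them. *)
pose s := upd s0 j (s0 i).
have hs l : smooth_sect (s l) by rewrite /s /upd; case: eqP.
have us : u = (fun l => s l (bproj v)).
  apply/funext => l; rewrite /s /upd; case: eqVneq => [->|_]; last by rewrite -su.
  by rewrite -uij -su.
rewrite us dA_pull //.
have sij : s i = s j by rewrite /s updE upd_ne.
have [l jl] : exists l, j = lift i l.
  by case: (unliftP i j) => [l ?|ji]; [exists l|rewrite ji eqxx in ij].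
have [p ip] : exists p, i = lift j p.
  by case: (unliftP j i) => [p ?|ji]; [exists p|rewrite ji eqxx in ij].
have hW (m : 'I_k.+1) : smooth_sect (fun y : TE => w (fun l => s (lift m l) (bproj y) : pullE E y)).
  apply: (form_sect_smooth HT HA HF hw (s := fun q => pull_sect (s (lift m q)))).
  by move=> q; exact: (pull_smooth HB HE).
rewrite (bigD1 i) //= (bigD1 j) 1?eq_sym //= big1 ?addr0; last first.
  move=> m /andP[mi mj].
  rewrite (_ : (fun y => _) = (fun y => 0 : F y)) ?(nabla0 HT HF hc) ?scaler0 //.
  apply: sect_ext => y.
  have [a ia] : exists a, i = lift m a.
    by case: (unliftP m i) => [a ?|E0]; [exists a|rewrite E0 eqxx in mi].
  have [b jb] : exists b, j = lift m b.
    by case: (unliftP m j) => [b ?|E0]; [exists b|rewrite E0 eqxx in mj].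
  apply: (form_alternating hw (i := a) (j := b)); last by rewrite -ia -jb sij.
  by apply: contra ij => /eqP ab; rewrite ia jb ab.
(* l is the slot of j once i is deleted, and p that of i once j is deleted; deletion shifts just the
   larger index, whence one extra sign. *)
have sg : (-1) ^+ i * (-1) ^+ l = - ((-1) ^+ j * (-1) ^+ p) :> R.
  rewrite -!exprD; have := congr1 val jl; have := congr1 val ip; rewrite /= /bump.
  move: (i : nat) (j : nat) (l : nat) (p : nat) => a b c d.
  case: (leqP b d); case: (leqP a c) => /= h1 h2 e1 e2.
  - by exfalso; lia.
  - by rewrite (_ : (a + c = (b + d).+1)%N) ?exprS ?mulN1r //; lia.
  - by rewrite (_ : (b + d = (a + c).+1)%N) ?exprS ?mulN1r ?opprK //; lia.
  - by exfalso; lia.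
have E0 : (fun y : TE => w (fun q => s (lift i q) (bproj y) : pullE E y)) =
    (fun y => (- ((-1) ^+ i * (-1) ^+ j)) *: w (fun q => s (lift j q) (bproj y) : pullE E y)).
  apply: sect_ext => y; move: sg.
  move: w hw l p jl ip; case: k i j s sij {ij uij su us hs hW} => [|n] a b s sij w' hw' l p jl ip.
    by have := ltn_ord l.
  move=> sg.
  rewrite (form_to_front hw' (fun q => s (lift a q) (bproj y) : pullE E y) l).
  rewrite (form_to_front hw' (fun q => s (lift b q) (bproj y) : pullE E y) p).
  rewrite -jl -ip sij scalerA.
  rewrite (_ : (fun q => s (lift a (lift l q)) (bproj y)) =
    (fun q => s (lift b (lift p q)) (bproj y))); last first.
    by apply/funext => q; rewrite (lift_lift_swap _ jl ip).
  congr (_ *: _); have := congr1 ( *%R ((-1) ^+ a)) sg.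
  by rewrite mulrA -expr2 sqrr_sign mul1r => ->; ring.
rewrite E0 nablaZ // sij scalerA mulrN mulrA -expr2 sqrr_sign mul1r scaleNr.
by rewrite addNr.
Qed.

Lemma dA_form : is_form (dA br nabla w).
Proof.
split.
- exact: (dA_multilinear HT HA HF hbr hc hw).
- exact: dA_alternating.
- by apply: form_smooth_pull => S hS; exact: dA_smooth_pull.
Qed.

End Differential.

(** Near v the Euler section is the sum of the fibre coordinates y_a times pulled back frame
    sections. These commute with s, so the Leibniz rule leaves the derivatives of y_a along s, which
    are the coordinates of s. Two cutoffs globalize the frame on B and the coordinates on the total
    space. *)
Lemma pull_br_euler (s : sect E) (v : TE) : smooth_sect s ->
  br (pull_sect s) (@euler R B E) v = pull_sect s v.
Proof.
move=> hs; have [i di] := tdom_cover HE (bproj v).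
have oi := tdom_open HE i; have oi' := open_in_pull HB HE oi.
have [chi [V [hchi [oV Vv V1] _ _ cs]]] := cutoff HB oi di.
have [chj [W [hchj [oW Wv W1] _ cf _]]] := cutoff HT oi' di.
pose e a : sect E := fun y => chi y *: frame i a y.
have he a : smooth_sect (e a) by apply: (cs _ HE); exact: (smooth_frame HB HE).
have hps a : smooth_sect (pull_sect (e a)) by exact: (pull_smooth HB HE).
pose f a (y : TE) := chj y * triv i (projT2 y) 0 a.
have hf a : smooth_on setT (f a) by apply: cf; exact: (smooth_on_fiber HB HE).
have hp : smooth_sect (pull_sect s) by exact: (pull_smooth HB HE).
have oVW : open_in ((@bproj R B E) @^-1` V `&` W `&` (@bproj R B E) @^-1` tdom i).
  apply (open_inI HT (open_inI HT (open_in_pull HB HE oV) oW) oi').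
have hsum : smooth_sect (fun y => \sum_a f a y *: pull_sect (e a) y).
  by apply: (smooth_sect_sum HT HA) => a _; exact: (smooth_sect_scale HT HA).
rewrite (br_local HT hbr oVW _ hp (euler_smooth HB HE) hsum) //; last first.
  move=> [y u] [[/= Vy Wy] dy]; rewrite /euler /=.
  rewrite {1}(frame_decomp HE dy u); apply: eq_bigr => a _.
  by rewrite /f /pull_sect /e /bproj /= W1 // V1 // mul1r scale1r.
have brs (l : seq 'I_(brank E)) :
    br (pull_sect s) (fun y => \sum_(a <- l) f a y *: pull_sect (e a) y) v =
    \sum_(a <- l) vlift (pull_sect s v) (f a) *: pull_sect (e a) v.
  elim: l => [|a l IH].
    rewrite big_nil; have := br_leibniz hbr hp (smooth_sect0 HT HA) (smooth_cst HT 0) v.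
    rewrite vlift_cst !scale0r addr0 => E0; rewrite -[RHS]E0; congr (br _ _ v); apply: sect_ext => y.
    by rewrite big_nil scale0r.
  rewrite big_cons -IH -(add0r (_ *: _)) -(scaler0 _ (f a v)) -(hpull hs (he a) v).
  have hl : smooth_sect (fun y => \sum_(a <- l) f a y *: pull_sect (e a) y).
    by apply: (smooth_sect_sum HT HA) => q _; exact: (smooth_sect_scale HT HA).
  rewrite -(br_mulr HT HA hbr v (hf a) hp (hps a) hl).
  by congr (br _ _ v); apply: sect_ext => y; rewrite big_cons.
rewrite brs [RHS](frame_decomp HE di); apply: eq_bigr => a _.
rewrite /pull_sect /e V1 // scale1r; congr (_ *: _).
rewrite -(vlift_coord HE (s (bproj v) : pullE E v) a di).
have := @vlift_local _ _ HB _ HE W (f a) (fun y : TE => triv i (projT2 y) 0 a) v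
  (s (bproj v)) oW Wv; apply => y Wy. by rewrite /f W1 // mul1r.
Qed.

End PullbackAlgebroid.

(** * Parallel transport along rays *)

(** Global sections that span the fibres over W, with a smooth choice of coefficients. They need not
    be independent, so such a family exists over a neighbourhood of any compact arc without a
    trivialization along it. *)
Record is_coframe (R : realType) (M : atlas R) (F : prebundle M) (W : set M)
    (m : nat) (e : 'I_m -> sect F) (c : 'I_m -> forall y, F y -> R) : Prop :=
  IsCoframe {
    coframe_open : open_in W;
    coframe_smooth : forall k, smooth_sect (e k);
    coframe_linear : forall k y a (z z' : F y),
      c k y (a *: z + z') = a * c k y z + c k y z';
    coframe_decomp : forall y, W y -> forall z : F y,
      z = \sum_k c k y z *: e k y;
    coframe_coef : forall k (r : sect F), smooth_sect r ->
      smooth_on W (fun y => c k y (r y))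
  }.

Section CoframeTheory.
Context (R : realType) (M : atlas R) (F : prebundle M) (W : set M) (m : nat).
Context (e : 'I_m -> sect F) (c : 'I_m -> forall y, F y -> R).
Context (hF : is_coframe W e c).

Lemma coframe0 k y : c k (0 : F y) = 0.
Proof.
have := coframe_linear hF k (1 : R) (0 : F y) 0.
by rewrite scaler0 addr0 mul1r => /eqP; rewrite eq_sym -subr_eq0 addrK => /eqP.
Qed.

Lemma coframeZ k y a (z : F y) : c k (a *: z) = a * c k z.
Proof. by have := coframe_linear hF k a z 0; rewrite !addr0 coframe0 addr0. Qed.

Lemma coframeD k y (z z' : F y) : c k (z + z') = c k z + c k z'.
Proof. by have := coframe_linear hF k 1 z z'; rewrite scale1r mul1r. Qed.

Lemma coframe_sum k y (I : Type) (r : seq I) (z : I -> F y) :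
  c k (\sum_(i <- r) z i) = \sum_(i <- r) c k (z i).
Proof.
elim: r => [|i r IH]; first by rewrite !big_nil coframe0.
by rewrite !big_cons coframeD IH.
Qed.

Lemma coframe_inj y (z z' : F y) : W y -> (forall k, c k z = c k z') -> z = z'.
Proof.
move=> Wy zz'; rewrite (coframe_decomp hF Wy z) (coframe_decomp hF Wy z').
by apply: eq_bigr => k _; rewrite zz'.
Qed.

End CoframeTheory.

(** Finitely many cutoffs chi_s cover the arc. The sections are chi_s times frame vectors, and the
    functionals are chi_s times frame coordinates, divided by the sum of the chi_s^2. The hypothesis
    on g expresses its continuity. *)
Lemma coframe_along (R : realType) (M : atlas R) (HM : is_premanifold M)
    (F : prebundle M) (HF : is_vbundle F) (g : R -> M) (a b : R) :
  (forall (V : set M) s, open_in V -> V (g s) -> \forall s' \near s, V (g s')) ->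
  exists (m : nat) (e : 'I_m -> sect F) (c : 'I_m -> forall y, F y -> R) (W : set M),
    is_coframe W e c /\ forall s, a <= s <= b -> W (g s).
Proof.
move=> gV.
have cut s : exists f : tchart F * (M -> R) * set M,
    [/\ smooth_on setT f.1.2, open_in f.2,
      f.2 (g s) /\ (forall x, f.2 x -> f.1.2 x = 1),
      forall x, tdom f.1.1 x \/ f.1.2 x = 0
    & (forall h : M -> R, smooth_on (tdom f.1.1) h ->
         smooth_on setT (fun x => f.1.2 x * h x)) /\
      (forall t : sect F, smooth_sect_on (tdom f.1.1) t ->
         smooth_sect (fun x => f.1.2 x *: t x))].
  have [i di] := tdom_cover HF (g s).
  have [chi [V [hchi [oV Vs V1] c0 cf cs]]] := cutoff HM (tdom_open HF i) di.
  by exists (i, chi, V); split=> //; split=> // t ht; exact: (cs _ HF).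
have [f hf] := choice cut.
pose tr s := (f s).1.1; pose chi s := (f s).1.2; pose V s := (f s).2.
have [D _ cD] : finite_subset_cover `[a, b]
    (fun s => (g @^-1` V s)^°) `[a, b].
  have := @segment_compact R a b; rewrite compact_cover; apply.
    by move=> s _; exact: open_interior.
  move=> s sab; exists s => //; have [_ oV [Vs _] _ _] := hf s.
  exact: gV.
pose l : seq R := finmap.enum_fset D.
(* Squares appear because chi_s enters once in the section and once in the functional; on the arc
   some chi_s equals 1, so phi is positive. *)
pose phi x := \sum_(s : seq_sub l) chi (val s) x * chi (val s) x.
have hchi s : smooth_on setT (chi s) by have [] := hf s.
have oT := open_inT HM.
have hphi : smooth_on setT phi.
  by apply: smooth_on_sum => // s _; exact: smooth_on_mul.
pose W : set M := setT `&` phi @^-1` [set t | t != 0].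
have oW : open_in W.
  exact (open_in_smooth oT hphi (@open_neq R 0)).
pose K := (seq_sub l * 'I_(brank F))%type.
pose e (k : K) : sect F := fun y => chi (val k.1) y *: frame (tr (val k.1)) k.2 y.
pose c (k : K) y (z : F y) : R :=
  chi (val k.1) y * triv (tr (val k.1)) z 0 k.2 / phi y.
have he k : smooth_sect (e k).
  by have [_ _ _ _ [_ cs]] := hf (val k.1); apply: cs; exact: (smooth_frame HM HF).
exists #|{: K}|, (fun k => e (enum_val k)), (fun k => c (enum_val k)), W.
split; last first.
  move=> s sab; split=> //=.
  have [s0 s0D s0s] := cD s sab.
  have Vs : V s0 (g s) by exact: (interior_subset s0s).
  have [_ _ [_ V1] _ _] := hf s0.
  have s0l : s0 \in l by [].
  rewrite gt_eqF // /phi (bigD1 (SeqSub s0l)) //= /chi V1 // mulr1.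
  by rewrite ltr_pwDl // sumr_ge0 // => i _; rewrite -expr2 sqr_ge0.
split=> //.
- move=> k y t z z'; rewrite /c; have [_ _ _ /(_ y) [dy|c0] _] := hf (val (enum_val k).1).
    by rewrite (trivD HF dy) (trivZ HF dy) !mxE; ring.
  by rewrite /chi c0 !mul0r mulr0 addr0.
- move=> y [_ /= phiy] z.
  transitivity (\sum_(k : K) c k y z *: e k y); last first.
    exact: (reindex _ (onW_bij _ (@enum_val_bij K))).
  rewrite (eq_bigr (fun k : K => c (k.1, k.2) y z *: e (k.1, k.2) y)); last by case.
  rewrite -(pair_bigA _ (fun s k => c (s, k) y z *: e (s, k) y)) /=.
  rewrite -{1}(scale1r z) -(divff phiy) /phi mulr_suml scaler_suml.
  apply: eq_bigr => s _; rewrite /c /e /=.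
  have [_ _ _ /(_ y) [dy|c0] _] := hf (val s).
    rewrite {1}(frame_decomp HF dy z) scaler_sumr; apply: eq_bigr => k _.
    by rewrite !scalerA; congr (_ *: _); rewrite /chi /tr; ring.
  rewrite /chi c0 !mul0r scale0r big1 // => k _; by rewrite !mul0r scale0r.
- move=> k r hr; rewrite /c; have [_ _ _ _ [cf _]] := hf (val (enum_val k).1).
  apply: smooth_on_mul => //.
    by apply: smooth_onS (cf _ (hr _ _)).
  apply: smooth_on_inv => //; first by move=> x [].
  exact: smooth_onS hphi.
Qed.

Section Clamp.
Context (R : realType).

(** Composition with it extends coefficients that are continuous on [0, T] to bounded continuous
    functions on the line, as [linear_ode_exists] requires. *)
Definition clamp (T s : R) : R := Num.max 0 (Num.min T s).

Lemma clamp_itv T s : 0 <= T -> 0 <= clamp T s <= T.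
Proof. by move=> T0; rewrite /clamp le_max lexx /= ge_max T0 ge_min lexx. Qed.

Lemma clamp_id T s : 0 <= s <= T -> clamp T s = s.
Proof.
by move=> /andP[s0 sT]; rewrite /clamp (min_idPr sT) (max_idPr s0).
Qed.

Lemma clamp_cont T : continuous (clamp T).
Proof.
move=> s; apply: (@continuous_max _ _ (fun=> 0) (fun s => Num.min T s)).
  exact: cvg_cst.
by apply: (@continuous_min _ _ (fun=> T) id); [exact: cvg_cst|exact: cvg_id].
Qed.

Lemma continuous_clamp T (f : R -> R) : 0 <= T ->
  (forall s, 0 <= s <= T -> {for s, continuous f}) ->
  continuous (fun s => f (clamp T s)).
Proof.
move=> T0 cf s; apply: (@continuous_comp _ _ _ (clamp T) f); first exact: clamp_cont.
by apply: cf; exact: clamp_itv.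
Qed.

Lemma bounded_clamp T (f : R -> R) : 0 <= T ->
  (forall s, 0 <= s <= T -> {for s, continuous f}) ->
  exists C : R, forall s, `|f (clamp T s)| <= C.
Proof.
move=> T0 cf; have cg : continuous (fun s => `|f (clamp T s)|).
  by move=> s; apply: cvg_norm; exact: continuous_clamp.
have [a _ ha] := EVT_max T0 (continuous_subspaceT cg).
exists `|f (clamp T a)| => s.
have := ha (clamp T s); rewrite in_itv /= clamp_itv // => /(_ isT).
by rewrite (clamp_id (clamp_itv s T0)).
Qed.

End Clamp.

Lemma derive0_const (R : realType) (f : R -> R) (a s : R) : a <= s ->
  (forall t : R, a <= t <= s -> is_derive t 1 f 0) -> f s = f a.
Proof.
move=> as' f0; have [c _ /eqP] := mean_value (df := fun=> 0) as' f0.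
by rewrite mul0r subr_eq0 => /eqP.
Qed.

Section AffineODE.
Context (R : realType) (I : finType).

(* An affine system is a linear one with an additional constant unknown. *)
Definition affine_mx (A : I -> I -> R) (b : I -> R) (j l : 'I_1 + I) : R :=
  match j, l with
  | inr j, inr l => A j l
  | inl _, inr l => b l
  | _, inl _ => 0
  end.

Definition affine_init (x0 : I -> R) (l : 'I_1 + I) : R :=
  if l is inr l then x0 l else 1.

Lemma affine_solution (A : R -> I -> I -> R) (b : R -> I -> R) (x0 : I -> R)
    (x : R -> 'I_1 + I -> R) : (forall l, x 0 l = affine_init x0 l) ->
  ode_solution (fun s => affine_mx (A s) (b s)) x ->
  forall (s : R) k, 0 <= s -> is_derive s 1 (fun s => x s (inr k))
    (\sum_j x s (inr j) * A s j k + b s k).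
Proof.
move=> x00 hx s k s0.
have x1 : x s (inl ord0) = 1.
  rewrite -[RHS](x00 (inl ord0)).
  apply: (derive0_const (f := fun t => x t (inl ord0)) s0) => t _.
  apply: is_derive_eq (hx t (inl ord0)) _.
  by rewrite big1 // => -[j|j] _ /=; rewrite mulr0.
apply: is_derive_eq (hx s (inr k)) _.
by rewrite big_sumType /= big_ord1 x1 mul1r addrC.
Qed.

Lemma affine_ode_exists (T : R) (A : R -> I -> I -> R) (b : R -> I -> R)
    (x0 : I -> R) : 0 <= T ->
  (forall s, 0 <= s <= T -> forall j k, {for s, continuous (fun s => A s j k)}) ->
  (forall s, 0 <= s <= T -> forall k, {for s, continuous (fun s => b s k)}) ->
  exists x : R -> I -> R, (forall k, x 0 k = x0 k) /\
    forall (s : R) k, 0 <= s <= T -> is_derive s 1 (fun s => x s k)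
      (\sum_j x s j * A s j k + b s k).
Proof.
move=> T0 cA cb.
pose M s := affine_mx (A (clamp T s)) (b (clamp T s)).
have cM j l s : 0 <= s <= T -> {for s, continuous (fun s => affine_mx (A s) (b s) j l)}.
  move=> sT; case: j l => [j|j] [l|l] /=; try exact: cvg_cst; [exact: cb|exact: cA].
have [C hC] : exists C : R, forall s j l, `|M s j l| <= C.
  have [C hC] := choice (fun jl : _ * _ => bounded_clamp T0 (cM jl.1 jl.2)).
  exists (\sum_jl `|C jl|) => s j l; apply: le_trans (hC (j, l) s) _.
  rewrite (bigD1 (j, l)) //= (le_trans (ler_norm _)) // lerDl.
  by apply: sumr_ge0 => jl _.
have [|x [xi hx]] := linear_ode_exists (affine_init x0) _ hC.
  move=> j l.
  by apply: (continuous_clamp (f := fun s => affine_mx (A s) (b s) j l) T0 (cM j l)).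
exists (fun s k => x s (inr k)); split=> [k|s k sT]; first exact: xi.
have s0 : 0 <= s by case/andP: sT.
have := affine_solution (A := fun s => A (clamp T s)) (b := fun s => b (clamp T s)) xi hx k s0.
by rewrite clamp_id.
Qed.

End AffineODE.

Lemma within_continuous_near (R : realType) (f : R -> R) (a b : R) :
  (forall s : R, a <= s <= b -> exists2 g : R -> R, {for s, continuous g} &
    \forall s' \near s, a <= s' <= b -> f s' = g s') ->
  {within `[a, b], continuous f}.
Proof.
move=> H; apply/subspace_continuousP => s; rewrite /= in_itv /= => abs.
have [g cg fg] := H s abs.
have fs : f s = g s by have /nbhs_singleton := fg; exact.
change (f x @[x --> within `[a, b] (nbhs s)] --> f s).
rewrite fs => P /cg gP; change (nbhs s (fun s' => `[a, b]%classic s' -> P (f s'))).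
move: fg gP; apply: filterS2 => s' fg gP; rewrite /= in_itv /= => /fg ->.
exact: gP.
Qed.

Section Rays.
Context (R : realType) (B : atlas R) (HB : is_premanifold B).
Context (E : prebundle B) (HE : is_vbundle E).
Let TE := total_space E.
Let HT : is_premanifold TE := total_space_pre HB HE.
Context (F : prebundle TE) (HF : is_vbundle F).
Context (nabla : forall v : TE, pullE E v -> sect F -> F v).
Context (hc : is_connection (@vlift R B E) nabla).
Context (W : set TE) (m : nat) (e : 'I_m -> sect F).
Context (c : 'I_m -> forall y, F y -> R) (hF : is_coframe W e c).

(** The coefficients of r are smooth on W only; a cutoff makes them global, and locality of the
    connection and of the vertical derivative removes it again. *)
Lemma nabla_expand (y : TE) (a : pullE E y) (r : sect F) : W y -> smooth_sect r ->
  nabla a r = \sum_k (c k (r y) *: nabla a (e k)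
                      + vlift a (fun y => c k (r y)) *: e k y).
Proof.
move=> Wy hr.
have [chi [V [_ [oV Vy V1] _ cf _]]] := cutoff HT (coframe_open hF) Wy.
have oVW := open_inI HT oV (coframe_open hF).
pose f k z := chi z * c k (r z).
have hf k : smooth_on setT (f k) by apply: cf; exact: (coframe_coef hF).
have he := coframe_smooth hF.
have hfe k : smooth_sect (fun z => f k z *: e k z).
  exact: (smooth_sect_scale HT HF).
rewrite (nabla_local HT hc a oVW _ hr (r' := fun z => \sum_k f k z *: e k z)).
- rewrite (nabla_sum HT HF hc a _ hfe); apply: eq_bigr => k _.
  rewrite (conn_leibniz hc) // {1}/f V1 // mul1r; congr (_ + _ *: _).
  by apply: (vlift_local HB HE a oV Vy) => z Vz; rewrite /f V1 // mul1r.
- by [].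
- by apply: (smooth_sect_sum HT HF).
- move=> z [Vz Wz]; rewrite [LHS](coframe_decomp hF Wz); apply: eq_bigr => k _.
  by rewrite /f V1 // mul1r.
Qed.

Context (b : B) (ve : E b).
Notation ray s := (dilate s (tpt ve)).
Notation dir s := (ve : pullE E (ray s)).

Lemma ray_coord (j : tchart E) (s : R) k : tdom j b ->
  is_derive s 1 (fun s => triv j (s *: ve) 0 k) (triv j ve 0 k).
Proof.
move=> dj; have := is_derive_line HE 0 ve s k dj.
by under eq_fun do rewrite add0r.
Qed.

Lemma ray_derive (V : set TE) (f : TE -> R) (s : R) : open_in V -> smooth_on V f ->
  V (ray s) -> is_derive s 1 (fun s => f (ray s)) (vlift (dir s) f).
Proof.
move=> oV hf Vs; have [j dj] := tdom_cover HE b.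
apply: (vliftE HB HE (g := fun s => s *: ve) oV hf Vs dj) => k.
exact: ray_coord.
Qed.

Lemma ray_cont (V : set TE) (f : TE -> R) (s : R) : open_in V -> smooth_on V f ->
  V (ray s) -> {for s, continuous (fun s => f (ray s))}.
Proof. by move=> oV hf Vs; exact: is_derive_cont (ray_derive oV hf Vs). Qed.

Lemma ray_near (V : set TE) (s : R) : open_in V -> V (ray s) ->
  \forall s' \near s, V (ray s').
Proof.
move=> oV Vs; have [j dj] := tdom_cover HE b.
apply: (fiber_curve_near HB HE (g := fun s => s *: ve) oV Vs dj) => k.
exact: is_derive_cont (ray_coord s k dj).
Qed.

(** A pullback section is constant on the fibre, so the one through ve supplies the direction ve at
    every point of the ray. *)
Lemma dir_nabla_smooth (r : sect F) : smooth_sect r ->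
  exists2 r' : sect F, smooth_sect r' & forall s, r' (ray s) = nabla (dir s) r.
Proof.
move=> hr; have [S [hS Sb]] := sect_through HB HE ve.
exists (fun y => nabla (pull_sect S y) r).
  by apply: (conn_smooth hc) => //; exact: (pull_smooth HB HE).
by move=> s; rewrite /pull_sect /= Sb.
Qed.

Definition conn_coef (s : R) (j k : 'I_m) : R := c k (nabla (dir s) (e j)).

Definition drift (s : R) (j k : 'I_m) : R :=
  vlift (dir s) (fun y => c k (e j y)) - conn_coef s j k.

Lemma conn_coef_cont s j k : W (ray s) ->
  {for s, continuous (fun s => conn_coef s j k)}.
Proof.
move=> Ws; have [r hr rE] := dir_nabla_smooth (coframe_smooth hF j).
have -> : (fun s => conn_coef s j k) = (fun s => c k (r (ray s))).
  by apply/funext => s'; rewrite rE.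
exact: ray_cont (coframe_open hF) (coframe_coef hF k hr) Ws.
Qed.

Lemma vlift_dir_cont (f : TE -> R) s : smooth_on W f -> W (ray s) ->
  {for s, continuous (fun s => vlift (dir s) f)}.
Proof.
move=> hf Ws; have [j dj] := tdom_cover HE b.
exact (vlift_cont HB HE (g := fun s => s *: ve) (u := ve) (coframe_open hF) hf Ws dj
  (fun k => is_derive_cont (ray_coord s k dj))).
Qed.

Lemma drift_cont s j k : W (ray s) -> {for s, continuous (fun s => drift s j k)}.
Proof.
move=> Ws.
have h1 := vlift_dir_cont (coframe_coef hF k (coframe_smooth hF j)) Ws.
exact (continuousB h1 (conn_coef_cont Ws)).
Qed.

(* The e_k may be linearly dependent: the coefficients satisfy z_l = sum_j z_j P_jl
   with P_jl = c_l(e_j), whose derivative is the first term of the drift. *)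
Lemma cov_derivative_coord (I : set R) (t : forall s : R, F (ray s)) (s : R)
    (y : F (ray s)) :
  W (ray s) -> cov_derivative nabla (fun s : R => dir s) I t y ->
  exists z : 'I_m -> R -> R,
    (\forall s' \near s, I s' -> forall k, c k (t s') = z k s') /\
    forall k, is_derive s 1 (z k) (c k y + \sum_j z j s * drift s j k).
Proof.
move=> Ws [n [f [e' [he' df tE ->]]]].
pose z k s' := \sum_j f j s' * c k (e' j (ray s')).
pose dc j k := vlift (dir s) (fun y => c k (e' j y)).
have hdc j k : is_derive s 1 (fun s => c k (e' j (ray s))) (dc j k).
  exact: (ray_derive (coframe_open hF) (coframe_coef hF k (he' j)) Ws).
have hdf j : is_derive s 1 (f j) (derive1 (f j) s).
  by rewrite derive1E; exact: derivableP.
pose dz k := \sum_j (derive1 (f j) s * c k (e' j (ray s)) + f j s * dc j k).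
have hdz k : is_derive s 1 (z k) (dz k).
  by apply: is_derive_sumr => j _; exact: is_derive_mul.
exists z; split.
  apply: filterS tE => s' tE Is' k; rewrite tE // (coframe_sum hF).
  by apply: eq_bigr => j _; rewrite (coframeZ hF).
move=> l.
pose P s k := c l (e k (ray s)).
have hP k : is_derive s 1 (fun s => P s k) (vlift (dir s) (fun y => c l (e k y))).
  exact: (ray_derive (coframe_open hF) (coframe_coef hF l (coframe_smooth hF k)) Ws).
have zE s' : W (ray s') -> \sum_k z k s' * P s' k = z l s'.
  move=> Ws'; under eq_bigr do rewrite mulr_suml.
  rewrite exchange_big; apply: eq_bigr => j _ /=.
  under eq_bigr do rewrite -mulrA.
  rewrite -mulr_sumr; congr (_ * _).
  rewrite [in RHS](coframe_decomp hF Ws' (e' j _)) (coframe_sum hF).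
  by apply: eq_bigr => k _; rewrite (coframeZ hF).
have H : is_derive s 1 (z l)
    (\sum_k (dz k * P s k + z k s * vlift (dir s) (fun y => c l (e k y)))).
  have H1 : is_derive s 1 (fun s' => \sum_k z k s' * P s' k)
      (\sum_k (dz k * P s k + z k s * vlift (dir s) (fun y => c l (e k y)))).
    by apply: is_derive_sumr => k _; exact: is_derive_mul.
  apply: near_eq_is_derive H1.
  by apply: filterS (ray_near (coframe_open hF) Ws) => s' Ws'; exact: zE.
(* The coordinates of the covariant derivative: [nabla_expand] is applied to each e'_j, and P turns
   coefficients over the e_k into values of c_l. *)
have key : \sum_k dz k * P s k + \sum_k z k s * conn_coef s k l =
    c l (\sum_j (derive1 (f j) s *: e' j (ray s) + f j s *: nabla (dir s) (e' j))).
  rewrite (coframe_sum hF) -big_split /=.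
  under eq_bigr => k _ do rewrite !mulr_suml -big_split /=.
  rewrite exchange_big; apply: eq_bigr => j _ /=.
  rewrite (coframeD hF) !(coframeZ hF) (nabla_expand _ Ws (he' j)).
  have -> : c l (e' j (ray s)) = \sum_k c k (e' j (ray s)) * P s k.
    rewrite [in LHS](coframe_decomp hF Ws (e' j _)) (coframe_sum hF).
    by apply: eq_bigr => k _; rewrite (coframeZ hF).
  rewrite (coframe_sum hF) !mulr_sumr.
  rewrite -big_split; apply: eq_bigr => k _ /=.
  by rewrite (coframeD hF) !(coframeZ hF) /P /conn_coef /dc; ring.
apply: is_derive_eq H _; rewrite big_split /= -key /drift.
under [X in _ = _ + X]eq_bigr do rewrite mulrBr.
by rewrite sumrB; ring.
Qed.

(** Both sides are covariant derivatives of the same curve of vectors, for two presentations of it;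
    [cov_derivative_coord] shows that their coordinates agree. *)
Lemma nabla_ray (r : sect F) (n : nat) (f : 'I_n -> R -> R) (df : 'I_n -> R)
    (e' : 'I_n -> sect F) (s : R) : W (ray s) -> smooth_sect r ->
  (forall j, smooth_sect (e' j)) -> (forall j, is_derive s 1 (f j) (df j)) ->
  (\forall s' \near s, r (ray s') = \sum_j f j s' *: e' j (ray s')) ->
  nabla (dir s) r = \sum_j (df j *: e' j (ray s) + f j s *: nabla (dir s) (e' j)).
Proof.
move=> Ws hr he' hf rE; set y := \sum_j _.
have D1 : cov_derivative nabla (fun s : R => dir s) setT (fun s => r (ray s))
    (nabla (dir s) r).
  exists 1%N, (fun _ _ => 1), (fun=> r); split=> //.
  - near=> s'; move=> _; by rewrite big_ord1 scale1r.
  - by rewrite big_ord1 scale1r derive1_cst scale0r add0r.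
have D2 : cov_derivative nabla (fun s : R => dir s) setT (fun s => r (ray s)) y.
  exists n, f, e'; split=> //.
  - by apply: filterS rE => s' ->.
  - by apply: eq_bigr => j _; rewrite derive1E (@derive_val _ _ _ _ _ _ _ (hf j)).
have [z1 [e1 d1]] := cov_derivative_coord Ws D1.
have [z2 [e2 d2]] := cov_derivative_coord Ws D2.
have zz : \forall s' \near s, forall k, z1 k s' = z2 k s'.
  move: e1 e2; apply: filterS2 => s' e1 e2 k.
  by rewrite -(e1 Logic.I) -(e2 Logic.I).
have zs k : z1 k s = z2 k s by have /nbhs_singleton := zz; exact.
apply: (coframe_inj hF Ws) => k.
have d12 : is_derive s 1 (z2 k) (c k (nabla (dir s) r) + \sum_j z1 j s * drift s j k).
  by apply: near_eq_is_derive (d1 k); apply: filterS zz => s' ->.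
have := etrans (esym (@derive_val _ _ _ _ _ _ _ d12)) (@derive_val _ _ _ _ _ _ _ (d2 k)).
by under eq_bigr do rewrite zs; move/addIr.
Unshelve. all: by end_near. Qed.

Context (hW : forall s : R, 0 <= s <= 1 -> W (ray s)).

Lemma parallel_unique (t : R) (x y : forall s : R, F (ray s)) : 0 <= t <= 1 ->
  parallel nabla (fun s : R => dir s) `[t, 1] x ->
  parallel nabla (fun s : R => dir s) `[t, 1] y ->
  (forall k, c k (x t) = c k (y t)) -> forall k, c k (x 1) = c k (y 1).
Proof.
move=> /andP[t0 t1] px py xy k.
have tW s : t <= s <= 1 -> W (ray s).
  by move=> /andP[ts s1]; apply: hW; rewrite s1 (le_trans t0 ts).
have [C hC] : exists C : R, forall s j l, `|drift (clamp 1 s) j l| <= C.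
  have cd (jl : 'I_m * 'I_m) s : 0 <= s <= 1 ->
    {for s, continuous (fun s => drift s jl.1 jl.2)}.
    by move=> s01; apply: drift_cont; exact: hW.
  have [C hC] := choice (fun jl => bounded_clamp ler01 (cd jl)).
  exists (\sum_jl `|C jl|) => s j l; apply: le_trans (hC (j, l) s) _.
  rewrite (bigD1 (j, l)) //= (le_trans (ler_norm _)) // lerDl.
  by apply: sumr_ge0 => jl _.
have [Q [Q0 hQ]] := gronwall 'I_m (normr_ge0 C) (@ler01 R).
pose d (s : R) (k : 'I_m) := c k (x s) - c k (y s).
(* Nothing is known about x and y outside [t, 1], so near each s the function d is replaced by
   differentiable functions that agree with it inside the interval. *)
have dz s : t <= s <= 1 -> exists z : 'I_m -> R -> R,
    (\forall s' \near s, t <= s' <= 1 -> forall k, d s' k = z k s') /\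
    forall k, is_derive s 1 (z k) (\sum_j d s j * drift s j k).
  move=> ts; have I_s : `[t, 1]%classic s by rewrite /= in_itv.
  have [z1 [e1 d1]] := cov_derivative_coord (tW s ts) (px s I_s).
  have [z2 [e2 d2]] := cov_derivative_coord (tW s ts) (py s I_s).
  exists (fun k s => z1 k s - z2 k s).
  have dE : \forall s' \near s, t <= s' <= 1 -> forall k, d s' k = z1 k s' - z2 k s'.
    move: e1 e2; apply: filterS2 => s' e1 e2 ts' l.
    by rewrite /d e1 ?e2 //= in_itv.
  split=> // l; apply: is_derive_eq.
  have Es j : d s j = z1 j s - z2 j s by have /nbhs_singleton := dE; exact.
  rewrite (coframe0 hF) !add0r -sumrB; apply: eq_bigr => j _.
  by rewrite -mulrBl Es.
have := hQ t 1 0 d (fun _ _ => 0) drift t1 _ (lexx 0) _ _ _ _ _ 1 k.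
rewrite mulr0 => H; apply/eqP; rewrite -subr_eq0 -normr_le0; apply: H.
- by rewrite lerBlDr lerDl.
- move=> l; apply: within_continuous_near => s ts; have [z [ze dz']] := dz s ts.
  exists (z l); first exact: is_derive_cont (dz' l).
  by apply: filterS ze => s' ze ts'; rewrite ze.
- move=> s /andP[ts s1] l.
  have [z [ze dz']] := dz s (introT andP (conj (ltW ts) (ltW s1))).
  apply: is_derive_eq; first apply: near_eq_is_derive (dz' l).
    have ns : \forall s' \near s, t < s' < 1.
      have := @near_in_itvoo R t 1 s; rewrite in_itv /= ts s1 => /(_ isT).
      by apply: filterS => q; rewrite in_itv.
    move: ze ns; apply: filterS2 => s' ze /andP[h1 h2].
    by rewrite ze // !ltW.
  by rewrite addr0.
- move=> s /andP[ts s1] j l.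
  rewrite -(@clamp_id _ 1 s) ?(ltW s1) ?(le_trans t0 (ltW ts)) //.
  exact: le_trans (hC _ _ _) (ler_norm _).
- by move=> s _ l; rewrite normr0.
- by move=> l; rewrite /d xy subrr normr0.
- by rewrite t1 lexx.
Qed.

End Rays.

(** f plays the integrand containing 1/t, and g its continuous extension to t = 0; the value at 0 is
    immaterial for the integral. *)
Lemma Rintegral_primitive (R : realType) (f g G : R -> R) :
  (forall s : R, 0 <= s <= 1 -> {for s, continuous g}) ->
  (forall s : R, 0 <= s <= 1 -> is_derive s 1 G (g s)) ->
  (forall s : R, 0 < s <= 1 -> f s = g s) ->
  \int[@lebesgue_measure R]_(t in `]0, 1]) f t = G 1 - G 0.
Proof.
move=> cg dG fg; pose h s := g (clamp 1 s).
have ch : continuous h by exact: continuous_clamp ler01 cg.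
have ih := continuous_integrable 0 1 ch.
transitivity (\int[@lebesgue_measure R]_(t in `]0, 1]) h t).
  apply: eq_Rintegral => s; rewrite inE /= in_itv /= => /andP[s0 s1].
  by rewrite fg ?s0 // /h clamp_id // (ltW s0).
rewrite Rintegral_itv_obnd_cbnd; last first.
  by apply: integrableS ih => //; exact: subset_itv_oc_cc.
have cG s : 0 <= s <= 1 -> {for s, continuous G}.
  by move=> s01; exact: is_derive_cont (dG s s01).
rewrite /Rintegral (@continuous_FTC2 _ h G) //.
- exact: continuous_subspaceT.
- split=> [s||].
  + by rewrite in_itv /= => /andP[s0 s1]; have [] := dG s; rewrite ?ltW.
  + by apply: cvg_at_right_filter; apply: cG; rewrite lexx ler01.
  + by apply: cvg_at_left_filter; apply: cG; rewrite lexx ler01.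
- move=> s; rewrite in_itv /= => /andP[s0 s1].
  have s01 : 0 <= s <= 1 by rewrite !ltW.
  by rewrite derive1E (@derive_val _ _ _ _ _ _ _ (dG s s01)) /h clamp_id.
Qed.

Section Transport.
Context (R : realType) (B : atlas R) (HB : is_premanifold B).
Context (E : prebundle B) (HE : is_vbundle E).
Let TE := total_space E.
Let HT : is_premanifold TE := total_space_pre HB HE.
Context (F : prebundle TE) (HF : is_vbundle F).
Context (nabla : forall v : TE, pullE E v -> sect F -> F v).
Context (hc : is_connection (@vlift R B E) nabla).

Lemma dilate1 (v : TE) : dilate 1 v = v.
Proof. by case: v => b ve; rewrite /dilate scale1r. Qed.

Lemma dilate_dilate (s t : R) (v : TE) : dilate s (dilate t v) = dilate (s * t) v.
Proof. by rewrite /dilate /= scalerA. Qed.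

Section Lincomb.
Context (m : nat) (e : 'I_m -> sect F).

Definition lincomb (y : TE) (x : 'I_m -> R) : F y := \sum_k x k *: e k y.

Lemma lincomb_lin (y : TE) (a : R) (x x' : 'I_m -> R) :
  lincomb y (fun k => a * x k + x' k) = a *: lincomb y x + lincomb y x'.
Proof.
rewrite /lincomb scaler_sumr -big_split; apply: eq_bigr => k _ /=.
by rewrite scalerDl scalerA.
Qed.

Lemma lincombZ (y : TE) (a : R) (x : 'I_m -> R) :
  lincomb y (fun k => a * x k) = a *: lincomb y x.
Proof. by rewrite /lincomb scaler_sumr; under [RHS]eq_bigr do rewrite scalerA. Qed.

Lemma lincomb0 (y : TE) : lincomb y (fun=> 0) = 0.
Proof. by rewrite /lincomb big1 // => k _; rewrite scale0r. Qed.

Lemma tpt_lincomb (y y' : TE) (x : 'I_m -> R) : y = y' ->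
  tpt (lincomb y x) = tpt (lincomb y' x).
Proof. by move=> ->. Qed.

End Lincomb.

Context (W : set TE) (m : nat) (e : 'I_m -> sect F).
Context (c : 'I_m -> forall y, F y -> R) (hF : is_coframe W e c).

Lemma tpt_coord (y y' : TE) (z : F y) (z' : F y') k : tpt z = tpt z' ->
  c k z = c k z'.
Proof.
by move=> zz'; have := congr1 (fun p : total_space F => c k (projT2 p)) zz'.
Qed.

Context (b : B) (ve : E b).
Notation ray s := (dilate s (tpt ve)).
Notation dir s := (ve : pullE E (ray s)).
Notation G := (conn_coef nabla e c ve).
Context (hW : forall s : R, 0 <= s <= 1 -> W (ray s)).

Lemma coframe_dom1 : W (tpt ve).
Proof. by rewrite -[tpt ve]dilate1; apply: hW; rewrite ler01 lexx. Qed.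

(** [transport] chooses some end value; [parallel_unique] shows that any parallel section with the
    right start gives the same one. *)
Lemma transport_parallel (t : R) (x : forall s : R, F (ray s)) (z : F (tpt ve)) :
  0 <= t <= 1 -> parallel nabla (fun s : R => dir s) `[t, 1] x ->
  tpt (x 1) = tpt z -> transport nabla t (tpt ve) (tpt (x t)) = z.
Proof.
move=> t01 px xz; rewrite /transport; set S := (X in xget _ X).
have Sz : S z by exists x.
have [y [py yx yz]] : S (xget 0 S) by exact: xgetPex (ex_intro _ _ Sz).
apply: (coframe_inj hF coframe_dom1) => k.
rewrite -(tpt_coord k yz) -(tpt_coord k xz).
apply: (parallel_unique HB HE HF hc hF hW t01 py px) => l.
exact: tpt_coord.
Qed.

(** The equation on coefficients is sufficient even if the e_k are dependent. This is how parallel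
    sections are shown to exist. *)
Lemma lincomb_parallel (t : R) (x : R -> 'I_m -> R) : 0 <= t ->
  (forall s : R, t <= s <= 1 -> forall k,
    is_derive s 1 (fun s => x s k) (- \sum_j x s j * G s j k)) ->
  parallel nabla (fun s : R => dir s) `[t, 1] (fun s => lincomb e (ray s) (x s)).
Proof.
move=> t0 hx s; rewrite /= in_itv /= => ts.
have Ws : W (ray s).
  by apply: hW; case/andP: ts => ts ->; rewrite (le_trans t0 ts).
exists m, (fun k s => x s k), e; split.
- exact: (coframe_smooth hF).
- by move=> k; have [] := hx s ts k.
- by near=> s'.
- rewrite big_split /=.
  have -> : \sum_j x s j *: nabla (dir s) (e j) =
      \sum_k (\sum_j x s j * G s j k) *: e k (ray s).
    under [RHS]eq_bigr do rewrite scaler_suml.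
    rewrite exchange_big; apply: eq_bigr => j _ /=.
    rewrite {1}(coframe_decomp hF Ws (nabla _ _)) scaler_sumr.
    by apply: eq_bigr => k _; rewrite scalerA.
  rewrite -big_split big1 // => k _ /=.
  by rewrite derive1E (@derive_val _ _ _ _ _ _ _ (hx s ts k)) scaleNr addNr.
Unshelve. all: by end_near. Qed.

(** Phi s sends coefficients at time s to coefficients at time 1. It equals V(s) Z(1), where Z' = -
    Z G and V' = G V start at the identity; V is the inverse of Z because the derivative of Z V
    vanishes. *)
Lemma ray_transport : exists Phi : R -> 'M[R]_m,
  [/\ Phi 1 = 1%:M,
      forall (s : R) j k, 0 <= s <= 1 ->
        is_derive s 1 (fun s => Phi s j k) (\sum_l G s j l * Phi s l k)
    & forall (s : R) (a : 'I_m -> R), 0 <= s <= 1 ->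
        transport nabla s (tpt ve) (tpt (lincomb e (ray s) a)) =
        lincomb e (tpt ve) (fun k => \sum_j a j * Phi s j k)].
Proof.
have cG (s : R) : 0 <= s <= 1 -> forall j k, {for s, continuous (fun s => G s j k)}.
  by move=> s01 j k; exact (conn_coef_cont HB HE hc hF (j := j) (k := k) (hW s01)).
have cG' (s : R) : 0 <= s <= 1 -> forall j k, {for s, continuous (fun s => - G s j k)}.
  by move=> s01 j k; exact (continuousN (cG s s01 j k)).
have c0 (s : R) : 0 <= s <= 1 -> 'I_m -> {for s, continuous (fun _ : R => 0 : R)}.
  by move=> _ _; exact: cvg_cst.
have [z hz] := choice (fun j : 'I_m => affine_ode_exists
  (A := fun s j k => - G s j k) (b := fun _ _ => 0) (fun k => (j == k)%:R) ler01 cG' c0).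
(* G acts on the left in the equation for V, so V is solved by columns with the transposed matrix,
   whereas Z is solved by rows. *)
have [v hv] := choice (fun k : 'I_m => affine_ode_exists
  (A := fun s j k => G s k j) (b := fun _ _ => 0) (fun j => (j == k)%:R) ler01
  (fun s s01 j k => cG s s01 k j) c0).
pose Z s : 'M[R]_m := \matrix_(j, k) z j s k.
pose V s : 'M[R]_m := \matrix_(j, k) v k s j.
have dZ (s : R) j k : 0 <= s <= 1 ->
    is_derive s 1 (fun s => Z s j k) (- \sum_l Z s j l * G s l k).
  move=> s01; have -> : (fun s => Z s j k) = (fun s => z j s k).
    by apply/funext => s'; rewrite mxE.
  apply: is_derive_eq ((hz j).2 s k s01) _; rewrite addr0 -sumrN.
  by apply: eq_bigr => l _; rewrite mxE mulrN.
have dV (s : R) j k : 0 <= s <= 1 ->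
    is_derive s 1 (fun s => V s j k) (\sum_l G s j l * V s l k).
  move=> s01; have -> : (fun s => V s j k) = (fun s => v k s j).
    by apply/funext => s'; rewrite mxE.
  apply: is_derive_eq ((hv k).2 s j s01) _; rewrite addr0.
  by apply: eq_bigr => l _; rewrite mxE mulrC.
have Z0 : Z 0 = 1%:M by apply/matrixP => j k; rewrite !mxE (hz j).1.
have V0 : V 0 = 1%:M by apply/matrixP => j k; rewrite !mxE (hv k).1.
have ZV (s : R) : 0 <= s <= 1 -> Z s *m V s = 1%:M.
  move=> /andP[s0 s1]; rewrite -[RHS]mulmx1 -{1}Z0 -V0; apply/matrixP => j k.
  apply: (derive0_const (f := fun s => (Z s *m V s) j k) s0) => r /andP[r0 rs].
  have r01 : 0 <= r <= 1 by rewrite r0 (le_trans rs s1).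
  have -> : (fun s => (Z s *m V s) j k) = (fun s => \sum_l Z s j l * V s l k).
    by apply/funext => s'; rewrite mxE.
  apply: is_derive_eq.
    by apply: is_derive_sumr => l _; exact: is_derive_mul (dZ r j l r01) (dV r l k r01).
  rewrite big_split /=; apply/eqP; rewrite addr_eq0; apply/eqP.
  under eq_bigr do rewrite mulNr mulr_suml.
  rewrite sumrN exchange_big; congr (- _); apply: eq_bigr => l _ /=.
  by rewrite mulr_sumr; apply: eq_bigr => q _; rewrite mulrA.
exists (fun s => V s *m Z 1); split.
- by apply: mulmx1C; apply: ZV; rewrite ler01 lexx.
- move=> s j k s01.
  have -> : (fun s => (V s *m Z 1) j k) = (fun s => \sum_l V s j l * Z 1 l k).
    by apply/funext => s'; rewrite mxE.
  apply: is_derive_eq.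
    by apply: is_derive_sumr => l _; exact: is_derive_mul (dV s j l s01) (is_derive_cst _ _ _).
  under [RHS]eq_bigr do rewrite mxE mulr_sumr.
  rewrite [RHS]exchange_big; apply: eq_bigr => l _ /=.
  by rewrite mulr0 addr0 mulr_suml; apply: eq_bigr => q _; rewrite mulrA.
- move=> t a t01; have /andP[t0 t1] := t01.
  (* The coefficient curve a V(t) Z(s): it is a at time t and a Phi(t) at time 1. *)
  pose y l := \sum_j a j * V t j l; pose x s k := \sum_l y l * Z s l k.
  have xE s k : x s k = \sum_j a j * (V t *m Z s) j k.
    rewrite /x /y; under eq_bigr do rewrite mulr_suml.
    rewrite exchange_big; apply: eq_bigr => j _ /=.
    by rewrite mxE mulr_sumr; apply: eq_bigr => l _; rewrite mulrA.
  have xt : x t = a.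
    apply/funext => k; rewrite xE (mulmx1C (ZV t t01)) (bigD1 k) //= mxE eqxx mulr1.
    by rewrite big1 ?addr0 // => j /negbTE jk; rewrite mxE jk mulr0.
  rewrite -{1}xt; apply: (transport_parallel (x := fun s => lincomb e (ray s) (x s)) t01).
    apply: lincomb_parallel => // s /andP[ts s1] k.
    have s01 : 0 <= s <= 1 by rewrite s1 (le_trans t0 ts).
    apply: is_derive_eq.
      apply: is_derive_sumr => l _.
      exact: is_derive_mul (is_derive_cst _ _ _) (dZ s l k s01).
    rewrite /x; under [in RHS]eq_bigr do rewrite mulr_suml.
    rewrite [in RHS]exchange_big -sumrN; apply: eq_bigr => l _ /=.
    rewrite mul0r add0r mulrN mulr_sumr; congr (- _).
    by apply: eq_bigr => q _; rewrite mulrA.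
  rewrite (tpt_lincomb _ _ (dilate1 (tpt ve))); congr (tpt (lincomb _ _ _)).
  by apply/funext => k; rewrite xE.
Qed.

End Transport.

(** * The homotopy operator *)

Section HomotopyFormula.
Context (R : realType) (B : atlas R) (HB : is_premanifold B).
Context (E : prebundle B) (HE : is_vbundle E).
Let TE := total_space E.
Let HT : is_premanifold TE := total_space_pre HB HE.
Let HA : is_vbundle (pullE E) := pullE_vbundle HB HE.
Context (F : prebundle TE) (HF : is_vbundle F).
Context (nabla : forall v : TE, pullE E v -> sect F -> F v).
Context (hc : is_connection (@vlift R B E) nabla).
Context (W : set TE) (m : nat) (e : 'I_m -> sect F).
Context (c : 'I_m -> forall y, F y -> R) (hF : is_coframe W e c).
Context (b : B) (ve : E b).
Notation ray s := (dilate s (tpt ve)).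
Notation dir s := (ve : pullE E (ray s)).
Notation G := (conn_coef nabla e c ve).

Definition form_coef k (w : preform (pullE E) F k) (u : 'I_k -> E b) (s : R)
    (l : 'I_m) : R :=
  c l (w (ray s) (u : 'I_k -> pullE E (ray s))).

Lemma form_coef_cont k (w : preform (pullE E) F k) (u : 'I_k -> E b) s l :
  is_form w -> W (ray s) -> {for s, continuous (fun s => form_coef w u s l)}.
Proof.
move=> hw Ws; have [S hS] := choice (fun i => sect_through HB HE (u i)).
have uE : u = (fun i => S i b) by apply/funext => i; case: (hS i).
have hs : smooth_sect (fun y : TE => w y (fun i => S i (bproj y) : pullE E y)).
  apply: (form_sect_smooth HT HA HF hw (s := fun i => pull_sect (S i))) => i.
  by apply: (pull_smooth HB HE); case: (hS i).
rewrite /form_coef uE.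
exact: (ray_cont HB HE (coframe_open hF) (coframe_coef hF l hs) Ws).
Qed.

Context (hW : forall s : R, 0 <= s <= 1 -> W (ray s)).

Lemma vcoord_lincomb i (x : 'I_m -> R) :
  vcoord i (lincomb e (tpt ve) x) = \sum_k x k * vcoord i (e k (tpt ve)).
Proof.
rewrite /vcoord /lincomb linear_sum; apply: eq_bigr => k _.
by rewrite linearZ.
Qed.

Lemma vcoord_sum (V : vectType R) (z : V) :
  \sum_i vcoord i z *: (vbasis {:V})`_i = z.
Proof. by rewrite -(coord_vbasis (memvf z)). Qed.

Section Fundamental.
Context (Phi : R -> 'M[R]_m).
Context (Phi1 : Phi 1 = 1%:M).
Context (dPhi : forall (s : R) j k, 0 <= s <= 1 ->
  is_derive s 1 (fun s => Phi s j k) (\sum_l G s j l * Phi s l k)).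
Context (hPhi : forall (s : R) (a : 'I_m -> R), 0 <= s <= 1 ->
  transport nabla s (tpt ve) (tpt (lincomb e (ray s) a)) =
  lincomb e (tpt ve) (fun k => \sum_j a j * Phi s j k)).

Lemma transport_form k (w : preform (pullE E) F k) (u : 'I_k -> E b) (s : R) :
  0 <= s <= 1 ->
  transport nabla s (tpt ve) (tpt (w (ray s) (u : 'I_k -> pullE E (ray s)))) =
  lincomb e (tpt ve) (fun l => \sum_j form_coef w u s j * Phi s j l).
Proof.
move=> s01; rewrite -hPhi //; congr (transport _ _ _ (tpt _)).
exact: (coframe_decomp hF (hW s01)).
Qed.

Lemma insert_eulerE k (w : preform (pullE E) F k.+1) (u : 'I_k -> E b) s :
  is_form w -> insert_euler w (u : 'I_k -> pullE E (ray s)) =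
  s *: w (ray s) (ocons (dir s) (u : 'I_k -> pullE E (ray s))).
Proof.
move=> hw; rewrite -(ocons_upd0 0 (dir s)) -(form_updZ hw) ocons_upd0.
by [].
Qed.

(** The Euler section at s v is s times v, and this factor s cancels 1/s. *)
Lemma homotopy_integrand k (w : preform (pullE E) F k.+1) (u : 'I_k -> E b) (s : R) :
  is_form w -> 0 < s <= 1 ->
  s^-1 *: Psi nabla s (insert_euler w) (u : 'I_k -> pullE E (tpt ve)) =
  lincomb e (tpt ve)
    (fun l => s ^+ k * \sum_j form_coef w (ocons ve u) s j * Phi s j l).
Proof.
move=> hw /andP[s0 s1]; have s01 : 0 <= s <= 1 by rewrite ltW.
rewrite /Psi insert_eulerE // scalerA.
have -> : s *: w (ray s) (ocons (dir s) (u : 'I_k -> pullE E (ray s))) =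
    lincomb e (ray s) (fun j => s * form_coef w (ocons ve u) s j).
  by rewrite lincombZ; congr (_ *: _); exact: (coframe_decomp hF (hW s01)).
rewrite hPhi // -lincombZ; congr lincomb; apply/funext => l.
under eq_bigr do rewrite -mulrA.
rewrite -mulr_sumr mulrA; congr (_ * _).
by rewrite mulrAC mulVf ?mul1r // gt_eqF.
Qed.

Lemma homotopy_solution k (w : preform (pullE E) F k.+1) (u : 'I_k -> E b)
    (x : R -> 'I_m -> R) : is_form w -> (forall l, x 0 l = 0) ->
  (forall (s : R) l, 0 <= s <= 1 -> is_derive s 1 (fun s => x s l)
    (- (\sum_j x s j * G s j l) + s ^+ k * form_coef w (ocons ve u) s l)) ->
  homotopy nabla w (u : 'I_k -> pullE E (tpt ve)) = lincomb e (tpt ve) (x 1).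
Proof.
move=> hw x0 hx; rewrite /homotopy /vint -[RHS]vcoord_sum; apply: eq_bigr => i _.
congr (_ *: _).
(* Variation of constants: y = x Phi is a primitive of the integrand q, with y(0) = 0 and y(1) =
   x(1). *)
pose y s l := \sum_j x s j * Phi s j l.
pose q s l := s ^+ k * \sum_j form_coef w (ocons ve u) s j * Phi s j l.
have dy (s : R) l : 0 <= s <= 1 -> is_derive s 1 (fun s => y s l) (q s l).
  move=> s01; apply: is_derive_eq.
    by apply: is_derive_sumr => j _; exact: is_derive_mul (hx s j s01) (dPhi j l s01).
  rewrite big_split /= /q; under eq_bigr do rewrite mulrDl mulNr mulr_suml.
  rewrite big_split /= sumrN exchange_big /= mulr_sumr.
  rewrite addrAC (_ : - _ + _ = 0) ?add0r.
    by apply: eq_bigr => j _; rewrite mulrA.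
  apply/eqP; rewrite addrC subr_eq0; apply/eqP; apply: eq_bigr => j _.
  by rewrite mulr_sumr; apply: eq_bigr => r _; rewrite mulrA.
transitivity (vcoord i (lincomb e (tpt ve) (y 1)) - vcoord i (lincomb e (tpt ve) (y 0))); last first.
  have -> : y 0 = fun=> 0.
    by apply/funext => l; rewrite /y big1 // => j _; rewrite x0 mul0r.
  rewrite lincomb0 {2}/vcoord linear0 subr0; congr (vcoord i (lincomb _ _ _)).
  apply/funext => l; rewrite /y Phi1 (bigD1 l) //= mxE eqxx mulr1 big1 ?addr0 //.
  by move=> j /negbTE jl; rewrite mxE jl mulr0.
apply: (@Rintegral_primitive _ _ (fun s => vcoord i (lincomb e (tpt ve) (q s)))
  (fun s => vcoord i (lincomb e (tpt ve) (y s)))).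
- move=> s s01; have -> : (fun s => vcoord i (lincomb e (tpt ve) (q s))) =
    (fun s => \sum_l q s l * vcoord i (e l (tpt ve))).
    by apply/funext => s'; rewrite vcoord_lincomb.
  apply: continuous_sumr => l _.
  have cq : {for s, continuous (fun s => q s l)}.
    have cs : {for s, continuous (fun s : R => s ^+ k)} by exact: exprn_continuous.
    apply (continuousM cs); apply: continuous_sumr => j _.
    exact (continuousM (form_coef_cont (l := j) hw (hW s01)) (is_derive_cont (dPhi j l s01))).
  exact (continuousM cq (@cst_continuous _ _ _ _)).
- move=> s s01; rewrite vcoord_lincomb.
  have -> : (fun s => vcoord i (lincomb e (tpt ve) (y s))) =
    (fun s => \sum_l y s l * vcoord i (e l (tpt ve))).
    by apply/funext => s'; rewrite vcoord_lincomb.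
  apply: is_derive_eq.
    by apply: is_derive_sumr => l _; exact: is_derive_mul (dy s l s01) (is_derive_cst _ _ _).
  by apply: eq_bigr => l _; rewrite mulr0 addr0.
- by move=> s s01; rewrite homotopy_integrand.
Qed.

End Fundamental.

Lemma homotopyE k (w : preform (pullE E) F k.+1) (u : 'I_k -> E b)
    (x : R -> 'I_m -> R) : is_form w -> (forall l, x 0 l = 0) ->
  (forall (s : R) l, 0 <= s <= 1 -> is_derive s 1 (fun s => x s l)
    (- (\sum_j x s j * G s j l) + s ^+ k * form_coef w (ocons ve u) s l)) ->
  homotopy nabla w (u : 'I_k -> pullE E (tpt ve)) = lincomb e (tpt ve) (x 1).
Proof.
have [Phi [h1 h2 h3]] := ray_transport HB HE HF hc hF hW.
exact: homotopy_solution h1 h2 h3 _ _ _ _.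
Qed.

Lemma homotopy_ode T k (w : preform (pullE E) F k.+1) (u : 'I_k -> E b) :
  is_form w -> 0 <= T -> (forall s : R, 0 <= s <= T -> W (ray s)) ->
  exists x : R -> 'I_m -> R, (forall l, x 0 l = 0) /\
    forall (s : R) l, 0 <= s <= T -> is_derive s 1 (fun s => x s l)
      (- (\sum_j x s j * G s j l) + s ^+ k * form_coef w (ocons ve u) s l).
Proof.
move=> hw T0 hT.
have [||x [x0 hx]] := affine_ode_exists (A := fun s j l => - G s j l)
  (b := fun s l => s ^+ k * form_coef w (ocons ve u) s l) (fun=> 0) T0.
- move=> s sT j l; have := @conn_coef_cont _ _ HB _ HE _ _ hc _ _ _ _ hF b ve s j l (hT s sT).
  exact: continuousN.
- move=> s sT l; have cs : {for s, continuous (fun s : R => s ^+ k)}.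
    exact: exprn_continuous.
  exact (continuousM cs (form_coef_cont (l := l) hw (hT s sT))).
exists x; split=> // s l sT; apply: is_derive_eq (hx s l sT) _.
by rewrite -sumrN; congr (_ + _); apply: eq_bigr => j _; rewrite mulrN.
Qed.

(** Through Phi the transported values are continuous in t on [0, 1], so the limit is the value at
    0. The factor [0 ^+ k] is 1 for k = 0 and 0 otherwise. *)
Lemma Psi_limit k (w : preform (pullE E) F k) (u : 'I_k -> E b) : is_form w ->
  is_cvg0 (fun t => Psi nabla t w (u : 'I_k -> pullE E (tpt ve))) /\
  Psi0 nabla w (u : 'I_k -> pullE E (tpt ve)) =
  0 ^+ k *: transport nabla 0 (tpt ve) (tpt (w (ray 0) (u : 'I_k -> pullE E (ray 0)))).
Proof.
move=> hw; have [Phi [_ dPhi hPhi]] := ray_transport HB HE HF hc hF hW.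
have tE s := transport_form hPhi w u (s := s).
have s00 : 0 <= (0 : R) <= 1 by rewrite lexx ler01.
pose q s l := s ^+ k * \sum_j form_coef w u s j * Phi s j l.
have L i : vcoord i (Psi nabla t w (u : 'I_k -> pullE E (tpt ve))) @[t --> 0^'+] -->
    vcoord i (0 ^+ k *: transport nabla 0 (tpt ve)
      (tpt (w (ray 0) (u : 'I_k -> pullE E (ray 0))))).
  rewrite tE // -lincombZ vcoord_lincomb.
  have cq : {for 0, continuous (fun s => \sum_l q s l * vcoord i (e l (tpt ve)))}.
    apply: continuous_sumr => l _.
    have cq : {for 0, continuous (fun s => q s l)}.
      have cs : {for 0, continuous (fun s : R => s ^+ k)} by exact: exprn_continuous.
      apply (continuousM cs); apply: continuous_sumr => j _.
      exact (continuousM (form_coef_cont (l := j) hw (hW s00)) (is_derive_cont (dPhi 0 j l s00))).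
    exact (continuousM cq (@cst_continuous _ _ _ _)).
  have := cvg_at_right_filter cq; apply: cvg_trans; apply: near_eq_cvg.
  near=> s; have s01 : 0 <= s <= 1.
    by apply/andP; split; near: s; [exact: nbhs_right_ge|exact: nbhs_right_le].
  by rewrite /Psi tE // -lincombZ vcoord_lincomb.
split; first by move=> i; apply/cvg_ex; eexists; exact: L.
rewrite /Psi0 /vlim0 -[RHS]vcoord_sum; apply: eq_bigr => i _; congr (_ *: _).
exact: cvg_lim (L i).
Unshelve. all: by end_near. Qed.

End HomotopyFormula.

Section LieDerivative.
Context (R : realType) (B : atlas R) (HB : is_premanifold B).
Context (E : prebundle B) (HE : is_vbundle E).
Let TE := total_space E.
Let HT : is_premanifold TE := total_space_pre HB HE.
Let HA : is_vbundle (pullE E) := pullE_vbundle HB HE.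
Context (F : prebundle TE) (HF : is_vbundle F).
Context (nabla : forall v : TE, pullE E v -> sect F -> F v).
Context (hc : is_connection (@vlift R B E) nabla).

(** The ray is followed up to time 2 because [homotopy_lie] differentiates at v, that is, in a
    two-sided neighbourhood of time 1. *)
Lemma coframe_ray (v : TE) : exists (m : nat) (e : 'I_m -> sect F)
    (c : 'I_m -> forall y, F y -> R) (W : set TE),
  is_coframe W e c /\ forall s : R, 0 <= s <= 2 -> W (dilate s v).
Proof.
case: v => b ve; apply: (coframe_along HT HF) => V s oV Vs.
exact: (ray_near HB HE oV Vs).
Qed.

Lemma unit_itv2 (s : R) : 0 <= s <= 1 -> 0 <= s <= 2.
Proof. by move=> /andP[-> s1]; rewrite (le_trans s1) // ler1n. Qed.

Section Form.
Context (k : nat) (w : preform (pullE E) F k.+1) (hw : is_form w).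
Arguments w : clear implicits.

(** The forcing term is linear in each u i, so the combination of the two solutions solves the
    combined equation; no integral is manipulated. *)
Lemma homotopy_multilinear (v : TE) (u : 'I_k -> pullE E v) i (a : R)
    (z z' : pullE E v) :
  homotopy nabla w (upd u i (a *: z + z')) =
  a *: homotopy nabla w (upd u i z) + homotopy nabla w (upd u i z').
Proof.
have [m [e [c [W [hF hW]]]]] := coframe_ray v.
case: v u z z' hW => b ve u z z' hW.
have hW1 s : 0 <= s <= 1 -> W (dilate s (tpt ve)) by move/unit_itv2; exact: hW.
have [x [x0 hx]] := homotopy_ode HB HE HF hc hF (upd u i z) hw ler01 hW1.
have [y [y0 hy]] := homotopy_ode HB HE HF hc hF (upd u i z') hw ler01 hW1.
rewrite (homotopyE HB HE HF hc hF hW1 hw x0 hx).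
rewrite (homotopyE HB HE HF hc hF hW1 hw y0 hy) -lincomb_lin.
apply: (homotopyE HB HE HF hc hF hW1 (x := fun s l => a * x s l + y s l) hw).
  by move=> l; rewrite x0 y0 mulr0 addr0.
move=> s l s01; apply: is_derive_eq.
  apply: is_derive_add (hy s l s01).
  exact: is_derive_mul (is_derive_cst _ _ _) (hx s l s01).
have -> : form_coef c ve w (ocons ve (upd u i (a *: z + z'))) s l =
    a * form_coef c ve w (ocons ve (upd u i z)) s l +
    form_coef c ve w (ocons ve (upd u i z')) s l.
  rewrite /form_coef -!ocons_updS.
  by rewrite (form_upd hw) (coframe_linear hF).
rewrite mul0r add0r; under [in RHS]eq_bigr do rewrite mulrDl -mulrA.
by rewrite big_split /= -mulr_sumr; ring.
Qed.

(** Without forcing term the zero curve is the solution. Alternation of h w and its vanishing on the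
    zero section both come from here. *)
Lemma homotopy_zero (v : TE) (u : 'I_k -> pullE E v) :
  (forall s : R, w (dilate s v) (ocons (projT2 v) u) = 0) ->
  homotopy nabla w u = 0.
Proof.
have [m [e [c [W [hF hW]]]]] := coframe_ray v.
case: v u hW => b ve u hW w0.
have hW1 s : 0 <= s <= 1 -> W (dilate s (tpt ve)) by move/unit_itv2; exact: hW.
rewrite -[RHS](lincomb0 e (tpt ve)).
apply: (homotopyE HB HE HF hc hF hW1 (x := fun _ _ => 0) hw) => // s l _.
apply: is_derive_eq (is_derive_cst (0 : R) s 1) _.
rewrite big1 => [|j _]; last by rewrite mul0r.
by rewrite /form_coef w0 (coframe0 hF) mulr0 oppr0 addr0.
Qed.

Lemma homotopy_alternating (v : TE) (u : 'I_k -> pullE E v) i j : i != j ->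
  u i = u j -> homotopy nabla w u = 0.
Proof.
move=> ij uij; apply: homotopy_zero => s.
apply: (form_alternating hw (i := lift ord0 i) (j := lift ord0 j)).
  by rewrite (inj_eq (@lift_inj _ ord0)).
by rewrite !oconsS.
Qed.

Lemma homotopy_at_zero (b : B) (u : 'I_k -> E b) :
  homotopy nabla w (u : 'I_k -> pullE E (tpt (0 : E b))) = 0.
Proof.
apply: homotopy_zero => s; apply: (form_zero_slot hw (i := ord0)).
by rewrite ocons0.
Qed.

Lemma conn_coef_scale m (e : 'I_m -> sect F) (c : 'I_m -> forall y, F y -> R)
    (W : set TE) (b : B) (ve : E b) (a s : R) j l : is_coframe W e c ->
  conn_coef nabla e c (a *: ve) s j l = a * conn_coef nabla e c ve (s * a) j l.
Proof.
move=> hF; rewrite /conn_coef /dilate /= scalerA.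
by rewrite (nabla_dirZ hc) ?(coframeZ hF) //; exact: (coframe_smooth hF).
Qed.

Lemma form_coef_scale m (e : 'I_m -> sect F) (c : 'I_m -> forall y, F y -> R)
    (W : set TE) (b : B) (ve : E b) (u : 'I_k -> E b) (a s : R) l :
  is_coframe W e c ->
  form_coef c (a *: ve) w (ocons (a *: ve) u) s l =
  a * form_coef c ve w (ocons ve u) (s * a) l.
Proof.
move=> hF; rewrite /form_coef /dilate /= scalerA.
rewrite -(ocons_upd0 0 (a *: ve)) (form_updZ hw) ocons_upd0.
by rewrite (coframeZ hF).
Qed.

(* Along the ray, h w is t^-k times a solution x of x' = - x G + t^k w(v, u). *)
Lemma homotopy_lie (S : 'I_k -> sect E) (v : TE) :
  smooth_sect (fun y => homotopy nabla w (fun i => S i (bproj y) : pullE E y)) ->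
  nabla (@euler R B E v)
    (fun y => homotopy nabla w (fun i => S i (bproj y) : pullE E y))
  + k%:R *: homotopy nabla w (fun i => S i (bproj v) : pullE E v) =
  w v (ocons (@euler R B E v) (fun i => S i (bproj v) : pullE E v)).
Proof.
set r := (X in smooth_sect X); move=> hr.
have [m [e [c [W [hF hW]]]]] := coframe_ray v.
case: v hW => b ve hW; pose u i := S i b.
have [x [x0 hx]] := homotopy_ode HB HE HF hc hF u hw (ler0n R 2) hW.
have rE (a : R) : 0 < a <= 2 ->
    r (dilate a (tpt ve)) = \sum_l (a^-1 ^+ k * x a l) *: e l (dilate a (tpt ve)).
  move=> /andP[a0 a2].
  have sa s : 0 <= s <= 1 -> 0 <= s * a <= 2.
    move=> /andP[s0 s1]; rewrite mulr_ge0 ?(ltW a0) //=.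
    by rewrite (le_trans _ a2) // ler_piMl // ltW.
  have hWa s : 0 <= s <= 1 -> W (dilate s (tpt (a *: ve))).
    by move=> /sa /hW; rewrite -(dilate_dilate s a (tpt ve)).
  (* The solution for the ray through a v is the one for v, read at time s a and divided by a^k. The
     chain rule gives a factor a, as does the scaling of G and of the form; a^-k cancels a^k in (s
     a)^k. *)
  have := @homotopyE _ _ HB _ HE _ HF _ hc _ _ _ _ hF b (a *: ve) hWa k w u
    (fun s l => a^-1 ^+ k * x (s * a) l) hw.
  rewrite /lincomb mul1r; apply=> [l|s l s01]; first by rewrite mul0r x0 mulr0.
  have hlin : is_derive (s : R) 1 (fun s : R => s * a) (1 * a + s * 0).
    exact: is_derive_mul (is_derive_id _ _) (is_derive_cst a _ _).
  have Hx := is_derive_chain hlin (hx (s * a) l (sa s s01)).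
  apply: is_derive_eq (is_derive_mul (is_derive_cst (a^-1 ^+ k) _ _) Hx) _.
  rewrite (form_coef_scale _ _ _ _ _ hF).
  under [in RHS]eq_bigr => j _ do rewrite (conn_coef_scale _ _ _ _ _ hF).
  have -> : \sum_j a^-1 ^+ k * x (s * a) j * (a * conn_coef nabla e c ve (s * a) j l) =
      a^-1 ^+ k * a * \sum_j x (s * a) j * conn_coef nabla e c ve (s * a) j l.
    by rewrite mulr_sumr; apply: eq_bigr => j _; ring.
  have Aa : a^-1 ^+ k * a ^+ k = 1 by rewrite -exprMn mulVf ?expr1n // gt_eqF.
  rewrite exprMn; move: (\sum_j _) (form_coef _ _ _ _ _ _) Aa => X f.
  move: (a^-1 ^+ k) (a ^+ k) (s ^+ k) => A p q Ap.
  rewrite /= (_ : _ + _ = - A * X * a + (A * p) * q * f * a); last by rewrite /cst; ring.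
  by rewrite Ap; ring.
have s11 : 0 <= (1 : R) <= 2 by rewrite ler01 ler1n.
have W1 := hW 1 s11.
pose dx l := - (\sum_j x 1 j * conn_coef nabla e c ve 1 j l)
  + form_coef c ve w (ocons ve u) 1 l.
(* Differentiating a^-k at 1 produces the term with the factor k; in the rest, - x G cancels against
   the derivatives of the e_l. *)
have hf l : is_derive (1 : R) 1 (fun a : R => a^-1 ^+ k * x a l) (- (k%:R * x 1 l) + dx l).
  have hV : is_derive (1 : R) 1 (fun a : R => a^-1) (-1).
    have nz : id (1 : R) != 0 by exact: oner_neq0.
    have did := is_derive_id (1 : R) 1.
    apply: DeriveDef (derivableV nz (@ex_derive _ _ _ _ _ _ _ did)) _.
    apply: etrans (deriveV nz (@ex_derive _ _ _ _ _ _ _ did)) _.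
    by rewrite derive_id /= expr1n invr1 scaleN1r.
  apply: is_derive_eq (is_derive_mul (is_derive_exp k hV) (hx 1 l s11)) _.
  by rewrite invr1 !expr1n /dx; ring.
have near1 : \forall a \near (1 : R), 0 < a <= 2.
  have := @near_in_itvoo R 0 2 1; rewrite in_itv /= ltr01 ltr1n => /(_ isT).
  by apply: filterS => q; rewrite in_itv /= => /andP[-> /ltW ->].
have r1 : r (dilate 1 (tpt ve)) = \sum_l x 1 l *: e l (dilate 1 (tpt ve)).
  rewrite rE ?ltr01 ?ler1n //; apply: eq_bigr => l _.
  by rewrite invr1 expr1n mul1r.
have rnear : \forall a \near (1 : R), r (dilate a (tpt ve)) =
    \sum_l (a^-1 ^+ k * x a l) *: e l (dilate a (tpt ve)).
  by apply: filterS near1 => a; exact: rE.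
have D := nabla_ray HB HE HF hc hF (ve := ve) W1 hr (coframe_smooth hF) hf rnear.
have : nabla (ve : pullE E (dilate 1 (tpt ve))) r + k%:R *: r (dilate 1 (tpt ve)) =
    w (dilate 1 (tpt ve)) (ocons ve u).
  rewrite D r1 big_split /= invr1 expr1n.
  under [X in _ + X + _]eq_bigr => j _ do
    rewrite mul1r (coframe_decomp hF W1 (nabla _ (e j))) scaler_sumr.
  rewrite [X in _ + X + _]exchange_big /= scaler_sumr -!big_split /=.
  rewrite [RHS](coframe_decomp hF W1); apply: eq_bigr => l _.
  under eq_bigr do rewrite scalerA.
  rewrite -scaler_suml scalerA -!scalerDl; congr (_ *: _).
  by rewrite /dx /conn_coef /form_coef; ring.
by rewrite /dilate /= scale1r.
Qed.

End Form.
End LieDerivative.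

(** * Dilation of the fibres in coordinates *)

Section PartialDilation.
Context (R : realType) (n r : nat).

Definition dil_factor (c : 'I_(n + r)) (s : R) : R :=
  if fintype.split c is inl _ then 1 else s.

Definition partial_dilate (s : R) (z : 'rV[R]_(n + r)) : 'rV[R]_(n + r) :=
  \row_c (dil_factor c s * z 0 c).

Lemma partial_dilateE s (x : 'rV[R]_n) (y : 'rV[R]_r) :
  partial_dilate s (row_mx x y) = row_mx x (s *: y).
Proof.
apply/rowP => c; rewrite mxE /dil_factor -(splitK c) unsplitK.
by case: (fintype.split c) => a /=; rewrite ?row_mxEl ?row_mxEr ?mul1r ?mxE.
Qed.

Lemma dil_factor_cont c : continuous (dil_factor c).
Proof.
move=> s; rewrite /dil_factor; case: (fintype.split c) => _; first exact: cvg_cst.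
exact: cvg_id.
Qed.

Lemma partial_dilate_cvg (T : Type) (H : set_system T) (f : T -> R)
    (q : T -> 'rV[R]_(n + r)) (s : R) (p : 'rV[R]_(n + r)) : Filter H ->
  f t @[t --> H] --> s -> (forall c, q t 0 c @[t --> H] --> p 0 c) ->
  partial_dilate (f t) (q t) @[t --> H] --> partial_dilate s p.
Proof.
move=> FH fs qp; apply: (@rV_cvg _ _ _ H) => c; rewrite mxE.
under eq_cvg do rewrite mxE.
apply: cvgM (qp c); apply: continuous_cvg fs; exact: dil_factor_cont.
Qed.

Lemma partial_dilate_pair (s : R) (p : 'rV[R]_(n + r)) :
  partial_dilate (fst sq) (snd sq) @[sq --> filter_prod (nbhs s) (nbhs p)]
    --> partial_dilate s p.
Proof.
apply: partial_dilate_cvg; first exact: cvg_fst.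
move=> c A /(@coord_continuous R 1 (n + r) 0 c p) hA.
exists (setT, fun z : 'rV[R]_(n + r) => A (z 0 c)); last by move=> [x y] [].
by split; first exact: filterT.
Qed.

(** The tube lemma for the compact time interval. *)
Lemma near_segment (P : 'rV[R]_(n + r) -> R -> Prop) (p : 'rV[R]_(n + r)) :
  (forall s : R, 0 <= s <= 1 -> \forall s' \near s & q \near p, P q s') ->
  \forall q \near p, forall s : R, 0 <= s <= 1 -> P q s.
Proof.
move=> HP; have /compact_near_coveringP := @segment_compact R 0 1.
move=> /(_ _ (nbhs p) P (nbhs_filter p)) H.
have K : \forall q \near p, `[0 : R, 1] `<=` P q.
  by apply: H => s; rewrite /= in_itv; exact: HP.
by apply: filterS K => q Kq s s01; apply: Kq; rewrite /= in_itv.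
Qed.

Context (V U : set 'rV[R]_(n + r)) (oV : open V) (oU : open U).
Context (UV : forall z s, U z -> 0 <= s <= 1 -> V (partial_dilate s z)).

Lemma param_cont_dilate g : (forall x, V x -> {for x, continuous g}) ->
  param_cont U (fun s z => g (partial_dilate (clamp 1 s) z)).
Proof.
move=> cg.
have cD z s : U z -> 0 <= s <= 1 ->
    {for s, continuous (fun s => g (partial_dilate s z))}.
  move=> Uz s01; apply: (@continuous_comp _ _ _ (fun s => partial_dilate s z) g).
    apply: (partial_dilate_cvg (q := fun=> z)) => [|c]; [exact: cvg_id|exact: cvg_cst].
  by apply: cg; exact: UV.
split.
- move=> p Up.
  exact: (continuous_clamp (f := fun s => g (partial_dilate s p)) ler01
    (fun s => @cD p s Up)).
- move=> p Up e e0.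
  have : \forall q \near p, forall s : R, 0 <= s <= 1 ->
      `|g (partial_dilate s q) - g (partial_dilate s p)| <= e.
    apply: near_segment => s s01.
    have cgs := cg _ (UV Up s01).
    have d1 := @partial_dilate_pair s p.
    have d2 : partial_dilate (fst sq) p
        @[sq --> filter_prod (nbhs s) (nbhs p)] --> partial_dilate s p.
      apply: (partial_dilate_cvg (q := fun=> p)); first exact: cvg_fst.
      by move=> c; exact: cvg_cst.
    have c1 := cvg_comp _ _ d1 cgs; have c2 := cvg_comp _ _ d2 cgs.
    have c12 := cvgB c1 c2; rewrite subrr in c12.
    have FP : Filter (filter_prod (nbhs s) (nbhs p)) by typeclasses eauto.
    exact (cvgr0_norm_le _ (c12 FP) _ e0).
  by apply: filterS => q Hq s; apply: Hq; exact: clamp_itv ler01.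
- move=> p Up.
  exact: (bounded_clamp (f := fun s => g (partial_dilate s p)) ler01
    (fun s => @cD p s Up)).
Qed.

(** The dilation is linear and diagonal, so a partial derivative of the composite is the composite
    of the same partial derivative of g, times a factor that depends on time only. *)
Lemma PCk_dilate k g : (forall k, Ck k V g) ->
  PCk k U (fun s z => g (partial_dilate (clamp 1 s) z)).
Proof.
elim: k g => [|k IH] g hg.
  by split=> //; apply: param_cont_dilate => x Vx; exact: Ck_cont (hg 0%N) Vx.
split; first by apply: param_cont_dilate => x Vx; exact: Ck_cont (hg 0%N) Vx.
move=> i; exists (fun s z => 'D_(delta_mx 0 i) g (partial_dilate (clamp 1 s) z) *
  dil_factor i (clamp 1 s)); split; last first.
  apply: PCk_mul.
    exact: (IH (fun x => 'D_(delta_mx 0 i) g x) (fun k' => Ck_partial i (hg k'.+1))).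
  apply: (@PCk_time _ _ _ _ _ 1).
    exact: (continuous_clamp (f := dil_factor i) ler01 (fun s _ => @dil_factor_cont i s)).
  move=> s; have /andP[s0 s1] := clamp_itv s (@ler01 R).
  rewrite /dil_factor; case: (fintype.split i) => _; first by rewrite normr1.
  by rewrite ger0_norm.
move=> s z Uz; set a := clamp 1 s.
have a01 : 0 <= a <= 1 by exact: clamp_itv ler01.
have H := @is_derive_C1_curve _ _ V g (fun t : R => partial_dilate a (z + t *: delta_mx 0 i))
  (fun c => dil_factor c a * (c == i)%:R) 0 oV (hg 1%N).
have -> : z = z + (0 : R) *: delta_mx 0 i by rewrite scale0r addr0.
apply/is_derive_lineP.
apply: is_derive_eq; first apply: H.
- by rewrite scale0r addr0; exact: UV.
- move=> c.
  have -> : (fun t : R => partial_dilate a (z + t *: delta_mx 0 i) 0 c) =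
     (fun t => dil_factor c a * (z 0 c + t * (c == i)%:R)).
    by apply/funext => t; rewrite !mxE eqxx.
  apply: is_derive_eq; rewrite /GRing.scale /=; ring.
- rewrite scale0r addr0 (bigD1 i) //= eqxx mulr1 big1 ?addr0 1?mulrC // => c ci.
  by rewrite (negbTE ci) mulr0 mul0r.
Qed.

End PartialDilation.

Section HomotopySmooth.
Context (R : realType) (B : atlas R) (HB : is_premanifold B).
Context (E : prebundle B) (HE : is_vbundle E).
Let TE := total_space E.
Let HT : is_premanifold TE := total_space_pre HB HE.
Let HA : is_vbundle (pullE E) := pullE_vbundle HB HE.
Context (F : prebundle TE) (HF : is_vbundle F).
Context (nabla : forall v : TE, pullE E v -> sect F -> F v).
Context (hc : is_connection (@vlift R B E) nabla).

Lemma chart_dilate (i : chart B) (j : tchart E) (s : R) (y : TE) :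
  cdom ((i, j) : chart TE) y ->
  crd ((i, j) : chart TE) (dilate s y) =
  partial_dilate s (crd ((i, j) : chart TE) y).
Proof.
by case: y => b ve [/= di dj]; rewrite partial_dilateE (trivZ HE dj).
Qed.

Lemma smooth_on_rep (V : set TE) (q : chart TE) (f : TE -> R) : smooth_on V f ->
  exists g : 'rV[R]_(mdim B + brank E) -> R,
    (forall k, Ck k (crd q @` (cdom q `&` V)) g) /\
    forall x, cdom q x -> V x -> f x = g (crd q x).
Proof. by move=> hf; have [g hg] := hf q; exists g. Qed.

Section Form.
Context (k : nat) (w : preform (pullE E) F k.+1) (hw : is_form w).
Arguments w : clear implicits.
Context (S : 'I_k -> sect E) (hS : forall l, smooth_sect (S l)).

(** A coframe along the ray of y0 also serves the rays of nearby points. In a chart, the equation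
    that computes h w becomes a family with smooth dependence on the point, and [ode_Ck] is applied
    to its solution at time 1. *)
Lemma homotopy_smooth_sect :
  smooth_sect (fun y : TE => homotopy nabla w (fun l => S l (bproj y) : pullE E y)).
Proof.
apply/smooth_sectT; apply: (smooth_sect_on_local HT HF); first exact (open_inT HT).
move=> y0 _.
have [i di] := pre_cover HB (bproj y0); have [j dj] := tdom_cover HE (bproj y0).
have [chi [V [_ [oV Vy V1] _ _ cs]]] := cutoff HB (tdom_open HE j) dj.
have [m [e [c [W [hF hW]]]]] := coframe_ray HB HE HF y0.
pose q : chart TE := (i, j).
(* The direction ve varies with the point. Expanding it over these fixed sections makes the
   coefficients of the equation linear in the fibre coordinates, times smooth functions on the total
   space. *)
pose eps a : sect E := fun b => chi b *: frame j a b.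
have heps a : smooth_sect (eps a) by apply: (cs _ HE); exact: (smooth_frame HB HE).
have hpe a : smooth_sect (pull_sect (eps a)) by exact: (pull_smooth HB HE).
pose V' : set TE := W `&` (@bproj R B E) @^-1` V.
have oV' : open_in V' by exact (open_inI HT (coframe_open hF) (open_in_pull HB HE oV)).
pose O := crd q @` (cdom q `&` V').
have oO : open O by exact (oV' q).
pose Gf (ajl : 'I_(brank E) * 'I_m * 'I_m) (y : TE) :=
  c ajl.2 y (nabla (pull_sect (eps ajl.1.1) y) (e ajl.1.2)).
have hGf ajl : smooth_on V' (Gf ajl).
  apply: (@smooth_onS _ _ W); first by move=> y [].
  apply: (coframe_coef hF); apply: (conn_smooth hc) => //.
  exact: (coframe_smooth hF).
pose bf (al : 'I_(brank E) * 'I_m) (y : TE) :=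
  c al.2 y (w y (ocons (pull_sect (eps al.1) y) (fun l => S l (bproj y) : pullE E y))).
have hbf al : smooth_on V' (bf al).
  apply: (@smooth_onS _ _ W); first by move=> y [].
  apply: (coframe_coef hF).
  have hs l : smooth_sect (ocons (pull_sect (eps al.1)) (fun l => pull_sect (S l)) l).
    case: (unliftP ord0 l) => [l' ->|->]; rewrite ?oconsS ?ocons0 //.
    exact: (pull_smooth HB HE).
  have := form_sect_smooth HT HA HF hw hs.
  rewrite (_ : (fun y => _) = (fun y => w y (ocons (pull_sect (eps al.1) y)
    (fun l => S l (bproj y) : pullE E y)))) //.
  apply: sect_ext => y; congr (w y _); apply/funext => l.
  by case: (unliftP ord0 l) => [l' ->|->]; rewrite ?oconsS ?ocons0.
have [gG hG] := choice (fun ajl => smooth_on_rep q (hGf ajl)).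
have [gb hb] := choice (fun al => smooth_on_rep q (hbf al)).
pose D (s : R) (z : 'rV[R]_(mdim B + brank E)) := partial_dilate (clamp 1 s) z.
(* Points whose whole segment to the zero section stays in O. By [near_segment] the point y0 is
   interior. *)
pose U : set 'rV[R]_(mdim B + brank E) :=
  [set z | forall s : R, 0 <= s <= 1 -> O (partial_dilate s z)]^°.
have oU : open U by exact: open_interior.
have UO z s : U z -> 0 <= s <= 1 -> O (partial_dilate s z).
  by move=> /interior_subset; apply.
have dq0 : cdom q y0 by [].
have Uy0 : U (crd q y0).
  rewrite /U /interior; apply: near_segment => s s01.
  have Os : O (partial_dilate s (crd q y0)).
    rewrite -chart_dilate //; exists (dilate s y0) => //; split=> //.
    by split=> //; exact/hW/unit_itv2.
  by apply: (@partial_dilate_pair _ _ _ s (crd q y0)); apply: open_nbhs_nbhs.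
pose va (a : 'I_(brank E)) (z : 'rV[R]_(mdim B + brank E)) : R := z 0 (rshift (mdim B) a).
(* The direction is the same at all points of the ray, so its coordinates are read at z, whereas the
   connection is read at the dilated point. *)
pose Am (s : R) z (j l : 'I_m) : R := - \sum_a va a z * gG (a, j, l) (D s z).
pose bm (s : R) z (l : 'I_m) : R := clamp 1 s ^+ k * \sum_a va a z * gb (a, l) (D s z).
have pM n (r l : 'I_1 + 'I_m) : PCk n U (fun s z => affine_mx (Am s z) (bm s z) r l).
  have pva a : PCk n U (fun _ z => va a z) by apply: PCk_space; exact: Ck_coord.
  case: r l => [r|r] [l|l] /=; try exact: PCk_cst.
    apply: PCk_mul.
      apply: (@PCk_time _ _ _ _ _ 1).
        move=> s; apply: (@continuous_comp _ _ _ (clamp 1) (fun x => x ^+ k)).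
          exact: clamp_cont.
        exact: exprn_continuous.
      move=> s; have /andP[s0 s1] := clamp_itv s (@ler01 R).
      by rewrite normrX ger0_norm // exprn_ile1.
    apply: PCk_sum => a _; apply: PCk_mul => //.
    exact: (PCk_dilate oO UO n (hb (a, l)).1).
  rewrite (_ : (fun s z => Am s z r l) =
    (fun s z => (-1) * \sum_a va a z * gG (a, r, l) (D s z))); last first.
    by apply/funext => s; apply/funext => z; rewrite mulN1r.
  apply: PCk_mul; first exact: PCk_cst.
  apply: PCk_sum => a _; apply: PCk_mul => //.
  exact: (PCk_dilate oO UO n (hG (a, r, l)).1).
have hx z : exists x : R -> 'I_1 + 'I_m -> R, U z ->
    (forall l, x 0 l = affine_init (fun=> 0) l) /\
    ode_solution (fun s => affine_mx (Am s z) (bm s z)) x.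
  case: (pselect (U z)) => [Uz|nU]; last by exists (fun _ _ => 0).
  have [C hC] := family_bounded (fun r l => PCk_cont (pM 0%N r l)) Uz.
  have cM r l : continuous (fun s => affine_mx (Am s z) (bm s z) r l).
    by have [+ _ _] := PCk_cont (pM 0%N r l); apply.
  have [x [x0 hx]] := linear_ode_exists (affine_init (fun=> 0)) cM hC.
  by exists x => _; split=> // s l; exact: hx.
have [x {}hx] := choice hx.
pose W' : set TE := cdom q `&` crd q @^-1` U.
have oW' : open_in W' by exact (@open_in_chart _ _ HT q U oU).
exists W'; split=> //.
have formula y : W' y -> homotopy nabla w (fun l => S l (bproj y) : pullE E y) =
    lincomb e y (fun l => x (crd q y) 1 (inr l)).
  move=> [dy Uy]; have [x0 hxy] := hx _ Uy.
  have Vs s : 0 <= s <= 1 -> V' (dilate s y).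
    move=> s01; have [y' [dy' Vy'] yy'] := UO _ _ Uy s01.
    have dsy : cdom q (dilate s y) by [].
    by rewrite -(pre_inj HT dy' dsy) // chart_dilate.
  case: y dy Uy x0 hxy Vs => b ve dy Uy x0 hxy Vs.
  have db : tdom j b by case: dy.
  have veE : ve = \sum_a triv j ve 0 a *: frame j a b by exact: (frame_decomp HE db).
  have vaE a : va a (crd q (tpt ve)) = triv j ve 0 a by rewrite /va /= row_mxEr.
  have epsE a (s : R) : 0 <= s <= 1 -> eps a b = frame j a b.
    by move=> s01; rewrite /eps V1 ?scale1r //; have [] := Vs s s01.
  have hWs (s : R) : 0 <= s <= 1 -> W (dilate s (tpt ve)) by move=> /Vs[].
  apply: (homotopyE HB HE HF hc hF hWs (x := fun s l => x (crd q (tpt ve)) s (inr l)) hw).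
    by move=> l; rewrite x0.
  move=> s l s01; have s0 : 0 <= s by case/andP: s01.
  have := affine_solution (A := fun s => Am s (crd q (tpt ve)))
    (b := fun s => bm s (crd q (tpt ve))) x0 hxy l s0.
  move=> H; apply: is_derive_eq H _.
  have Ds : D s (crd q (tpt ve)) = crd q (dilate s (tpt ve)).
    by rewrite /D clamp_id // chart_dilate.
  have dsy : cdom q (dilate s (tpt ve)) by [].
  have AE (r : 'I_m) : Am s (crd q (tpt ve)) r l = - conn_coef nabla e c ve s r l.
    rewrite /Am; congr (- _); rewrite /conn_coef.
    have -> : nabla (ve : pullE E (dilate s (tpt ve))) (e r) =
        \sum_a triv j ve 0 a *: nabla (frame j a b : pullE E (dilate s (tpt ve))) (e r).
      rewrite -(nabla_dir_sum hc); last exact: (coframe_smooth hF).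
      by rewrite -veE.
    rewrite (coframe_sum hF).
    apply: eq_bigr => a _; rewrite (coframeZ hF) vaE Ds -(hG _).2 //; last exact: Vs.
    by rewrite /Gf /= /pull_sect /= (epsE _ _ s01).
  have bE : bm s (crd q (tpt ve)) l =
      s ^+ k * form_coef c ve w (ocons ve (fun l => S l b)) s l.
    rewrite /bm clamp_id //; congr (_ * _); rewrite /form_coef.
    have -> : w (dilate s (tpt ve)) (ocons ve (fun l => S l b)) =
        \sum_a triv j ve 0 a *: w (dilate s (tpt ve)) (ocons (frame j a b) (fun l => S l b)).
      have := @form_upd_sum _ _ _ _ _ _ hw (dilate s (tpt ve))
        (ocons (0 : E b) (fun l => S l b)) ord0 _ (index_enum _)
        (fun a => triv j ve 0 a) (fun a => frame j a b).
      rewrite -veE ocons_upd0 => ->; apply: eq_bigr => a _.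
      by rewrite ocons_upd0.
    rewrite (coframe_sum hF).
    apply: eq_bigr => a _; rewrite (coframeZ hF) vaE Ds -(hb _).2 //; last exact: Vs.
    by rewrite /bf /= /pull_sect /= (epsE _ _ s01).
  rewrite bE; congr (_ + _); rewrite -sumrN; apply: eq_bigr => r _.
  by rewrite AE mulrN.
apply: (@smooth_sect_on_eq _ _ _ _ _ _ (fun y Wy => esym (formula y Wy))).
apply: (smooth_sect_on_sum HT HF) => // l _.
apply: (smooth_sect_on_scale HT HF) => //; last first.
  exact: (smooth_sectW _ (coframe_smooth hF l)).
apply: (smooth_on_chart HT (i := q) (g := fun z => x z 1 (inr l))) => //.
  by move=> y [].
move=> n; apply: (@Ck_sub _ _ _ U); first by move=> _ [y [_ [_ Uy]] <-].
apply: (ode_Ck (x := fun s z => x z s) (x0 := affine_init (fun=> 0)) (inr l) oU (pM n)) => //.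
- by move=> z Uz r; have [h _] := hx z Uz.
- by move=> z Uz; have [_ h] := hx z Uz.
Qed.

End Form.

Lemma homotopy_form k (w : preform (pullE E) F k.+1) : is_form w ->
  is_form (homotopy nabla w).
Proof.
move=> hw; split.
- exact: (homotopy_multilinear HB HE HF hc hw).
- by move=> x u i j; exact: (homotopy_alternating HB HE HF hc hw).
- by apply: (form_smooth_pull HB HE HF) => S hS; exact: homotopy_smooth_sect.
Qed.

End HomotopySmooth.

(** * The homotopy identity *)

Lemma ocons_lift (T : Type) n (a : T) (u : 'I_n.+1 -> T) (i : 'I_n.+1) :
  (fun l => ocons a u (lift (lift ord0 i) l)) = ocons a (fun q => u (lift i q)).
Proof.
apply/funext => l; case: (unliftP ord0 l) => [q|] ->.
  rewrite oconsS (_ : lift (lift ord0 i) (lift ord0 q) = lift ord0 (lift i q)).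
    by rewrite oconsS.
  by apply: val_inj; rewrite /= /bump !add1n ltnS addnS.
rewrite ocons0 (_ : lift (lift ord0 i) ord0 = ord0) ?ocons0 //.
exact: val_inj.
Qed.

Section Cartan.
Context (R : realType) (B : atlas R) (HB : is_premanifold B).
Context (E : prebundle B) (HE : is_vbundle E).
Let TE := total_space E.
Let HT : is_premanifold TE := total_space_pre HB HE.
Let HA : is_vbundle (pullE E) := pullE_vbundle HB HE.
Context (F : prebundle TE) (HF : is_vbundle F).
Context (br : sect (pullE E) -> sect (pullE E) -> sect (pullE E)).
Context (nabla : forall v : TE, pullE E v -> sect F -> F v).
Context (hbr : is_lie_algebroid (@vlift R B E) br).
Context (hpull : forall s1 s2 : sect E, smooth_sect s1 -> smooth_sect s2 ->
  forall v, br (pull_sect s1) (pull_sect s2) v = 0).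
Context (hc : is_connection (@vlift R B E) nabla) (hflat : is_flat br nabla).
Notation euler := (@euler R B E).

Lemma euler_br_pull (s : sect E) v : smooth_sect s ->
  br euler (pull_sect s) v = - pull_sect s v.
Proof.
move=> hs; rewrite (br_antisym hbr); last exact: (pull_smooth HB HE).
  by rewrite (pull_br_euler HB HE hbr hpull).
exact: (euler_smooth HB HE).
Qed.

Definition eval_pull k (w : preform (pullE E) F k) (S : 'I_k -> sect E) : sect F :=
  fun y => w y (fun l => S l (bproj y) : pullE E y).

Definition eval_euler k (w : preform (pullE E) F k.+1) (S : 'I_k -> sect E) : sect F :=
  fun y => w y (ocons (euler y) (fun l => S l (bproj y) : pullE E y)).

Lemma eval_pull_smooth k (w : preform (pullE E) F k) (S : 'I_k -> sect E) :
  is_form w -> (forall l, smooth_sect (S l)) -> smooth_sect (eval_pull w S).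
Proof.
move=> hw hS; apply: (form_sect_smooth HT HA HF hw (s := fun l => pull_sect (S l))) => l.
exact: (pull_smooth HB HE).
Qed.

Lemma ocons_sect k (S : 'I_k -> sect E) y :
  ocons (euler y) (fun l => S l (bproj y) : pullE E y) =
  (fun l => ocons euler (fun l => pull_sect (S l)) l y).
Proof.
apply/funext => l; case: (unliftP ord0 l) => [q|] ->; rewrite ?oconsS ?ocons0 //.
Qed.

Lemma ocons_sect_smooth k (S : 'I_k -> sect E) : (forall l, smooth_sect (S l)) ->
  forall l, smooth_sect (ocons euler (fun l => pull_sect (S l)) l).
Proof.
move=> hS l; case: (unliftP ord0 l) => [q|] ->; rewrite ?oconsS ?ocons0.
  exact: (pull_smooth HB HE).
exact: (euler_smooth HB HE).
Qed.

Lemma eval_euler_smooth k (w : preform (pullE E) F k.+1) (S : 'I_k -> sect E) :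
  is_form w -> (forall l, smooth_sect (S l)) -> smooth_sect (eval_euler w S).
Proof.
move=> hw hS.
have := form_sect_smooth HT HA HF hw (ocons_sect_smooth hS).
rewrite (_ : (fun y => _) = eval_euler w S) //.
by apply: sect_ext => y; rewrite /eval_euler ocons_sect.
Qed.

Lemma dA_euler0 (w : preform (pullE E) F 0) (S : 'I_0 -> sect E) v : is_form w ->
  eval_euler (dA br nabla w) S v = nabla (euler v) (eval_pull w S).
Proof.
move=> hw; have hS l : smooth_sect (S l) by case: l.
rewrite /eval_euler ocons_sect.
rewrite (dAE HT HA HF hbr hc hw _ (ocons_sect_smooth hS)) koszul_terms.
rewrite big_ord1 [X in _ + X]big1 ?addr0; last first.
  by move=> i _; rewrite big1 // => j; rewrite !ord1.
rewrite /nabla_term expr0 scale1r ocons0; congr nabla.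
by apply: sect_ext => y; congr (w y _); apply/funext => -[].
Qed.

(** The only brackets left are [e, S_m] = - S_m. Each has the Koszul sign of (0, m + 1), and moving
    S_m from the front to slot m costs (-1)^m; the signs cancel, which gives k + 1 equal terms. *)
Lemma dA_euler k (w : preform (pullE E) F k.+1) (S : 'I_k.+1 -> sect E) v :
  is_form w -> (forall l, smooth_sect (S l)) ->
  eval_euler (dA br nabla w) S v = nabla (euler v) (eval_pull w S)
    - \sum_(i < k.+1) (-1) ^+ i *: nabla (S i (bproj v) : pullE E v)
        (eval_euler w (fun q => S (lift i q)))
    + k.+1%:R *: eval_pull w S v.
Proof.
move=> hw hS; have hs := ocons_sect_smooth hS.
rewrite /eval_euler ocons_sect (dAE HT HA HF hbr hc hw _ hs) koszul_terms.
set s := ocons euler _.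
rewrite big_ord_recl; congr (_ + _ + _).
- rewrite /nabla_term expr0 scale1r /s ocons0; congr nabla.
  by apply: sect_ext => y; congr (w y _); apply/funext => l; rewrite oconsS.
- rewrite -sumrN; apply: eq_bigr => i _.
  rewrite /nabla_term (_ : nat_of_ord (lift ord0 i) = i.+1) //.
  rewrite exprS mulN1r scaleNr /s oconsS; congr (- (_ *: nabla _ _)).
  apply: sect_ext => y; rewrite (ocons_sect (fun q => S (lift i q))); congr (w y _).
  exact: (congr1 (fun g (l : 'I_k.+1) => g l y)
    (ocons_lift euler (fun l => pull_sect (S l)) i)).
rewrite big_ord_recl [X in _ + X]big1 ?addr0; last first.
  move=> i _; rewrite big1 // => j ij.
  have [j' jj] : exists j', j = lift ord0 j'.
    by case: (unliftP ord0 j) ij => [j' ->|->] // _; exists j'.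
  have [p jp] : exists p, j = lift (lift ord0 i) p.
    case: (unliftP (lift ord0 i) j) => [p ?|E0]; first by exists p.
    by move: ij; rewrite E0 ltnn.
  rewrite jp bracket_termE -jp (form_zero_slot hw (i := ord0)) ?scaler0 //.
  by rewrite ocons0 /s jj !oconsS hpull.
have -> : \sum_(j < k.+2 | (@ord0 k.+1 < j)%N) bracket_term br w s v ord0 j =
    \sum_(m < k.+1) bracket_term br w s v ord0 (lift ord0 m).
  by rewrite [LHS]big_mkcond [LHS]big_ord_recl /= add0r; apply: eq_bigr.
rewrite (eq_bigr (fun=> eval_pull w S v)).
  by rewrite sumr_const card_ord scaler_nat.
move=> m _; rewrite /= bracket_termE (_ : nat_of_ord (lift ord0 m) = m.+1) // add0n.
rewrite /s ocons0 !oconsS euler_br_pull //.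
rewrite /eval_pull (form_to_front hw (fun l => S l (bproj v) : pullE E v) m).
have -> : (fun q : 'I_k => ocons euler (fun l => pull_sect (S l)) (lift ord0 (lift m q)) v)
    = (fun q => S (lift m q) (bproj v) : pullE E v).
  by apply/funext => q; rewrite oconsS.
rewrite -(ocons_upd0 0 (- pull_sect (S m) v)) -[- pull_sect (S m) v]scaleN1r.
rewrite (form_updZ hw) ocons_upd0.
by rewrite scalerA exprS mulN1r mulrN1 opprK.
Qed.

(** Flatness moves the derivative along e inside the derivatives along S_i, where [homotopy_lie]
    evaluates it. The coefficient k + 1 is k from the degree of h w plus 1 from [e, S_i] = - S_i. *)
Lemma nabla_euler_dA k (w : preform (pullE E) F k.+1) (S : 'I_k.+1 -> sect E) v :
  is_form w -> (forall l, smooth_sect (S l)) ->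
  nabla (euler v) (eval_pull (dA br nabla (homotopy nabla w)) S) =
  \sum_(i < k.+1) (-1) ^+ i *: nabla (S i (bproj v) : pullE E v)
        (eval_euler w (fun q => S (lift i q)))
  - k.+1%:R *: eval_pull (dA br nabla (homotopy nabla w)) S v.
Proof.
move=> hw hS; have hh := homotopy_form HB HE HF hc hw.
pose th (i : 'I_k.+1) := eval_pull (homotopy nabla w) (fun q => S (lift i q)).
have hth i : smooth_sect (th i) by apply: eval_pull_smooth => // q.
have dE y : eval_pull (dA br nabla (homotopy nabla w)) S y =
    \sum_(i < k.+1) (-1) ^+ i *: nabla (pull_sect (S i) y) (th i).
  exact: (dA_pull HB HE HF hbr hpull hc hh).
rewrite (sect_ext dE) (nabla_lincomb HB HE HF hc); last first.
  move=> i; apply: (conn_smooth hc) => //; exact: (pull_smooth HB HE).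
rewrite scaler_sumr -sumrB; apply: eq_bigr => i _.
rewrite scalerA [_ * (-1) ^+ i]mulrC -scalerA -scalerBr; congr (_ *: _).
have := hflat (euler_smooth HB HE) (pull_smooth HB HE (hS i)) (hth i) v.
have -> : nabla (br euler (pull_sect (S i)) v) (th i) = - nabla (pull_sect (S i) v) (th i).
  by rewrite euler_br_pull // -[- pull_sect _ _]scaleN1r (nabla_dirZ hc) // scaleN1r.
have -> : (fun y => nabla (euler y) (th i)) =
    (fun y => eval_euler w (fun q => S (lift i q)) y + (- k%:R) *: th i y).
  apply: sect_ext => y; rewrite /eval_euler.
  rewrite -(homotopy_lie HB HE HF hc hw (S := fun q => S (lift i q)) y); last exact: hth.
  by rewrite scaleNr addrK.
rewrite (conn_add hc); [|apply: eval_euler_smooth => //|]; last first.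
  exact: (smooth_sect_scale HT HF (smooth_cst HT _)).
rewrite (nablaZ HB HE hc) // => /eqP; rewrite subr_eq => /eqP ->.
rewrite -natr1 scalerDl scale1r opprD scaleNr addrCA; congr (_ + _).
exact: addrC.
Qed.

End Cartan.

(** * Sections annihilated by nabla along the Euler section plus k *)

Section Rigidity.
Context (R : realType) (B : atlas R) (HB : is_premanifold B).
Context (E : prebundle B) (HE : is_vbundle E).
Let TE := total_space E.
Let HT : is_premanifold TE := total_space_pre HB HE.
Context (F : prebundle TE) (HF : is_vbundle F).
Context (nabla : forall v : TE, pullE E v -> sect F -> F v).
Context (hc : is_connection (@vlift R B E) nabla).
Context (k : nat) (r : sect F) (hr : smooth_sect r).
Context (lie0 : forall v : TE, nabla (@euler R B E v) r + k%:R *: r v = 0).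

Lemma lie0_ray (b : B) (ve : E b) (s : R) :
  s *: nabla (ve : pullE E (dilate s (tpt ve))) r
  + k%:R *: r (dilate s (tpt ve)) = 0.
Proof. by rewrite -(nabla_dirZ hc) //; exact: lie0. Qed.

(** The hypothesis gives s times the derivative, which says nothing at s = 0; there the claim
    follows by continuity along the ray. *)
Lemma lie0_nabla (b : B) (ve : E b) (s : R) : k = 0%N ->
  nabla (ve : pullE E (dilate s (tpt ve))) r = 0.
Proof.
move=> k0.
have N0 t : t != 0 -> nabla (ve : pullE E (dilate t (tpt ve))) r = 0.
  move=> t0; have /eqP := lie0_ray ve t.
  by rewrite k0 scale0r addr0 scaler_eq0 (negbTE t0) => /eqP.
have [->|s0] := eqVneq s 0; last exact: N0.
have [m [e [c [W [hF hW]]]]] := coframe_ray HB HE HF (tpt ve).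
have W0 : W (dilate 0 (tpt ve)) by apply: hW; rewrite lexx ler0n.
have [r' hr' rE] := dir_nabla_smooth HB HE hc ve hr.
apply: (coframe_inj hF W0) => l; rewrite (coframe0 hF) -rE.
have cr := ray_cont HB HE (coframe_open hF) (coframe_coef hF l hr') W0.
have c1 : c l _ (r' (dilate t (tpt ve))) @[t --> 0^'+] --> c l _ (r' (dilate 0 (tpt ve))).
  exact: cvg_at_right_filter.
have c2 : c l _ (r' (dilate t (tpt ve))) @[t --> 0^'+] --> (0 : R).
  apply: cvg_near_cst; near=> t; have t0 : 0 < t by near: t; exact: nbhs_right_gt.
  by rewrite rE N0 ?(coframe0 hF) // gt_eqF.
exact: (cvg_unique _ c1 c2).
Unshelve. all: by end_near. Qed.

(** For k > 0 the derivative is s^(k-1) times the expression in [lie0_ray], which vanishes at s = 0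
    as well. For k = 0 no factor s is available, and [lie0_nabla] takes over. *)
Lemma lie0_parallel (b : B) (ve : E b) :
  parallel nabla (fun s : R => ve : pullE E (dilate s (tpt ve))) `[0, 1]
    (fun s => s ^+ k *: r (dilate s (tpt ve))).
Proof.
move=> s _.
have d : is_derive s 1 (fun s : R => s ^+ k) (k%:R * s ^+ k.-1 * 1).
  exact: is_derive_exp (is_derive_id s 1).
exists 1%N, (fun _ s => s ^+ k), (fun=> r); split=> //.
- apply: (@filterE _ (nbhs s) _ _) => s'; by rewrite big_ord1.
- rewrite big_ord1 derive1E (@derive_val _ _ _ _ _ _ _ d) mulr1.
  have [k0|k0] := posnP k.
    by rewrite lie0_nabla // k0 mul0r scale0r scaler0 addr0.
  have -> : s ^+ k = s ^+ k.-1 * s by rewrite -exprSr prednK.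
  by rewrite mulrC -!scalerA -scalerDr addrC lie0_ray scaler0.
Qed.

Lemma lie0_vanish (v : TE) : (0 < k)%N -> r v = 0.
Proof.
move=> k0; have [m [e [c [W [hF hW]]]]] := coframe_ray HB HE HF v.
case: v hW => b ve hW.
have hW1 (s : R) : 0 <= s <= 1 -> W (dilate s (tpt ve)).
  by move/unit_itv2; exact: hW.
have p0 := lincomb_parallel hF (nabla := nabla) hW1 (x := fun _ _ => 0) (lexx 0).
have z0 : parallel nabla (fun s : R => ve : pullE E (dilate s (tpt ve))) `[0, 1]
    (fun s => lincomb e (dilate s (tpt ve)) (fun=> 0)).
  apply: p0 => s _ l; apply: is_derive_eq (is_derive_cst (0 : R) s 1) _.
  by rewrite big1 ?oppr0 // => j _; rewrite mul0r.
have U := parallel_unique HB HE HF hc hF hW1 (t := 0) _ (lie0_parallel ve) z0.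
have s00 : 0 <= (0 : R) <= 1 by rewrite lexx ler01.
apply: (coframe_inj hF (coframe_dom1 hW1)) => l.
have E1 : c l _ (r (tpt ve)) = c l _ (1 ^+ k *: r (dilate 1 (tpt ve))).
  rewrite expr1n scale1r.
  by apply: tpt_coord; rewrite dilate1.
rewrite (coframe0 hF) -(coframe0 hF l (dilate 1 (tpt ve))) [LHS]E1.
rewrite (U s00 _ l) ?lincomb0 // => j.
by rewrite expr0n eqn0Ngt k0 scale0r.
Qed.

Lemma lie0_transport (v : TE) : k = 0%N ->
  transport nabla 0 v (tpt (r (dilate 0 v))) = r v.
Proof.
move=> k0; have [m [e [c [W [hF hW]]]]] := coframe_ray HB HE HF v.
case: v hW => b ve hW.
have hW1 (s : R) : 0 <= s <= 1 -> W (dilate s (tpt ve)).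
  by move/unit_itv2; exact: hW.
have s00 : 0 <= (0 : R) <= 1 by rewrite lexx ler01.
have := transport_parallel HB HE HF hc hF hW1 (z := r (tpt ve)) s00
  (lie0_parallel ve).
rewrite k0 !expr0 !scale1r; apply.
by rewrite dilate1.
Qed.

End Rigidity.

Section HomotopyIdentity.
Context (R : realType) (B : atlas R) (HB : is_premanifold B).
Context (E : prebundle B) (HE : is_vbundle E).
Let TE := total_space E.
Let HT : is_premanifold TE := total_space_pre HB HE.
Context (F : prebundle TE) (HF : is_vbundle F).
Context (br : sect (pullE E) -> sect (pullE E) -> sect (pullE E)).
Context (nabla : forall v : TE, pullE E v -> sect F -> F v).
Context (hbr : is_lie_algebroid (@vlift R B E) br).
Context (hpull : forall s1 s2 : sect E, smooth_sect s1 -> smooth_sect s2 ->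
  forall v, br (pull_sect s1) (pull_sect s2) v = 0).
Context (hc : is_connection (@vlift R B E) nabla) (hflat : is_flat br nabla).

(** The arguments u are extended by pulled back sections S, so that the defect of the identity
    becomes a single section r of F, to which [lie0_vanish] applies. *)
Lemma homotopy_identity k (w : preform (pullE E) F k) (v : TE)
    (u : 'I_k -> pullE E v) : (0 < k)%N -> is_form w ->
  homotopy nabla (dA br nabla w) u + d_homotopy br nabla w u = w v u.
Proof.
case: k w u => // k w u _ hw; have [S [hS <-]] := sections_through HB HE u.
have hd := dA_form HB HE HF hbr hpull hc hw.
have hh := homotopy_form HB HE HF hc hw.
have hhd := homotopy_form HB HE HF hc hd.
have hdh := dA_form HB HE HF hbr hpull hc hh.
pose r1 := eval_pull (homotopy nabla (dA br nabla w)) S.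
pose r2 := eval_pull (dA br nabla (homotopy nabla w)) S.
pose r3 := eval_pull w S.
have s1 : smooth_sect r1 by exact: (eval_pull_smooth HB HE HF hhd hS).
have s2 : smooth_sect r2 by exact: (eval_pull_smooth HB HE HF hdh hS).
have s3 : smooth_sect r3 by exact: (eval_pull_smooth HB HE HF hw hS).
have s3' := smooth_sect_scale HT HF (smooth_cst HT (-1)) s3.
have s23 := smooth_sect_add HT HF s2 s3'.
pose r y := r1 y + (r2 y + (-1) *: r3 y).
have hr : smooth_sect r by exact: (smooth_sect_add HT HF).
have L y : nabla (@euler R B E y) r + k.+1%:R *: r y = 0.
  (* L1 turns h d w into (d w)(e, S), which L3 expands; its sum over i cancels that of L2, and its
     remaining terms are those of w. *)
  have L1 := homotopy_lie HB HE HF hc hd (S := S) y s1.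
  have L1' : nabla (euler y) r1 + k.+1%:R *: r1 y = eval_euler (dA br nabla w) S y.
    exact: L1.
  have L2 := nabla_euler_dA HB HE HF hbr hpull hc hflat y hw hS.
  rewrite -/r2 in L2.
  have L3 := dA_euler HB HE HF hbr hpull hc y hw hS; rewrite -/r3 in L3.
  rewrite /r (conn_add hc) // (conn_add hc) // (nablaZ HB HE hc) //.
  rewrite L2 !scalerDr addrACA L1' L3 addrACA.
  rewrite !scaleN1r scalerN.
  move: (nabla _ r3) (\sum_i _) (_ *: r2 y) (_ *: r3 y) => n t p q.
  rewrite [q + _]addrC subrK (_ : t - p - n = - (n - t) - p).
    by rewrite (addrA (n - t)) subrr add0r addNr.
  by rewrite opprB addrAC.
have := lie0_vanish HB HE HF hc hr L v isT.
rewrite /r addrA scaleN1r => /eqP; rewrite subr_eq0 => /eqP.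
exact.
Qed.

Lemma homotopy_identity0 (w : preform (pullE E) F 0) (v : TE)
    (u : 'I_0 -> pullE E v) : is_form w ->
  homotopy nabla (dA br nabla w) u =
  w v u - transport nabla 0 v (tpt (w (dilate 0 v) (u : 'I_0 -> pullE E (dilate 0 v)))).
Proof.
move=> hw; have [S [hS <-]] := sections_through HB HE u.
have hd := dA_form HB HE HF hbr hpull hc hw.
have hhd := homotopy_form HB HE HF hc hd.
pose r1 := eval_pull (homotopy nabla (dA br nabla w)) S.
pose r3 := eval_pull w S.
have s1 : smooth_sect r1 by exact: (eval_pull_smooth HB HE HF hhd hS).
have s3 : smooth_sect r3 by exact: (eval_pull_smooth HB HE HF hw hS).
have s1' := smooth_sect_scale HT HF (smooth_cst HT (-1)) s1.
pose r y := r3 y + (-1) *: r1 y.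
have hr : smooth_sect r by exact: (smooth_sect_add HT HF).
have L y : nabla (@euler R B E y) r + 0%:R *: r y = 0.
  have L1 := homotopy_lie HB HE HF hc hd (S := S) y s1.
  have L1' : nabla (euler y) r1 + 0%:R *: r1 y = eval_euler (dA br nabla w) S y.
    exact: L1.
  rewrite scale0r addr0 in L1'; rewrite scale0r addr0.
  rewrite /r (conn_add hc) // (nablaZ HB HE hc) // L1'.
  by rewrite (dA_euler0 HB HE HF hbr hc) // -/r3 scaleN1r subrr.
have := lie0_transport HB HE HF hc hr L v (erefl _).
(* On the zero section r is w itself, so the transported value is the one in the statement. *)
rewrite /r (_ : r1 (dilate 0 v) = 0) ?scaler0 ?addr0; last first.
  rewrite /r1 /eval_pull /dilate scale0r.
  exact: (homotopy_at_zero HB HE HF hc hd).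
move=> ->; rewrite -[w v _]/(r3 v) scaleN1r opprD opprK addrA subrr add0r.
by [].
Qed.

End HomotopyIdentity.

Lemma section_form_is_form (R : realType) (M : atlas R) (A F : prebundle M)
    (r : sect F) : smooth_sect r -> is_form (section_form (A := A) r).
Proof.
move=> hr; split=> [x u [] //|x u [] //|i j b c].
by apply: smooth_onS (hr j c) => x [].
Qed.

Theorem proposition4p2 (R : realType) (B : atlas R) (E : prebundle B)
    (F : prebundle (total_space E))
    (br : sect (pullE E) -> sect (pullE E) -> sect (pullE E))
    (nabla : forall v : total_space E, pullE E v -> sect F -> F v)
    (B_manifold : is_manifold B) (E_vbundle : is_vbundle E)
    (F_vbundle : is_vbundle F)
    (br_lie : is_lie_algebroid (@vlift R B E) br)
    (br_pull : forall s1 s2 : sect E, smooth_sect s1 -> smooth_sect s2 ->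
       forall v, br (pull_sect s1) (pull_sect s2) v = 0)
    (nabla_rep : is_representation (@vlift R B E) br nabla) :
  [/\ (forall (k : nat) (w : preform (pullE E) F k.+1),
         is_form w -> is_form (homotopy nabla w)),
      (forall (k : nat) (w : preform (pullE E) F k), is_form w ->
         forall (v : total_space E) (u : 'I_k -> pullE E v),
           is_cvg0 (fun t => Psi nabla t w u) /\
           homotopy nabla (dA br nabla w) u + d_homotopy br nabla w u =
           w v u - Psi0 nabla w u),
      (forall (k : nat) (w : preform (pullE E) F k), (0 < k)%N -> is_form w ->
         forall (v : total_space E) (u : 'I_k -> pullE E v),
           homotopy nabla (dA br nabla w) u + d_homotopy br nabla w u = w v u)
    & (forall w : sect F, smooth_sect w ->
         forall (v : total_space E) (u : 'I_0 -> pullE E v),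
           homotopy nabla (dA br nabla (section_form (A := pullE E) w)) u =
           w v - transport nabla 0 v
                   (tpt (w (zero_section E (bproj v)))))].
Proof.
have HB := manifold_pre B_manifold; have [hc hflat] := nabla_rep.
have key k (w : preform (pullE E) F k) (hk : (0 < k)%N) (hw : is_form w) v u :=
  homotopy_identity HB E_vbundle F_vbundle br_lie br_pull hc hflat (v := v) u hk hw.
split.
- by move=> k w hw; exact: (homotopy_form HB E_vbundle F_vbundle hc hw).
- move=> k w hw v u.
  have [m [e [c [W [hF hW]]]]] := coframe_ray HB E_vbundle F_vbundle v.
  have [cv psi] : is_cvg0 (fun t => Psi nabla t w u) /\ Psi0 nabla w u =
      0 ^+ k *: transport nabla 0 v (tpt (w (dilate 0 v) (u : 'I_k -> pullE E (dilate 0 v)))).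
    case: v u hW => b ve u hW.
    apply: (Psi_limit HB E_vbundle F_vbundle hc hF _ _ hw) => s /unit_itv2.
    exact: hW.
  (* The factor [0 ^+ k] in the limit separates degree 0, where the transported value remains, from
     positive degrees, where the limit is 0. *)
  split=> //; rewrite psi; case: k w hw u cv psi => [|k] w hw u _ _.
    rewrite expr0 scale1r addr0.
    exact: (homotopy_identity0 HB E_vbundle F_vbundle br_lie br_pull hc).
  by rewrite expr0n scale0r subr0 key.
- by move=> k w hk hw v u; exact: key.
- move=> w hw v u.
  have hf := section_form_is_form (pullE E) hw.
  rewrite (homotopy_identity0 HB E_vbundle F_vbundle br_lie br_pull hc _ hf).
  congr (_ - transport _ _ _ _); rewrite /section_form.
  by rewrite (_ : dilate 0 v = zero_section E (bproj v)) // /dilate scale0r.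
Qed.
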